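(* Let $f\colon\mathbb{N}\to\mathbb{R}$ be a strongly additive function with $|f(p)|\le M$ for all primes $p$, where $M>0$ is constant, and let $\alpha\in\mathcal{M}^{\ast}$ with parameters $A_0,\beta,\sigma_0,\vartheta_0,\varrho_0,r$. (1) If $\beta=1$ and $0<h_0<(3/2)^{2/3}$ is arbitrary, and if $B(x)\to\infty$ as $x\to\infty$, then $$M(x;m)=C_mB(x)^{\frac{m}{2}}\left(\chi_m+O\left(\frac{Mm^{\frac{3}{2}}}{\sqrt{B(x)}}\right)\right)$$ uniformly for all sufficiently large $x$ and all integers $m$ with $1\le m\le h_0(B(x)/M^2)^{1/3}$. (2) If $\beta\ne1$ and if $B(x)/(\log\log\log x)^2\to\infty$ as $x\to\infty$, then $$M(x;m)=C_mB(x)^{\frac{m}{2}}\left(\chi_m+O\left(\frac{Mm^{\frac{3}{2}}\log\log\log x}{\sqrt{B(x)}}\right)\right)$$ uniformly for all sufficiently large $x$ and all integers $m$ with $1\le m\ll B(x)^{1/3}/(\log\log\log x)^{2/3}$. The implicit constants in the error terms of both asymptotic formulas depend at most on the explicit and implicit constants in the hypotheses except for $M$.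
   Context: $\mathbb{N}$ is the set of positive integers; $p$ always denotes a prime and $p^\nu$ ($\nu\ge1$) a prime power. A function $f\colon\mathbb{N}\to\mathbb{R}$ is additive if $f(mn)=f(m)+f(n)$ whenever $\gcd(m,n)=1$, and strongly additive if moreover $f(p^\nu)=f(p)$ for all prime powers $p^\nu$. The class $\mathcal{M}^{\ast}$ consists of the multiplicative functions $\alpha\colon\mathbb{N}\to\mathbb{R}_{\ge0}$ for which there exist constants (called the parameters of $\alpha$) $A_0,\beta,\sigma_0>0$, $\vartheta_0\ge0$, $\varrho_0\in[0,1)$ and $r\in(0,1)$ such that: (i) $\alpha(p^{\nu})\ll p^{(\varrho_0+\sigma_0-1)\nu}$ for all prime powers $p^\nu$; (ii) $\sum_{p\le x}\frac{\alpha(p)\log p}{p^{\sigma_0-1}}=\beta x+O\left(\frac{x}{(\log x)^{A_0}}\right)$; (iii) $\sum_{p}'\left(\frac{\alpha(p)^2}{p^{2(r+\sigma_0-1)}}+\sum_{\nu\ge2}\frac{\alpha(p^{\nu})}{p^{(r+\sigma_0-1)\nu}}\right)<\infty$, where $\sum_p'$ runs over all but finitely many primes; (iv) $\sum_{\nu\ge1}\frac{\nu\alpha(p^{\nu})}{p^{\sigma_0\nu}}\ll\frac{(\log\log(p+1))^{\vartheta_0}}{p}$ for all primes $p$. Put $$S(x)=\sum_{n\le x}\alpha(n),\quad A(x)=\sum_{p\le x}\alpha(p)\frac{f(p)}{p^{\sigma_0}},\quad B(x)=\sum_{p\le x}\alpha(p)\frac{f(p)^2}{p^{\sigma_0}},$$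 $$M(x;m)=S(x)^{-1}\sum_{n\le x}\alpha(n)(f(n)-A(x))^m,\quad \chi_m=\frac{1+(-1)^m}{2},\quad C_m=\frac{m!}{2^{m/2}\,\Gamma(m/2+1)}\qquad(m\in\mathbb{N}).$$ A range condition $m\ll Q(x)$ means $m\le cQ(x)$ for a fixed constant $c>0$, which counts among the implicit constants of the hypotheses. Likewise $h_0$ is one of the explicit constants. *)

(* Defs.v *)
From HB Require Import structures.
From mathcomp Require Import all_boot all_order all_algebra.
From mathcomp Require Import all_classical all_reals all_analysis.

Set Implicit Arguments.
Unset Strict Implicit.
Unset Printing Implicit Defensive.
Import Order.TTheory GRing.Theory Num.Theory.
Import numFieldNormedType.Exports.
Local Open Scope classical_set_scope.
Local Open Scope ring_scope.

(* Arithmetic functions are functions [nat -> R] of which only the values at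
   positive integers matter. *)
Definition additive_arith (R : realType) (f : nat -> R) : Prop :=
  forall m n : nat, (0 < m)%N -> (0 < n)%N -> coprime m n ->
    f (m * n)%N = f m + f n.

Definition strongly_additive (R : realType) (f : nat -> R) : Prop :=
  additive_arith f /\
  forall p nu : nat, prime p -> (0 < nu)%N -> f (p ^ nu)%N = f p.

Definition multiplicative_arith (R : realType) (alpha : nat -> R) : Prop :=
  alpha 1%N = 1 /\
  forall m n : nat, (0 < m)%N -> (0 < n)%N -> coprime m n ->
    alpha (m * n)%N = alpha m * alpha n.

(* Membership in the class M^* with prescribed parameters
   A0, beta, sigma0, theta0, rho0, r and prescribed implicit constants:
   K1, K2, K4 are the constants of the Vinogradov and Landau symbols in the
   first, second and fourth conditions; E is the finite set of primes omitted
   from the third condition and K3 a bound for the (extended real) value of the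
   sum there. *)
Definition Mstar_with (R : realType) (A0 beta sigma0 theta0 rho0 r : R)
    (K1 K2 : R) (E : seq nat) (K3 K4 : R) (alpha : nat -> R) : Prop :=
  [/\ [/\ 0 < A0, 0 < beta & 0 < sigma0],
      [/\ 0 <= theta0, 0 <= rho0 < 1 & 0 < r < 1],
      multiplicative_arith alpha,
      (forall n : nat, (0 < n)%N -> 0 <= alpha n) &
  [/\ (forall p nu : nat, prime p -> (0 < nu)%N ->
         alpha (p ^ nu)%N <= K1 * p%:R `^ ((rho0 + sigma0 - 1) * nu%:R)),
      (forall x : R, 2 <= x ->
         `| \sum_(1 <= p < (Num.truncn x).+1 | prime p)
              alpha p * ln p%:R / p%:R `^ (sigma0 - 1) - beta * x |
         <= K2 * (x / ln x `^ A0)),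
      (\sum_(0 <= p <oo | prime p && (p \notin E))
         ((alpha p ^+ 2 / p%:R `^ (2 * (r + sigma0 - 1)))%:E
          + \sum_(2 <= nu <oo)
              (alpha (p ^ nu)%N / p%:R `^ ((r + sigma0 - 1) * nu%:R))%:E)
       <= K3%:E)%E &
      (forall p : nat, prime p ->
         (\sum_(1 <= nu <oo)
            (nu%:R * alpha (p ^ nu)%N / p%:R `^ (sigma0 * nu%:R))%:E
          <= (K4 * (ln (ln p.+1%:R) `^ theta0 / p%:R))%:E)%E)]].

Definition Mstar (R : realType) (alpha : nat -> R) : Prop :=
  exists A0 beta sigma0 theta0 rho0 r K1 K2 : R,
  exists E : seq nat, exists K3 K4 : R,
    Mstar_with A0 beta sigma0 theta0 rho0 r K1 K2 E K3 K4 alpha.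

Definition Ssum (R : realType) (alpha : nat -> R) (x : R) : R :=
  \sum_(1 <= n < (Num.truncn x).+1) alpha n.

Definition Asum (R : realType) (alpha f : nat -> R) (sigma0 x : R) : R :=
  \sum_(1 <= p < (Num.truncn x).+1 | prime p)
    alpha p * (f p / p%:R `^ sigma0).

Definition Bsum (R : realType) (alpha f : nat -> R) (sigma0 x : R) : R :=
  \sum_(1 <= p < (Num.truncn x).+1 | prime p)
    alpha p * (f p ^+ 2 / p%:R `^ sigma0).

Definition Mmoment (R : realType) (alpha f : nat -> R) (sigma0 x : R)
    (m : nat) : R :=
  (Ssum alpha x)^-1 *
  \sum_(1 <= n < (Num.truncn x).+1)
    alpha n * (f n - Asum alpha f sigma0 x) ^+ m.

Definition chi (R : realType) (m : nat) : R := (1 + (-1) ^+ m) / 2.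

(* Euler's integral, used for s > 0 only. *)
Definition Gamma (R : realType) (s : R) : R :=
  \int[@lebesgue_measure R]_(t in `]0, +oo[) (t `^ (s - 1) * expR (- t)).

Definition Cconst (R : realType) (m : nat) : R :=
  m`!%:R / (2 `^ (m%:R / 2) * Gamma (m%:R / 2 + 1)).

Definition logloglog (R : realType) (x : R) : R := ln (ln (ln x)).

(* Main.v *)
Require Import Defs.
From HB Require Import structures.
From mathcomp Require Import all_boot all_order all_algebra.
From mathcomp Require Import all_classical all_reals all_analysis.
From mathcomp Require Import measurable_realfun.
From mathcomp Require Import ring lra zify.

Set Implicit Arguments.
Unset Strict Implicit.
Unset Printing Implicit Defensive.
Import Order.TTheory GRing.Theory Num.Theory.
Import numFieldNormedType.Exports.
Local Open Scope classical_set_scope.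
Local Open Scope ring_scope.

(** Why the theorem is true.  Put b n = alpha n / n^sigma0, N the integer part
    of x and L = ln N, and rescale f so that the values at primes are bounded by 1.
    The proof compares the weighted integers n <= N with a product model: for
    every prime p <= N draw an exponent v_p independently, with probability
    proportional to b (p^v).  The random integer Z = prod p^(v_p), conditioned on
    Z <= N, has the law of n <= N weighted by b ([model_link]).

    (a) In the model f(Z), centred, is a sum W of independent variables bounded
    by 1.  Its moments satisfy E W^(j+1) = j s^2 E W^(j-1) up to an error of
    lower order ([stein]), where s^2 is the variance of W.  The constants C_m
    obey the same recursion exactly, by the functional equation of Gamma, so
    induction gives E W^m = (chi_m + O(m^(3/2)/s)) C_m s^m as long as m^(3/2) = O(s)
    ([moment_asymptotics]).

    (b) Conditioning on Z <= N hardly changes these moments.  Revealing the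
    exponents from the smallest prime on, the covariance of W^m with the event
    Z <= N is at most the sum over p of the influence of v_p on W^m, of size
    m (|W| + 2)^(m-1), times its influence on the conditional probability of Z <= N
    ([covariance]).  The latter is the probability that the
    part of ln Z carried by the primes above p falls into a window of length O(ln p),
    which is O((ln p / L)^g) ([model_anticoncentration]); weighting by
    b p and summing over p gives O(1) ([rho_below_rate]).  The event Z <= N has
    probability bounded below ([model_below_lower]).

    (c) Weighting by alpha n = b n n^sigma0 instead of b n costs equally little.
    Writing ln n as a sum over the prime powers exactly dividing n and using the
    prime number theorem with weights alpha, which the class prescribes, for the
    sum over the prime, L * sum alpha n g n becomes beta / sigma0 * N^sigma0 * sum b m g m, with an
    error in which g is replaced by its variation under m -> p^v m or multiplied
    by L^(-A/2) ([log_reduction]).  For g = (f - A(x))^m this is an error of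
    relative size O(m^(3/2)/s).

    Together these give [normalised_moments]; the mean and the variance in the model
    differ from A(x) and B(x) by O(1) ([centre_close], [model_variance_close]).  Both
    halves of the theorem are instances of [uniform_moments]: in the second half the range of m and
    the error term are weakened by powers of logloglog x, which tends to infinity. *)

Ltac nonneg := repeat first
  [ assumption | (apply: ltW; assumption) | exact: ler01 | exact: ler0n
  | apply: normr_ge0 | apply: sqr_ge0
  | apply: exprn_ge0 | apply: powR_ge0 | apply: sqrtr_ge0 | apply: expR_ge0
  | apply: addr_ge0 | apply: mulr_ge0 | rewrite invr_ge0 | done ].

(** * Values of the Gamma function *)

Section GammaIntegral.
Variable R : realType.
Implicit Types (s t : R).
Notation mu := (@lebesgue_measure R).

Notation J g := (\int[mu]_(t in `[0%R, +oo[) (g t)%:E)%E.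
Notation msr g := (measurable_fun (`[0, +oo[ : set R) (g : R -> R)).

(** Gamma before truncation to the reals: nonnegative integrands make linearity and monotone limits available without checking integrability. *)
Definition gammaE s : \bar R := J (fun t => t `^ (s - 1) * expR (- t)).

Lemma half_line_integralD (g1 g2 : R -> R) :
  (forall t, 0 <= t -> 0 <= g1 t) -> (forall t, 0 <= t -> 0 <= g2 t) ->
  msr g1 -> msr g2 -> J (fun t => g1 t + g2 t) = (J g1 + J g2)%E.
Proof.
move=> g10 g20 m1 m2; rewrite -ge0_integralD//.
- by move=> t; rewrite /= in_itv/= andbT => /g10; rewrite lee_fin.
- exact/measurable_EFinP.
- by move=> t; rewrite /= in_itv/= andbT => /g20; rewrite lee_fin.
- exact/measurable_EFinP.
Qed.

Lemma half_line_integralZ (k : R) (g : R -> R) :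
  0 <= k -> (forall t, 0 <= t -> 0 <= g t) -> msr g ->
  J (fun t => k * g t) = (k%:E * J g)%E.
Proof.
move=> k0 g0 mg; rewrite -ge0_integralZl_EFin//.
- by move=> t; rewrite /= in_itv/= andbT => /g0; rewrite lee_fin.
- exact/measurable_EFinP.
Qed.

Lemma half_line_integral_le (g1 g2 : R -> R) :
  (forall t, 0 <= t -> 0 <= g1 t <= g2 t) -> msr g1 -> msr g2 ->
  (J g1 <= J g2)%E.
Proof.
move=> h m1 m2; apply: ge0_le_integral => //.
- by move=> t; rewrite /= in_itv/= andbT => /h/andP[]; rewrite lee_fin.
- exact/measurable_EFinP.
- exact/measurable_EFinP.
- by move=> t; rewrite /= in_itv/= andbT => /h/andP[]; rewrite lee_fin.
Qed.

Lemma measurable_gamma_integrand s (D : set R) :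
  measurable_fun D (fun t => t `^ (s - 1) * expR (- t)).
Proof.
apply: measurable_funM; first exact: measurable_funTS.
apply: measurable_funTS; apply: measurableT_comp => //.
Qed.

Lemma gamma_integrand_ge0 s t : 0 <= t `^ (s - 1) * expR (- t).
Proof. by rewrite mulr_ge0 ?powR_ge0 ?expR_ge0. Qed.

Lemma GammaE s : Gamma s = fine (gammaE s).
Proof.
rewrite /Gamma /Rintegral /gammaE integral_itv_obnd_cbnd//.
by apply/measurable_EFinP; exact: measurable_gamma_integrand.
Qed.

Lemma right_continuous_powR s : 0 <= s -> (t `^ s) @[t --> 0^'+] --> (0 : R) `^ s.
Proof.
rewrite le_eqVlt => /orP[/eqP <-|s0].
  by rewrite powRr0; under eq_fun do rewrite powRr0; exact: cvg_cst.
by rewrite powR0 ?gt_eqF//; exact: powR_cvg0.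
Qed.

Lemma continuous_powR_gt0 s t : 0 < t -> {for t, continuous (fun u => u `^ s)}.
Proof.
by move=> t0; apply: differentiable_continuous; apply/derivable1_diffP;
   apply: derivable_powR; rewrite in_itv/= andbT.
Qed.

Lemma powR_le_expR s a t : 0 < s -> 0 < a -> 0 <= t ->
  t `^ s <= (s / a) `^ s * expR (a * t).
Proof.
move=> s0 a0; rewrite le_eqVlt => /orP[/eqP <-|t0].
  by rewrite powR0 ?gt_eqF// mulr_ge0 ?powR_ge0 ?expR_ge0.
have sa0 : 0 < s / a by rewrite divr_gt0.
rewrite /powR !gt_eqF// -expRD ler_expR.
have -> : t = (s / a) * (t / (s / a)) by rewrite mulrC divfK// gt_eqF.
have u0 : 0 < t / (s / a) by rewrite divr_gt0.
rewrite lnM ?posrE// mulrDr lerD2l.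
have -> : a * (s / a * (t / (s / a))) = s * (t / (s / a)).
  by field; rewrite !gt_eqF.
by rewrite ler_wpM2l ?(ltW s0)//; apply/ltW/ln_sublinear.
Qed.

Lemma cvg_powR_expRN s : 0 < s -> (t `^ s * expR (- t)) @[t --> +oo] --> (0 : R).
Proof.
move=> s0.
have h : (((s / 2^-1) `^ s * expR (- (2^-1 * t))) : R) @[t --> +oo] --> (0 : R).
  rewrite -[X in _ --> X](mulr0 ((s / 2^-1) `^ s)).
  apply: cvgM; first exact: cvg_cst.
  rewrite (_ : (fun x => expR (- (2^-1 * x))) =
               (fun z => expR (- z)) \o (fun z => 2^-1 * z :> R))//.
  apply: (@cvg_comp _ _ _ _ _ _ (pinfty_nbhs R)); last exact: cvgr_expR.
  by apply: gt0_cvgMry => //; rewrite ?invr_gt0.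
apply: (squeeze_cvgr _ (cvg_cst 0) h).
near=> t.
have t0 : 0 <= t by near: t; exact: nbhs_pinfty_ge.
rewrite mulr_ge0 ?powR_ge0 ?expR_ge0//=.
have a0 : (0 : R) < 2^-1 by rewrite invr_gt0.
apply: (le_trans (ler_wpM2r (expR_ge0 _) (powR_le_expR s0 a0 t0))).
rewrite -mulrA -expRD ler_wpM2l ?powR_ge0// ler_expR; lra.
Unshelve. all: by end_near. Qed.

Lemma gammaE1 : gammaE 1 = 1%E.
Proof.
have cont1 : continuous (fun t : R => expR (- t)).
  move=> t; apply: continuous_comp; last exact: continuous_expR.
  by apply: (@continuousN _ R^o).
rewrite /gammaE.
under eq_integral do rewrite subrr powRr0 mul1r.
rewrite (@ge0_continuous_FTC2y _ _ (fun t => - (expR (- t))) 0 0).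
- by rewrite sub0e -EFinN opprK oppr0 expR0.
- by move=> t _; exact: expR_ge0.
- by apply: continuous_subspaceT.
- by rewrite -oppr0; apply: cvgN; exact: cvgr_expR.
- by move=> t t0; apply: derivableN; apply: ex_derive.
- by apply: cvgN; apply: cvg_at_right_filter; exact: cont1.
- move=> t _.
  have h3 : is_derive t 1 (fun u : R => expR (- u)) (- expR (- t)).
    by apply: is_derive_eq; rewrite /GRing.scale/= ?mulr1 ?mulN1r ?mulrN1.
  have h5 := is_deriveN h3.
  by rewrite derive1E derive_val opprK.
Qed.

(** Integration by parts.  With K = s^s the function (t^s + K) exp(-t) is decreasing, so the
    fundamental theorem of calculus for integrands of constant sign applies on the half-line. *)
Lemma gammaES s : 1 <= s -> gammaE (s + 1) = (s%:E * gammaE s)%E.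
Proof.
move=> s1.
have s0 : 0 < s by lra.
pose K := s `^ s.
have K0 : 0 <= K by exact: powR_ge0.
have sub t : 0 <= t -> s * t `^ (s - 1) <= t `^ s + K.
  move=> t0; have [ts|st] := leP t s.
    apply: (@le_trans _ _ K); last by rewrite lerDr powR_ge0.
    rewrite /K -(mulr_powRB1 (ltW s0) s0) ler_wpM2l ?(ltW s0)//.
    by apply: ge0_ler_powR; rewrite ?nnegrE ?subr_ge0 // ltW.
  apply: (@le_trans _ _ (t `^ s)); last by rewrite lerDl.
  by rewrite -(mulr_powRB1 t0 s0) ler_wpM2r ?powR_ge0// ltW.
pose f t := (t `^ s + K - s * t `^ (s - 1)) * expR (- t).
have cont1 : continuous (fun t : R => expR (- t)).
  move=> t; apply: continuous_comp; last exact: continuous_expR.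
  by apply: (@continuousN _ R^o).
have int_f : (\int[mu]_(t in `[0%R, +oo[) (f t)%:E = K%:E)%E.
  rewrite (@ge0_continuous_FTC2y _ f (fun t => - ((t `^ s + K) * expR (- t))) 0 0).
  - by rewrite sub0e -EFinN opprK oppr0 expR0 mulr1 powR0 ?add0r// gt_eqF.
  - by move=> t t0; rewrite /f mulr_ge0 ?expR_ge0// subr_ge0 sub.
  - apply/continuous_within_itvcyP; split.
      move=> t; rewrite in_itv/= andbT => t0; rewrite /f.
      apply: cvgM; last exact: cont1.
      apply: cvgB; last first.
        by apply: cvgM; [exact: cvg_cst|exact: continuous_powR_gt0].
      by apply: cvgD; [exact: continuous_powR_gt0|exact: cvg_cst].
    rewrite /f; apply: cvgM; last by apply: cvg_at_right_filter; exact: cont1.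
    apply: cvgB; last first.
      by apply: cvgM; [exact: cvg_cst|apply: right_continuous_powR; lra].
    by apply: cvgD; [apply: right_continuous_powR; lra|exact: cvg_cst].
  - rewrite -oppr0; apply: cvgN.
    have h : (t `^ s * expR (- t) + K * expR (- t)) @[t --> +oo] --> (0 + K * 0 : R).
      apply: cvgD; first exact: cvg_powR_expRN.
      by apply: cvgM; [exact: cvg_cst|exact: cvgr_expR].
    rewrite mulr0 addr0 in h.
    by under eq_fun do rewrite mulrDl.
  - move=> t t0; apply: derivableN; apply: derivableM.
      apply: derivableD => //.
      by apply: derivable_powR; rewrite in_itv/= andbT.
    by apply: ex_derive.
  - apply: cvgN; apply: cvgM; last by apply: cvg_at_right_filter; exact: cont1.
    by apply: cvgD; [apply: right_continuous_powR; lra|exact: cvg_cst].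
  - move=> t; rewrite in_itv/= andbT => t0.
    have h1 := is_derive1_powR s t0.
    have h2 : is_derive t 1 (fun u : R => u `^ s + K) (s * t `^ (s - 1) + 0).
      by apply: is_deriveD.
    have h3 : is_derive t 1 (fun u : R => expR (- u)) (- expR (- t)).
      by apply: is_derive_eq; rewrite /GRing.scale/= ?mulr1 ?mulN1r ?mulrN1.
    have h4 := is_deriveM h2 h3.
    have h5 := is_deriveN h4.
    rewrite derive1E derive_val /f /GRing.scale /=; ring.
have mg v : msr (fun t => t `^ (v - 1) * expR (- t)).
  exact: measurable_gamma_integrand.
have mE : msr (fun t => expR (- t)).
  by apply: measurable_funTS; exact: continuous_measurable_fun.
have g0 := gamma_integrand_ge0.
have IK : K%:E = J (fun t => K * (t `^ (1 - 1) * expR (- t))).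
  by rewrite half_line_integralZ// -[X in (_ * X)%E]/(gammaE 1) gammaE1 mule1.
have e1 : (gammaE (s + 1) + K%:E = K%:E + s%:E * gammaE s)%E.
  have mK v : msr (fun t => v * (t `^ (1 - 1) * expR (- t))) by exact: measurable_funM.
  have mf : msr f.
    apply: measurable_funM => //.
    apply: measurable_funB; last by apply: measurable_funM => //; exact: measurable_funTS.
    by apply: measurable_funD => //; exact: measurable_funTS.
  pose g1 t := t `^ (s + 1 - 1) * expR (- t).
  pose g2 t := K * (t `^ (1 - 1) * expR (- t)).
  pose g3 t := s * (t `^ (s - 1) * expR (- t)).
  have -> : (gammaE (s + 1) + K%:E = J (fun t => g1 t + g2 t))%E.
    rewrite IK half_line_integralD.
    - by [].
    - by move=> t _; exact: g0.
    - by move=> t _; rewrite mulr_ge0.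
    - exact: mg.
    - exact: mK.
  have -> : (K%:E + s%:E * gammaE s = J (fun t => f t + g3 t))%E.
    rewrite half_line_integralD.
    - by rewrite int_f half_line_integralZ// ltW.
    - by move=> t t0; rewrite mulr_ge0 ?expR_ge0// subr_ge0 sub.
    - by move=> t t0; rewrite mulr_ge0 ?(ltW s0)//; exact: g0.
    - exact: mf.
    - by apply: measurable_funM => //; exact: mg.
  apply: eq_integral => t _; rewrite /f /g1 /g2 /g3 addrK subrr powRr0.
  by congr EFin; ring.
by rewrite -[LHS](@addeK _ K%:E)// e1 addeC addeA [(- _ + _)%E]addeC subee// add0e.
Qed.

Lemma gammaE_ge0 s : (0 <= gammaE s)%E.
Proof.
by apply: integral_ge0 => t _; rewrite lee_fin mulr_ge0 ?powR_ge0 ?expR_ge0.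
Qed.

Lemma Gamma1 : Gamma 1 = 1 :> R.
Proof. by rewrite GammaE gammaE1. Qed.

Lemma GammaS s : 1 <= s -> Gamma (s + 1) = s * Gamma s.
Proof.
move=> s1; rewrite !GammaE gammaES//.
have s0 : 0 < s by lra.
by case: (gammaE s) => [x| |]; rewrite ?gt0_muley ?gt0_muleNy ?lte_fin//= mulr0.
Qed.

(** Seeds the recursion at half-integers.  The factor sqrt t lies between polynomials,
    (3 t - t^2)/2 <= sqrt t <= 1 + t, whose integrals against exp(-t) are known; the upper bound
    gives finiteness, the lower one positivity. *)
Lemma Gamma32_gt0 : 0 < Gamma (3 / 2 : R).
Proof.
have I2 : gammaE 2 = 1%E.
  by rewrite -[2]/(1 + 1) gammaES// mul1e gammaE1.
have I3 : gammaE 3 = 2%:E.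
  have -> : (3 : R) = 2 + 1 by lra.
  by rewrite gammaES ?I2 ?mule1// ler1n.
have mg v : msr (fun t => t `^ (v - 1) * expR (- t)).
  exact: measurable_gamma_integrand.
have g0 := gamma_integrand_ge0.
have E0 t : 0 <= expR (- t) :> R by exact: expR_ge0.
have pw (t : R) : 0 <= t -> [/\ t `^ (3 / 2 - 1) = Num.sqrt t, t `^ (1 - 1) = 1,
    t `^ (2 - 1) = t & t `^ (3 - 1) = t ^+ 2].
  move=> t0; rewrite (_ : 3 / 2 - 1 = 2^-1 :> R) ?powR12_sqrt//; last lra.
  rewrite subrr powRr0 (_ : 2 - 1 = 1 :> R) ?powRr1//; last lra.
  by rewrite (_ : 3 - 1 = 2%:R :> R) ?powR_mulrn//; lra.
have up : (gammaE (3 / 2) <= gammaE 1 + gammaE 2)%E.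
  rewrite /gammaE -half_line_integralD//.
  apply: half_line_integral_le => //; last exact: measurable_funD.
  move=> t t0; rewrite g0/=.
  have [-> -> -> _] := pw _ t0.
  rewrite -mulrDl ler_wpM2r//.
  have s0 := sqrtr_ge0 t; rewrite -{2}(sqr_sqrtr t0); nra.
have lo : ((3 / 2)%:E * gammaE 2 <= gammaE (3 / 2) + 2^-1%:E * gammaE 3)%E.
  have c32 : 0 <= (3 / 2 : R) by lra.
  rewrite /gammaE -!half_line_integralZ ?invr_ge0//.
  have mZ k v : msr (fun t => k * (t `^ (v - 1) * expR (- t))) by exact: measurable_funM.
  have gZ k v t : 0 <= k -> 0 <= k * (t `^ (v - 1) * expR (- t)).
    by move=> k0; rewrite mulr_ge0.
  rewrite -half_line_integralD//; last by move=> t _; rewrite gZ ?invr_ge0.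
  apply: half_line_integral_le => //; last exact: measurable_funD.
  move=> t t0; rewrite gZ; last lra.
  have [-> _ -> ->] := pw _ t0.
  rewrite !mulrA -mulrDl ler_wpM2r//.
  move: (Num.sqrt t) (sqrtr_ge0 t) (sqr_sqrtr t0) => u s0 <-.
  rewrite -subr_ge0 [X in 0 <= X](_ : _ = u * (u - 1) ^+ 2 * (u + 2) / 2); last by field.
  have h1 := sqr_ge0 (u - 1).
  by apply: divr_ge0 => //; apply: mulr_ge0; [exact: mulr_ge0|exact: addr_ge0].
rewrite GammaE; move: up lo (gammaE_ge0 (3 / 2)); rewrite I2 I3 gammaE1.
case: (gammaE (3 / 2)) => [x| |] //; rewrite -?EFinM -?EFinD !lee_fin /= => up lo; first by move=> _; lra.
Qed.
End GammaIntegral.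

(** * Independent exponents: expectations, an approximate moment recursion, covariances *)

Section PowerBounds.
Variable R : realType.
Implicit Types x y d e : R.

Lemma power_increment x y n :
  `|(x + y) ^+ n.+1 - x ^+ n.+1| <= `|y| * n.+1%:R * (`|x| + `|y|) ^+ n.
Proof.
have xy0 : 0 <= `|x| + `|y| by rewrite addr_ge0.
rewrite subrXX (_ : x + y - x = y) ?normrM -?mulrA; last by ring.
rewrite ler_wpM2l//.
apply: (le_trans (ler_norm_sum _ _ _)).
have -> : n.+1%:R * (`|x| + `|y|) ^+ n = \sum_(i < n.+1) (`|x| + `|y|) ^+ n.
  by rewrite sumr_const card_ord mulr_natl.
apply: ler_sum => i _; rewrite normrM !normrX.
have -> : (`|x| + `|y|) ^+ n = (`|x| + `|y|) ^+ (n - i) * (`|x| + `|y|) ^+ i.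
  by rewrite -exprD subnK// -ltnS.
rewrite ler_pM ?exprn_ge0//.
  by rewrite lerXn2r ?nnegrE// ler_normD.
by rewrite lerXn2r ?nnegrE// lerDl.
Qed.

Lemma power_increment_diff x d e n : `|d| <= 1 -> `|e| <= 1 ->
  `|(x + d) ^+ n.+1 - (x + e) ^+ n.+1| <= `|d - e| * n.+1%:R * (`|x| + 1) ^+ n.
Proof.
move=> d1 e1; rewrite subrXX (_ : x + d - (x + e) = d - e); last by ring.
rewrite normrM -mulrA ler_wpM2l//.
apply: (le_trans (ler_norm_sum _ _ _)).
have -> : n.+1%:R * (`|x| + 1) ^+ n = \sum_(i < n.+1) (`|x| + 1) ^+ n.
  by rewrite sumr_const card_ord mulr_natl.
apply: ler_sum => i _; rewrite normrM !normrX.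
have -> : (`|x| + 1) ^+ n = (`|x| + 1) ^+ (n - i) * (`|x| + 1) ^+ i.
  by rewrite -exprD subnK// -ltnS.
have x1 : 0 <= `|x| + 1 by rewrite addr_ge0.
have hD y : `|y| <= 1 -> `|x + y| <= `|x| + 1.
  by move=> y1; apply: (le_trans (ler_normD _ _)); rewrite lerD2l.
by rewrite ler_pM ?exprn_ge0// lerXn2r ?nnegrE ?hD.
Qed.

(** Second order Taylor bound, in a form uniform in the exponent: the error is measured by a lower power of (|x| + 1). *)
Lemma power_taylor2 x y n : `|y| <= 1 ->
  `|(x + y) ^+ n.+2 - x ^+ n.+2 - n.+2%:R * y * x ^+ n.+1| <=
  y ^+ 2 * n.+2%:R ^+ 2 * (`|x| + 1) ^+ n.
Proof.
move=> y1; elim: n => [|n IH].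
  rewrite (_ : _ - _ - _ = y ^+ 2); last by ring.
  rewrite ger0_norm ?sqr_ge0// expr0 mulr1 ler_peMr ?sqr_ge0//.
  by rewrite -natrX ler1n.
have -> : (x + y) ^+ n.+3 - x ^+ n.+3 - n.+3%:R * y * x ^+ n.+2 =
  (x + y) * ((x + y) ^+ n.+2 - x ^+ n.+2 - n.+2%:R * y * x ^+ n.+1) +
  n.+2%:R * y ^+ 2 * x ^+ n.+1.
  by rewrite !(exprS _ n.+2) !(exprS _ n.+1) -(natr1 n.+2); ring.
have x1 : 0 <= `|x| + 1 by rewrite addr_ge0.
have xD : `|x + y| <= `|x| + 1.
  by apply: (le_trans (ler_normD _ _)); rewrite lerD2l.
apply: (le_trans (ler_normD _ _)); rewrite normrM.
apply: (@le_trans _ _ ((`|x| + 1) * (y ^+ 2 * n.+2%:R ^+ 2 * (`|x| + 1) ^+ n) +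
   n.+2%:R * y ^+ 2 * (`|x| + 1) ^+ n.+1)).
  rewrite lerD ?ler_pM//.
  rewrite 2!normrM normr_nat (ger0_norm (sqr_ge0 y)) ler_wpM2l//; first by nonneg.
  by rewrite normrX lerXn2r ?nnegrE// lerDl.
rewrite (_ : _ + _ = y ^+ 2 * (n.+2%:R ^+ 2 + n.+2%:R) * (`|x| + 1) ^+ n.+1);
  last by rewrite (exprS (`|x| + 1) n); ring.
rewrite ler_wpM2r ?exprn_ge0// ler_wpM2l ?sqr_ge0//.
by rewrite -(natr1 n.+2); move: (n.+2%:R) (ler0n R n.+2) => z z0; nra.
Qed.

End PowerBounds.

Section ProductModel.
Variable R : realType.
Variable V : nat.
Variables (wt dev : nat -> nat -> R) (lg : nat -> R).
Implicit Types (ps : seq nat) (g : R -> R -> R) (a c : R).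

(** Expectation of g(a + W, c + U), where the exponents v_p, for p in the list, are
    independent with laws [wt p], and W and U are the sums of [dev p v_p] and of
    v_p * [lg p].  The starting points a and c make the recursion on the list compositional. *)
Fixpoint EE ps g a c : R :=
  if ps is p :: ps' then
    \sum_(v < V.+1) wt p v * EE ps' g (a + dev p v) (c + v%:R * lg p)
  else g a c.

Lemma EE_ext ps g g' a c : (forall x y, g x y = g' x y) ->
  EE ps g a c = EE ps g' a c.
Proof.
move=> e; elim: ps a c => //= p ps IH a c.
by apply: eq_bigr => v _; rewrite IH.
Qed.

Lemma EE_lin ps k g g' a c :
  EE ps (fun x y => k * g x y + g' x y) a c = k * EE ps g a c + EE ps g' a c.
Proof.
elim: ps a c => //= p ps IH a c.
under eq_bigr do rewrite IH mulrDr mulrCA.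
by rewrite big_split/= mulr_sumr.
Qed.

Lemma EE0 ps a c : EE ps (fun _ _ => 0) a c = 0.
Proof.
by elim: ps a c => //= p ps IH a c; rewrite big1// => v _; rewrite IH mulr0.
Qed.

Lemma EED ps g g' a c :
  EE ps (fun x y => g x y + g' x y) a c = EE ps g a c + EE ps g' a c.
Proof.
rewrite -[EE ps g a c]mul1r -EE_lin; apply: EE_ext => x y; by rewrite mul1r.
Qed.

Lemma EEZ ps k g a c : EE ps (fun x y => k * g x y) a c = k * EE ps g a c.
Proof.
rewrite -[RHS]addr0 -(EE0 ps a c) -EE_lin; apply: EE_ext => x y.
by rewrite addr0.
Qed.

Lemma EEB ps g g' a c :
  EE ps (fun x y => g x y - g' x y) a c = EE ps g a c - EE ps g' a c.
Proof.
rewrite addrC -mulN1r -EE_lin; apply: EE_ext => x y; by rewrite mulN1r addrC.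
Qed.

Lemma EE_sum ps n (h : 'I_n -> R -> R -> R) a c :
  EE ps (fun x y => \sum_(i < n) h i x y) a c = \sum_(i < n) EE ps (h i) a c.
Proof.
elim: n h => [|n IH] h.
  by rewrite big_ord0 -[RHS](EE0 ps a c); apply: EE_ext => x y; rewrite big_ord0.
rewrite big_ord_recl -IH -EED; apply: EE_ext => x y.
by rewrite big_ord_recl.
Qed.

Lemma EE_cat ps1 ps2 g a c :
  EE (ps1 ++ ps2) g a c = EE ps1 (fun x y => EE ps2 g x y) a c.
Proof.
by elim: ps1 a c => //= p ps1 IH a c; apply: eq_bigr => v _; rewrite IH.
Qed.

Lemma EE_shift ps g d e a c :
  EE ps g (a + d) (c + e) = EE ps (fun x y => g (x + d) (y + e)) a c.
Proof.
elim: ps a c => //= p ps IH a c; apply: eq_bigr => v _.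
by rewrite addrAC (addrAC c) IH.
Qed.

Lemma EE_snd_irrelevant ps (g : R -> R) a c c' :
  EE ps (fun x _ => g x) a c = EE ps (fun x _ => g x) a c'.
Proof.
by elim: ps a c c' => //= p ps IH a c c'; apply: eq_bigr => v _; rewrite (IH _ _ (c' + v%:R * lg p)).
Qed.

Lemma EE_fst_irrelevant ps (g : R -> R) a a' c :
  EE ps (fun _ y => g y) a c = EE ps (fun _ y => g y) a' c.
Proof.
by elim: ps a a' c => //= p ps IH a a' c; apply: eq_bigr => v _; rewrite (IH _ (a' + dev p v)).
Qed.

Hypothesis wt0 : forall p v, 0 <= wt p v.
Hypothesis lg0 : forall p, 0 <= lg p.

(** The second coordinate only increases, so g need only be compared on values at least c. *)
Lemma EE_le_supp ps g g' a c :
  (forall x y, c <= y -> g x y <= g' x y) -> EE ps g a c <= EE ps g' a c.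
Proof.
elim: ps a c => [|p ps IH] a c h //=; first exact: h.
apply: ler_sum => v _; rewrite ler_wpM2l// IH// => x y cy; apply: h.
by apply: le_trans cy; rewrite lerDl mulr_ge0.
Qed.

Lemma EE_le ps g g' a c :
  (forall x y, g x y <= g' x y) -> EE ps g a c <= EE ps g' a c.
Proof. by move=> h; apply: EE_le_supp => x y _. Qed.

Lemma EE_ge0 ps g a c : (forall x y, 0 <= g x y) -> 0 <= EE ps g a c.
Proof. by move=> h; rewrite -(EE0 ps a c); exact: EE_le. Qed.

Lemma EE_norm ps g a c : `|EE ps g a c| <= EE ps (fun x y => `|g x y|) a c.
Proof.
rewrite ler_norml -mulN1r -EEZ; apply/andP; split; apply: EE_le => x y.
  by rewrite mulN1r lerNl ler_normr lexx orbT.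
exact: ler_norm.
Qed.

Hypothesis wt1 : forall p, \sum_(v < V.+1) wt p v = 1.

Lemma wt_cst p k : k = \sum_(v < V.+1) wt p v * k.
Proof. by rewrite -mulr_suml wt1 mul1r. Qed.

Lemma EE_cst ps k a c : EE ps (fun _ _ => k) a c = k.
Proof.
elim: ps a c => //= p ps IH a c.
by under eq_bigr do rewrite IH; rewrite -mulr_suml wt1 mul1r.
Qed.

Notation E1 ps g a := (EE ps (fun x _ => g x) a 0).

Lemma E1_cons p ps (g : R -> R) a :
  E1 (p :: ps) g a = \sum_(v < V.+1) wt p v * E1 ps g (a + dev p v).
Proof.
by rewrite /=; apply: eq_bigr => v _; congr (_ * _); exact: EE_snd_irrelevant.
Qed.

Lemma E1_shift ps (g : R -> R) d a : E1 ps g (a + d) = E1 ps (fun x => g (x + d)) a.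
Proof.
by rewrite -[X in EE _ _ _ X](addr0 0) EE_shift.
Qed.

Hypothesis dev1 : forall p v, `|dev p v| <= 1.
Hypothesis dev0 : forall p, \sum_(v < V.+1) wt p v * dev p v = 0.

Definition var1 p := \sum_(v < V.+1) wt p v * dev p v ^+ 2.
Definition vars ps := \sum_(p <- ps) var1 p.

Lemma var1_ge0 p : 0 <= var1 p.
Proof. by apply: sumr_ge0 => v _; rewrite mulr_ge0 ?sqr_ge0. Qed.

Lemma norm_shift_le x p v n : (`|x| + 1) ^+ n <= (`|x + dev p v| + 2) ^+ n.
Proof.
rewrite lerXn2r ?nnegrE ?addr_ge0//.
have -> : x = x + dev p v - dev p v by ring.
apply: (@le_trans _ _ (`|x + dev p v| + `|dev p v| + 1)).
  by rewrite lerD2r; exact: ler_normB.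
by rewrite subrK; have := dev1 p v; lra.
Qed.

(** One step of the moment recursion: since [dev p] has mean 0, E (d (x + d)^(n+2)) is
    the linear Taylor term (n+2) E(d^2) x^(n+1) up to second order; replacing x by
    x + d in that term costs no more. *)
Lemma stein_one p n x :
  `|\sum_(v < V.+1) wt p v * (dev p v * (x + dev p v) ^+ n.+2)
    - n.+2%:R * var1 p * \sum_(v < V.+1) wt p v * (x + dev p v) ^+ n.+1|
  <= 2 * var1 p * n.+2%:R ^+ 2 * \sum_(v < V.+1) wt p v * (`|x + dev p v| + 2) ^+ n.
Proof.
have B : (`|x| + 1) ^+ n <= \sum_(v < V.+1) wt p v * (`|x + dev p v| + 2) ^+ n.
  rewrite [leLHS](wt_cst p); apply: ler_sum => v _.
  by rewrite ler_wpM2l// norm_shift_le.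
apply: (@le_trans _ _ (2 * var1 p * n.+2%:R ^+ 2 * (`|x| + 1) ^+ n)); last first.
  by have := var1_ge0 p; move=> ?; rewrite ler_wpM2l//; nonneg.
have s1 : `|\sum_(v < V.+1) wt p v * (dev p v * (x + dev p v) ^+ n.+2)
     - n.+2%:R * var1 p * x ^+ n.+1| <= var1 p * n.+2%:R ^+ 2 * (`|x| + 1) ^+ n.
  have -> : \sum_(v < V.+1) wt p v * (dev p v * (x + dev p v) ^+ n.+2)
      - n.+2%:R * var1 p * x ^+ n.+1 =
     \sum_(v < V.+1) wt p v * (dev p v * ((x + dev p v) ^+ n.+2 - x ^+ n.+2
        - n.+2%:R * dev p v * x ^+ n.+1)).
    transitivity (\sum_(v < V.+1) wt p v * (dev p v * (x + dev p v) ^+ n.+2)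
      - (\sum_(v < V.+1) wt p v * dev p v) * x ^+ n.+2
      - var1 p * (n.+2%:R * x ^+ n.+1)).
      by rewrite dev0; ring.
    rewrite /var1 !mulr_suml -!sumrB; apply: eq_bigr => v _; ring.
  apply: (le_trans (ler_norm_sum _ _ _)).
  rewrite /var1 !mulr_suml; apply: ler_sum => v _.
  rewrite normrM ger0_norm// normrM.
  apply: (@le_trans _ _ (wt p v * (1 * (dev p v ^+ 2 * n.+2%:R ^+ 2 * (`|x| + 1) ^+ n)))).
    by rewrite ler_wpM2l// ler_pM// power_taylor2.
  by rewrite mul1r !mulrA.
have s2 : `|\sum_(v < V.+1) wt p v * (x + dev p v) ^+ n.+1 - x ^+ n.+1| <=
    n.+1%:R * (`|x| + 1) ^+ n.
  have -> : \sum_(v < V.+1) wt p v * (x + dev p v) ^+ n.+1 - x ^+ n.+1 =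
     \sum_(v < V.+1) wt p v * ((x + dev p v) ^+ n.+1 - x ^+ n.+1).
    rewrite [X in _ - X](wt_cst p) -sumrB.
    by apply: eq_bigr => v _; rewrite mulrBr.
  apply: (le_trans (ler_norm_sum _ _ _)).
  rewrite [leRHS](wt_cst p); apply: ler_sum => v _.
  rewrite normrM ger0_norm// ler_wpM2l//.
  have := @power_increment_diff R x (dev p v) 0 n (dev1 p v).
  rewrite normr0 ler01 addr0 subr0 => /(_ isT)/le_trans; apply.
  by rewrite -mulrA ler_piMl//; nonneg.
set A := \sum_(v < V.+1) wt p v * (dev p v * _) in s1 *.
set C := \sum_(v < V.+1) wt p v * _ in s2 *.
have -> : A - n.+2%:R * var1 p * C =
  (A - n.+2%:R * var1 p * x ^+ n.+1) - n.+2%:R * var1 p * (C - x ^+ n.+1) by ring.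
apply: (le_trans (ler_normB _ _)).
rewrite (_ : 2 * _ * _ * _ = var1 p * n.+2%:R ^+ 2 * (`|x| + 1) ^+ n +
   var1 p * n.+2%:R ^+ 2 * (`|x| + 1) ^+ n); last by ring.
rewrite lerD// 2!normrM normr_nat (ger0_norm (var1_ge0 p)).
rewrite (_ : var1 p * _ * _ = n.+2%:R * var1 p * (n.+2%:R * (`|x| + 1) ^+ n)); last by ring.
rewrite ler_wpM2l ?mulr_ge0 ?var1_ge0//.
by apply: (le_trans s2); rewrite ler_wpM2r ?ler_nat//; nonneg.
Qed.

(** Summing [stein_one] over the independent summands: an approximate form of
    the identity E (X h(X)) = s^2 E h'(X) that characterises Gaussian variables, for
    the power functions. *)
Lemma stein ps n a :
  `|E1 ps (fun x => (x - a) * x ^+ n.+2) a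
    - n.+2%:R * vars ps * E1 ps (fun x => x ^+ n.+1) a|
  <= 2 * vars ps * n.+2%:R ^+ 2 * E1 ps (fun x => (`|x| + 2) ^+ n) a.
Proof.
elim: ps a => [|p ps IH] a.
  by rewrite /= subrr mul0r /vars big_nil !(mulr0, mul0r) subrr normr0.
rewrite !E1_cons /vars big_cons -/(vars ps).
pose T v := E1 ps (fun x => (x - (a + dev p v)) * x ^+ n.+2) (a + dev p v).
pose Q v := E1 ps (fun x => x ^+ n.+1) (a + dev p v).
pose B v := E1 ps (fun x => (`|x| + 2) ^+ n) (a + dev p v).
pose D v := E1 ps (fun x => x ^+ n.+2) (a + dev p v).
have e1 v : E1 ps (fun x => (x - a) * x ^+ n.+2) (a + dev p v) = T v + dev p v * D v.
  rewrite /T /D -EEZ -EED; apply: EE_ext => x _; ring.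
under eq_bigr do rewrite e1 mulrDr.
rewrite big_split/=.
rewrite -/(B _) (_ : \sum_(v < V.+1) wt p v * E1 ps (fun x => x ^+ n.+1) (a + dev p v) =
   \sum_(v < V.+1) wt p v * Q v)// (_ : \sum_(v < V.+1) wt p v *
   E1 ps (fun x => (`|x| + 2) ^+ n) (a + dev p v) = \sum_(v < V.+1) wt p v * B v)//.
have t1 : `|\sum_(v < V.+1) wt p v * T v - n.+2%:R * vars ps * \sum_(v < V.+1) wt p v * Q v|
   <= 2 * vars ps * n.+2%:R ^+ 2 * \sum_(v < V.+1) wt p v * B v.
  move: (vars ps) IH => vs IH.
  rewrite !mulr_sumr -sumrB; apply: (le_trans (ler_norm_sum _ _ _)).
  apply: ler_sum => v _; rewrite mulrCA -mulrBr normrM ger0_norm//.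
  by rewrite [leRHS]mulrCA ler_wpM2l//; exact: IH.
have t2 : `|\sum_(v < V.+1) wt p v * (dev p v * D v)
     - n.+2%:R * var1 p * \sum_(v < V.+1) wt p v * Q v|
   <= 2 * var1 p * n.+2%:R ^+ 2 * \sum_(v < V.+1) wt p v * B v.
  have -> : \sum_(v < V.+1) wt p v * (dev p v * D v) =
    E1 ps (fun x => \sum_(v < V.+1) wt p v * (dev p v * (x + dev p v) ^+ n.+2)) a.
    rewrite EE_sum; apply: eq_bigr => v _.
    by rewrite /D E1_shift -!EEZ.
  have -> : \sum_(v < V.+1) wt p v * Q v =
    E1 ps (fun x => \sum_(v < V.+1) wt p v * (x + dev p v) ^+ n.+1) a.
    by rewrite EE_sum; apply: eq_bigr => v _; rewrite /Q E1_shift -!EEZ.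
  have -> : \sum_(v < V.+1) wt p v * B v =
    E1 ps (fun x => \sum_(v < V.+1) wt p v * (`|x + dev p v| + 2) ^+ n) a.
    by rewrite EE_sum; apply: eq_bigr => v _; rewrite /B E1_shift -!EEZ.
  rewrite -!EEZ -EEB; apply: (le_trans (EE_norm _ _ _ _)); apply: EE_le => x _.
  exact: stein_one.
rewrite (_ : _ + _ - _ =
  (\sum_(v < V.+1) wt p v * T v - n.+2%:R * vars ps * \sum_(v < V.+1) wt p v * Q v) +
  (\sum_(v < V.+1) wt p v * (dev p v * D v)
     - n.+2%:R * var1 p * \sum_(v < V.+1) wt p v * Q v)); last by ring.
apply: (le_trans (ler_normD _ _)).
by apply: (le_trans (lerD t1 t2)); rewrite -!mulrDl -mulrDr (addrC (vars ps)).
Qed.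

Lemma E1_mean ps a : E1 ps (fun x => x) a = a.
Proof.
elim: ps a => // p ps IH a; rewrite E1_cons.
by under eq_bigr do rewrite IH mulrDr; rewrite big_split/= dev0 addr0 -mulr_suml wt1 mul1r.
Qed.

Lemma E1_var ps a : E1 ps (fun x => x ^+ 2) a = a ^+ 2 + vars ps.
Proof.
elim: ps a => [|p ps IH] a; first by rewrite /= /vars big_nil addr0.
rewrite E1_cons /vars big_cons -/(vars ps).
rewrite (eq_bigr (fun v : 'I_V.+1 => wt p v * (a ^+ 2 + vars ps) +
   (wt p v * dev p v) * (2 * a) + wt p v * dev p v ^+ 2)); last first.
  by move=> v _; rewrite IH; ring.
by rewrite !big_split/= -!mulr_suml dev0 wt1 mul0r mul1r -/(var1 p); ring.
Qed.

Hypothesis dev_diff : forall p v, `|dev p v - dev p 0%N| <= 1.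
Variable r : nat -> nat -> R.
Variable psi : R -> R.

(** Total influence of the exponents on the smoothed indicator, the error factor in [covariance]. *)
Definition rho ps := \sum_(p <- ps) 2 * \sum_(v < V.+1) wt p v * r p v.

(** r p v bounds the effect of the value v of the exponent of p on the conditional expectation
    of psi, once the exponents of the primes before p are known and those after p
    are averaged. *)
Definition smoothing ps := forall ps1 p ps2, ps = ps1 ++ p :: ps2 ->
  forall (v : 'I_V.+1) a c, 0 <= c ->
  `|EE ps2 (fun _ y => psi y) a (c + v%:R * lg p) - EE ps2 (fun _ y => psi y) a c| <= r p v.

(** Covariance of two functions of one exponent, both expressed by increments from the value at 0. *)
Lemma covariance_sum (X Y : 'I_V.+1 -> R) p D :
  (forall v, `|X v - X ord0| <= D) -> (forall v, `|Y v - Y ord0| <= r p v) ->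
  `|\sum_(v < V.+1) wt p v * (X v * Y v) -
    (\sum_(v < V.+1) wt p v * X v) * (\sum_(v < V.+1) wt p v * Y v)| <=
  D * (2 * \sum_(v < V.+1) wt p v * r p v).
Proof.
move=> hX hY.
have D0 : 0 <= D := le_trans (normr_ge0 _) (hX ord0).
have eX : \sum_(v < V.+1) wt p v * X v = X ord0 + \sum_(v < V.+1) wt p v * (X v - X ord0).
  rewrite [X in X + _](wt_cst p) -big_split/=.
  by apply: eq_bigr => v _; ring.
have eY : \sum_(v < V.+1) wt p v * Y v = Y ord0 + \sum_(v < V.+1) wt p v * (Y v - Y ord0).
  rewrite [X in X + _](wt_cst p) -big_split/=.
  by apply: eq_bigr => v _; ring.
have eXY : \sum_(v < V.+1) wt p v * (X v * Y v) =
   X ord0 * Y ord0 + X ord0 * (\sum_(v < V.+1) wt p v * (Y v - Y ord0))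
   + Y ord0 * (\sum_(v < V.+1) wt p v * (X v - X ord0))
   + \sum_(v < V.+1) wt p v * ((X v - X ord0) * (Y v - Y ord0)).
  rewrite [X ord0 * Y ord0](wt_cst p) !mulr_sumr -!big_split/=.
  by apply: eq_bigr => v _; ring.
rewrite eXY eX eY.
set a := \sum_(v < _) wt p v * (X v - _); set b := \sum_(v < _) wt p v * (Y v - _).
set d := \sum_(v < _) wt p v * (_ * _).
rewrite (_ : _ - _ = d - a * b); last by ring.
have hd : `|d| <= D * \sum_(v < V.+1) wt p v * r p v.
  apply: (le_trans (ler_norm_sum _ _ _)); rewrite mulr_sumr; apply: ler_sum => v _.
  by rewrite normrM ger0_norm// mulrCA ler_wpM2l// normrM ler_pM.
have ha : `|a| <= D.
  apply: (le_trans (ler_norm_sum _ _ _)).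
  rewrite [D](wt_cst p); apply: ler_sum => v _.
  by rewrite normrM ger0_norm// ler_wpM2l.
have hb : `|b| <= \sum_(v < V.+1) wt p v * r p v.
  apply: (le_trans (ler_norm_sum _ _ _)); apply: ler_sum => v _.
  by rewrite normrM ger0_norm// ler_wpM2l.
apply: (le_trans (ler_normB _ _)).
rewrite mulrCA mulr_natl mulr2n lerD// normrM.
by rewrite ler_pM.
Qed.

(** Induction along the list.  Conditioning on the first exponent splits the covariance
    into the mean of the conditional covariances and the covariance of the two
    conditional means; the first is handled by induction, the second by [covariance_sum],
    as a change of one exponent moves x^(n+1) by at most (n+1)(|x| + 2)^n on average. *)
Lemma covariance ps n a c : smoothing ps -> 0 <= c ->
  `|EE ps (fun x y => x ^+ n.+1 * psi y) a c -
    E1 ps (fun x => x ^+ n.+1) a * EE ps (fun _ y => psi y) a c| <=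
  rho ps * (n.+1%:R * E1 ps (fun x => (`|x| + 2) ^+ n) a).
Proof.
elim: ps a c => [|p ps IH] a c sm c0.
  by rewrite /= subrr normr0 /rho big_nil mul0r.
have smS : smoothing ps.
  by move=> ps1 q ps2 e; apply: (sm (p :: ps1)); rewrite e.
rewrite /rho big_cons -/(rho ps) mulrDl !E1_cons.
pose X v := E1 ps (fun x => x ^+ n.+1) (a + dev p v).
pose Y (v : nat) := EE ps (fun _ y => psi y) (a + dev p v) (c + v%:R * lg p).
pose A (v : nat) := EE ps (fun x y => x ^+ n.+1 * psi y) (a + dev p v) (c + v%:R * lg p).
pose B v := E1 ps (fun x => (`|x| + 2) ^+ n) (a + dev p v).
pose D := n.+1%:R * \sum_(v < V.+1) wt p v * B v.
rewrite [EE (p :: ps) (fun x y => _ * _) a c](_ : _ = \sum_(v < V.+1) wt p v * A v)//.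
rewrite [EE (p :: ps) (fun x y => psi y) a c](_ : _ = \sum_(v < V.+1) wt p v * Y v)//.
rewrite [X in `|_ - X * _|](_ : _ = \sum_(v < V.+1) wt p v * X v)//.
rewrite -/D.
have B0 v : 0 <= B v.
  by apply: EE_ge0 => x _; rewrite exprn_ge0// addr_ge0.
have cv : `|\sum_(v < V.+1) wt p v * (X v * Y v) -
    (\sum_(v < V.+1) wt p v * X v) * (\sum_(v < V.+1) wt p v * Y v)| <=
  D * (2 * \sum_(v < V.+1) wt p v * r p v).
  apply: (@covariance_sum (fun v => X v) (fun v => Y v)) => v /=; last first.
    have := sm [::] p ps erefl v (a + dev p v) c c0; rewrite -/(Y v).
    rewrite (EE_fst_irrelevant _ _ _ (a + dev p 0%N)).
    by rewrite /Y /= mul0r addr0.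
  rewrite /X !E1_shift -EEB; apply: (le_trans (EE_norm _ _ _ _)).
  apply: (@le_trans _ _ (E1 ps (fun x => n.+1%:R * (`|x| + 1) ^+ n) a)).
    apply: EE_le => x _.
    apply: (le_trans (power_increment_diff x n (dev1 p v) (dev1 p 0))).
    by rewrite -mulrA ler_piMl//; nonneg.
  rewrite EEZ /D ler_wpM2l// [leLHS](wt_cst p).
  apply: ler_sum => w _; rewrite ler_wpM2l// /B E1_shift; apply: EE_le => x _.
  exact: norm_shift_le.
have ca : `|\sum_(v < V.+1) wt p v * A v - \sum_(v < V.+1) wt p v * (X v * Y v)| <= rho ps * D.
  rewrite -sumrB; apply: (le_trans (ler_norm_sum _ _ _)).
  rewrite /D !mulr_sumr; apply: ler_sum => v _.
  rewrite -mulrBr normrM ger0_norm// (mulrCA n.+1%:R) (mulrCA (rho ps)) ler_wpM2l//.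
  apply: IH => //; by rewrite addr_ge0// mulr_ge0.
rewrite [leRHS]addrC (mulrC (2 * _)).
rewrite (_ : _ - _ = (\sum_(v < V.+1) wt p v * A v - \sum_(v < V.+1) wt p v * (X v * Y v)) +
  (\sum_(v < V.+1) wt p v * (X v * Y v) -
    (\sum_(v < V.+1) wt p v * X v) * (\sum_(v < V.+1) wt p v * Y v))); last by ring.
by apply: (le_trans (ler_normD _ _)); rewrite lerD.
Qed.

End ProductModel.

(** * From the moment recursion to moment asymptotics *)

Section MomentConstants.
Variable R : realType.

Lemma Gamma_half_gt0 m : 0 < Gamma (m%:R / 2 + 1 : R).
Proof.
have H : 0 < Gamma (m%:R / 2 + 1 : R) /\ 0 < Gamma (m.+1%:R / 2 + 1 : R).
  elim: m => [|m [IH0 IH1]]; last first.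
    split; first exact: IH1.
    have -> : m.+2%:R / 2 + 1 = (m%:R / 2 + 1) + 1 :> R.
      by rewrite -natr1 -natr1; field.
    have m1 : 1 <= m%:R / 2 + 1 :> R by rewrite lerDr divr_ge0.
    by rewrite (GammaS m1); apply: mulr_gt0; [exact: lt_le_trans m1|exact: IH0].
  rewrite mul0r add0r Gamma1; split; first exact: ltr01.
  by rewrite (_ : 1%:R / 2 + 1 = 3 / 2 :> R); [exact: Gamma32_gt0|field].
by case: H.
Qed.

Lemma Cconst_gt0 m : 0 < Cconst R m.
Proof.
apply: divr_gt0; first by rewrite ltr0n fact_gt0.
by apply: mulr_gt0; [exact: powR_gt0|exact: Gamma_half_gt0].
Qed.

Lemma Cconst0 : Cconst R 0 = 1.
Proof. by rewrite /Cconst mul0r powRr0 add0r Gamma1 mulr1 divff. Qed.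

(** The recursion of the absolute moments of the Gaussian law, from Gamma(s + 1) = s Gamma(s). *)
Lemma CconstSS m : Cconst R m.+2 = m.+1%:R * Cconst R m.
Proof.
rewrite /Cconst; have -> : m.+2%:R / 2 + 1 = (m%:R / 2 + 1) + 1 :> R.
  by rewrite -natr1 -natr1; field.
have m1 : 1 <= m%:R / 2 + 1 :> R by rewrite lerDr divr_ge0.
rewrite (GammaS m1).
have -> : m.+2%:R / 2 = m%:R / 2 + 1 :> R by rewrite -natr1 -natr1; field.
rewrite powRD ?pnatr_eq0 ?implybT// powRr1// !factS !natrM.
move: (Gamma _) (Gamma_half_gt0 m) => G G0.
have P0 : 0 < 2 `^ (m%:R / 2) :> R by rewrite powR_gt0.
have m0 : 0 <= m%:R :> R by [].
rewrite -(natr1 m.+1) -(natr1 m).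
by field; rewrite !gt_eqF//= ?andbT; lra.
Qed.

End MomentConstants.

Section GaussianMomentSequence.
Variable R : realType.
Variable c : nat -> R.
Hypotheses (c0E : c 0%N = 1) (c_gt0 : forall m, 0 < c m)
  (cSS : forall m, c m.+2 = m.+1%:R * c m).

(** The minimum of the ratios c(m+1) / (sqrt(m+1) c m) for m = 0 and m = 1; the recursion propagates it to all m. *)
Definition moment_ratio : R := Num.min (c 1%N) ((c 1%N)^-1 / Num.sqrt 2).

Lemma moment_ratio_gt0 : 0 < moment_ratio.
Proof. by rewrite /moment_ratio lt_min c_gt0 divr_gt0 ?invr_gt0 ?sqrtr_gt0. Qed.

Lemma moment_ratioP m : moment_ratio * Num.sqrt m.+1%:R * c m <= c m.+1.
Proof.
have k0 := moment_ratio_gt0.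
have H : moment_ratio * Num.sqrt m.+1%:R * c m <= c m.+1 /\
         moment_ratio * Num.sqrt m.+2%:R * c m.+1 <= c m.+2.
  elim: m => [|m [IH0 IH1]]; last first.
    split; first exact: IH1.
    rewrite (cSS m) (cSS m.+1).
    apply: (@le_trans _ _ (m.+2%:R * (moment_ratio * Num.sqrt m.+1%:R * c m))); last first.
      by rewrite ler_wpM2l.
    have h : Num.sqrt m.+3%:R * m.+1%:R <= m.+2%:R * Num.sqrt m.+1%:R :> R.
      rewrite -ler_sqr ?nnegrE ?mulr_ge0 ?sqrtr_ge0//.
      rewrite !exprMn !sqr_sqrtr// -!natrX -!natrM ler_nat; nia.
    have c0 := c_gt0 m.
    rewrite (_ : _ * _ = moment_ratio * c m * (Num.sqrt m.+3%:R * m.+1%:R)); last by ring.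
    rewrite (_ : m.+2%:R * _ = moment_ratio * c m * (m.+2%:R * Num.sqrt m.+1%:R)); last by ring.
    by rewrite ler_wpM2l// mulr_ge0// ltW.
  rewrite (cSS 0) c0E sqrtr1 !mulr1; split; first by rewrite /moment_ratio ge_min lexx.
  have s2 : 0 < Num.sqrt 2 :> R by rewrite sqrtr_gt0.
  apply: (@le_trans _ _ ((c 1%N)^-1 / Num.sqrt 2 * Num.sqrt 2 * c 1%N)).
    by rewrite ler_wpM2r ?(ltW (c_gt0 _))// ler_wpM2r ?(ltW s2)// /moment_ratio ge_min lexx orbT.
  by rewrite divfK ?gt_eqF// mulVf ?gt_eqF.
by case: H.
Qed.

Lemma moment_even_ge1 k : 1 <= c k.*2.
Proof.
elim: k => [|k IH]; first by rewrite c0E.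
by rewrite doubleS cSS (le_trans IH)// ler_peMl ?(le_trans ler01)// ler1n.
Qed.


(** The three properties of an expectation that the moment argument uses. *)
Record mean_functional (E : (R -> R) -> R) : Prop := MeanFunctional {
  mean_lin : forall k g g', E (fun x => k * g x + g' x) = k * E g + E g';
  mean_le : forall g g', (forall x, g x <= g' x) -> E g <= E g';
  mean_cst : forall k, E (fun _ => k) = k }.

Section Functional.
Variable E : (R -> R) -> R.
Hypothesis mE : mean_functional E.

Lemma meanZ k g : E (fun x => k * g x) = k * E g.
Proof.
have := mean_lin mE k g (fun _ => 0); rewrite (mean_cst mE) addr0 => <-.
by congr E; apply/funext => x; rewrite addr0.
Qed.

Lemma meanD g g' : E (fun x => g x + g' x) = E g + E g'.
Proof.
rewrite -[E g]mul1r -(mean_lin mE).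
by congr E; apply/funext => x; rewrite mul1r.
Qed.

(** Odd absolute moments from the neighbouring even ones, by 2 x <= x^2 / t + t. *)
Lemma mean_interp (t D : R) a : 0 < t -> 0 <= D ->
  E (fun x => (`|x| + D) ^+ a.+1) <=
  (t^-1 * E (fun x => (`|x| + D) ^+ a.+2) + t * E (fun x => (`|x| + D) ^+ a)) / 2.
Proof.
move=> t0 D0; rewrite mulrC -meanZ -(mean_lin mE) -meanZ.
apply: (mean_le mE) => x; set y := `|x| + D.
have y0 : 0 <= y by rewrite addr_ge0.
have ya0 : 0 <= y ^+ a by rewrite exprn_ge0.
rewrite !exprS -subr_ge0.
rewrite (_ : _ - _ = 2^-1 * (y ^+ a * (t^-1 * (y - t) ^+ 2))); last by field; rewrite gt_eqF.
have t1 : 0 <= t^-1 by rewrite invr_ge0 ltW.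
by nonneg.
Qed.

Variables (s h q : R).
Hypotheses (s1 : 1 <= s) (h0 : 0 <= h).
Variable n : nat.
Hypotheses (q1 : 1 <= q) (qq : q * q = n%:R).
Hypotheses (n0 : (0 < n)%N) (nh : n%:R * q <= h * s).

Let s0 : 0 < s. Proof. exact: lt_le_trans s1. Qed.

Let le_nh i : (i <= n.+1)%N -> i%:R <= 2 * h * s.
Proof.
move=> i_n; apply: (@le_trans _ _ (2 * (n%:R * q))); last by rewrite -mulrA ler_wpM2l.
apply: (@le_trans _ _ (2 * n%:R)).
  by rewrite -natrM ler_nat (leq_trans i_n)// mul2n -addnn -addn1 leq_add2l.
by rewrite ler_wpM2l// ler_peMr.
Qed.

(** A shift by D multiplies a moment of order i by (1 + D/s)^i at most where |x| >= s; this is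
    bounded because i = O(s). *)
Lemma mean_shifted_power D i : 0 <= D -> (i <= n.+1)%N ->
  E (fun x => (`|x| + D) ^+ i) <= expR (2 * D * h) * (E (fun x => `|x| ^+ i) + s ^+ i).
Proof.
move=> D0 i_n; rewrite -[s ^+ i](mean_cst mE) -meanD -meanZ.
apply: (mean_le mE) => x.
have Ds : 0 <= D / s by rewrite divr_ge0// ltW.
have e : (1 + D / s) ^+ i <= expR (2 * D * h).
  apply: (@le_trans _ _ (expR (D / s) ^+ i)).
    by rewrite lerXn2r ?nnegrE ?addr_ge0 ?expR_ge0 ?expR_ge1Dx.
  rewrite -expRM_natl ler_expR mulrA ler_pdivrMr// mulrC.
  by rewrite (_ : 2 * D * h * s = D * (2 * h * s)) ?ler_wpM2l ?le_nh//; ring.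
have [sx|xs] := leP s `|x|.
  apply: (@le_trans _ _ ((1 + D / s) ^+ i * `|x| ^+ i)).
    rewrite -exprMn lerXn2r ?nnegrE ?mulr_ge0 ?addr_ge0//.
    rewrite mulrDl mul1r lerD2l mulrAC ler_pdivlMr// ler_wpM2l//.
  rewrite ler_pM//; try by rewrite exprn_ge0 ?addr_ge0.
  by rewrite lerDl exprn_ge0// ltW.
apply: (@le_trans _ _ ((1 + D / s) ^+ i * s ^+ i)).
  rewrite -exprMn lerXn2r ?nnegrE ?mulr_ge0 ?addr_ge0// ?(ltW s0)//.
  by rewrite mulrDl mul1r divfK ?gt_eqF// lerD2r ltW.
rewrite ler_pM//; try by rewrite exprn_ge0 ?addr_ge0 ?(ltW s0).
by rewrite lerDr exprn_ge0.
Qed.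

Hypothesis E1 : E (fun x => x) = 0.
Hypothesis E2 : E (fun x => x ^+ 2) = s ^+ 2.
Hypothesis Estein : forall j,
  `|E (fun x => x ^+ j.+3) - j.+2%:R * s ^+ 2 * E (fun x => x ^+ j.+1)| <=
  2 * s ^+ 2 * j.+2%:R ^+ 2 * E (fun x => (`|x| + 2) ^+ j).

Variable u : nat -> R.
Hypotheses (u00 : u 0%N = 1) (u0 : forall j, 0 < u j)
  (uSS : forall j, u j.+2 = j.+1%:R * s ^+ 2 * u j)
  (u_even : forall k, s ^+ k.*2 <= u k.*2).
Variable kappa : R.
Hypotheses (k0 : 0 < kappa)
  (u_ratio : forall j, kappa * Num.sqrt j.+1%:R * s * u j <= u j.+1).
Variables (e2 G : R).
Hypotheses (e2E : expR (2 * 2 * h) = e2) (GE : expR (12 * e2 * h) = G).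
Let e20 : 0 < e2. Proof. by rewrite -e2E expR_gt0. Qed.
Let q0 : 0 < q. Proof. exact: lt_le_trans q1. Qed.

Lemma even_abs k : E (fun x => `|x| ^+ k.*2) = E (fun x => x ^+ k.*2).
Proof.
by congr E; apply/funext => x; rewrite -muln2 mulnC !exprM real_normK ?num_real.
Qed.

(** The error term in the recursion has order j^2 s^2 E(|x| + 2)^(j-2), smaller than the main term by a factor
    sqrt(n)/s up to constants, once absolute moments are interpolated between even ones. *)
Lemma even_moment_step k g : (k.+1.*2.+2 <= n.+1)%N -> 1 <= g ->
  E (fun x => x ^+ k.*2) <= g * u k.*2 ->
  E (fun x => x ^+ k.+1.*2) <= g * u k.+1.*2 ->
  E (fun x => x ^+ k.+2.*2) <= g * (1 + 12 * e2 * (q / s)) * u k.+2.*2.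
Proof.
move=> kn g1 H0 H1.
have g0 : 0 < g by rewrite (lt_le_trans _ g1).
have kn' : (k.*2 <= n.+1)%N by move: kn; clear; rewrite !doubleS; lia.
have kn1 : (k.+1.*2 <= n.+1)%N by move: kn; clear; rewrite !doubleS; lia.
have V0 : E (fun x => (`|x| + 2) ^+ k.*2) <= 2 * e2 * g * u k.*2.
  apply: (le_trans (mean_shifted_power (ler0n _ 2) kn')).
  rewrite e2E even_abs [leRHS](_ : _ = e2 * (g * u k.*2 + g * u k.*2)); last by ring.
  rewrite ler_wpM2l ?(ltW e20)// lerD// (le_trans (u_even k))// ler_peMl ?(ltW (u0 _))//.
have V2 : E (fun x => (`|x| + 2) ^+ k.+1.*2) <= 2 * e2 * g * u k.+1.*2.
  apply: (le_trans (mean_shifted_power (ler0n _ 2) kn1)).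
  rewrite e2E even_abs [leRHS](_ : _ = e2 * (g * u k.+1.*2 + g * u k.+1.*2)); last by ring.
  rewrite ler_wpM2l ?(ltW e20)// lerD// (le_trans (u_even k.+1))// ler_peMl ?(ltW (u0 _))//.
have sq0 : 0 < s * q by rewrite mulr_gt0.
have V1 : E (fun x => (`|x| + 2) ^+ k.*2.+1) <= 2 * e2 * g * s * q * u k.*2.
  apply: (le_trans (mean_interp k.*2 sq0 (ler0n _ 2))).
  rewrite ler_pdivrMr//.
  apply: (@le_trans _ _ ((s * q)^-1 * (2 * e2 * g * u k.+1.*2) + (s * q) * (2 * e2 * g * u k.*2))).
    by rewrite lerD// ler_wpM2l// ?invr_ge0 ltW.
  rewrite doubleS uSS.
  have kq : k.*2.+1%:R / q <= q.
    rewrite (ler_pdivrMr _ _ q0) qq ler_nat; move: kn; clear; rewrite doubleS; lia.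
  rewrite (_ : _ + _ = (2 * e2 * g * s * u k.*2) * (k.*2.+1%:R / q + q)); last first.
    by field; rewrite !gt_eqF.
  rewrite [leRHS](_ : _ = (2 * e2 * g * s * u k.*2) * (q + q)); last by ring.
  by rewrite ler_wpM2l ?lerD2r// !mulr_ge0// ltW.
have := Estein k.*2.+1; rewrite -doubleS -(doubleS k.+1) ler_norml => /andP[_].
rewrite lerBlDl => /le_trans; apply.
rewrite mulrDr mulr1 mulrDl lerD//.
  rewrite (doubleS k.+1) uSS [leRHS]mulrCA ler_wpM2l//.
  by rewrite mulr_ge0 ?sqr_ge0.
apply: (le_trans (ler_wpM2l _ V1)); first by nonneg.
rewrite !doubleS 2!uSS.
have k3 : k.*2.+3%:R <= 3 * k.*2.+1%:R :> R by rewrite -natrM ler_nat; clear; lia.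
rewrite [leLHS](_ : _ = (4 * e2 * g * q * u k.*2 * s ^+ 3 * k.*2.+3%:R) * k.*2.+3%:R);
  last by ring.
rewrite [leRHS](_ : _ = (4 * e2 * g * q * u k.*2 * s ^+ 3 * k.*2.+3%:R) * (3 * k.*2.+1%:R));
  last by field; rewrite gt_eqF.
rewrite ler_wpM2l// !mulr_ge0 ?exprn_ge0// ltW//.
Qed.

Lemma even_moment_bound_aux k : (k.*2 <= n.+1)%N -> forall i, (i <= k)%N ->
  E (fun x => x ^+ i.*2) <= (1 + 12 * e2 * (q / s)) ^+ k * u i.*2.
Proof.
have x0 : 0 <= 12 * e2 * (q / s) by rewrite !mulr_ge0 ?invr_ge0// ltW.
have x1 : 1 <= 1 + 12 * e2 * (q / s) by rewrite lerDl.
have X1 j : 1 <= (1 + 12 * e2 * (q / s)) ^+ j by rewrite exprn_ege1.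
have b0 : E (fun x => x ^+ 0) = u 0 by rewrite u00 (mean_cst mE).
have b1 : E (fun x => x ^+ 2) = u 2 by rewrite uSS u00 E2 mul1r mulr1.
elim: k => [|k IH] kn i.
  by rewrite leqn0 => /eqP ->; rewrite expr0 mul1r b0.
have {}IH : forall i, (i <= k)%N -> E (fun x => x ^+ i.*2) <= (1 + 12 * e2 * (q / s)) ^+ k * u i.*2.
  by apply: IH; move: kn; clear; rewrite doubleS; lia.
rewrite leq_eqVlt => /orP[/eqP ->|]; last first.
  rewrite ltnS => /IH /le_trans; apply; rewrite ler_wpM2r ?(ltW (u0 _))//.
  by rewrite exprS ler_peMl// exprn_ge0// (le_trans ler01).
case: k kn IH => [|k] kn IH.
  by rewrite b1 ler_peMl// ltW.
rewrite exprSr; apply: even_moment_step; first by move: kn; clear; rewrite !doubleS; lia.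
- exact: X1.
  by apply: IH.
by apply: IH.
Qed.

(** The factors 1 + O(sqrt(n)/s) accumulate over n/2 steps to exp(O(n^(3/2)/s)), which is bounded. *)
Lemma even_moment_bound k : (k.*2 <= n.+1)%N -> E (fun x => x ^+ k.*2) <= G * u k.*2.
Proof.
move=> kn; apply: (le_trans (even_moment_bound_aux kn (leqnn k))).
have x0 : 0 <= 12 * e2 * (q / s) by rewrite !mulr_ge0 ?invr_ge0// ltW.
rewrite ler_wpM2r ?(ltW (u0 _))//.
apply: (@le_trans _ _ (expR (12 * e2 * (q / s)) ^+ k)).
  by rewrite lerXn2r ?nnegrE ?addr_ge0 ?expR_ge0 ?expR_ge1Dx.
rewrite -expRM_natl -GE ler_expR mulrCA ler_wpM2l ?mulr_ge0 ?(ltW e20)//.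
rewrite mulrA ler_pdivrMr//; apply: le_trans nh; rewrite ler_wpM2r ?(ltW q0)// ler_nat.
by move: kn; rewrite -addnn; move: n0; clear; lia.
Qed.

Lemma abs_moment_bound D i : 0 <= D -> (i <= n)%N ->
  E (fun x => (`|x| + D) ^+ i) <= 2 * expR (2 * D * h) * G * (1 + kappa^-1) * u i.
Proof.
move=> D0 i_n.
have eD0 : 0 < expR (2 * D * h) by rewrite expR_gt0.
have G1 : 1 <= G.
  by rewrite -GE -[leLHS]expR0 ler_expR !mulr_ge0 ?(ltW e20).
have G0 : 0 < G by rewrite (lt_le_trans _ G1).
have ev k : (k.*2 <= n.+1)%N ->
    E (fun x => (`|x| + D) ^+ k.*2) <= 2 * expR (2 * D * h) * G * u k.*2.
  move=> kn; apply: (le_trans (mean_shifted_power D0 kn)).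
  rewrite even_abs [leRHS](_ : _ = expR (2 * D * h) * (G * u k.*2 + G * u k.*2)); last by ring.
  rewrite ler_wpM2l ?(ltW eD0)// lerD ?even_moment_bound//.
  by rewrite (le_trans (u_even k))// ler_peMl ?(ltW (u0 _)).
have ki0 : 0 <= kappa^-1 by rewrite invr_ge0 ltW.
have [oi|ei] := boolP (odd i); last first.
  rewrite -[i]odd_double_half (negbTE ei) add0n.
  apply: (le_trans (ev _ _)).
    by rewrite -[leqRHS]/(n.+1) -(leq_add2l (odd i)) odd_double_half (negbTE ei) add0n ltnW.
  rewrite ler_wpM2r ?(ltW (u0 _))// ler_peMr ?mulr_ge0 ?(ltW eD0) ?(ltW G0)//.
  by rewrite lerDl.
have ei : i = i./2.*2.+1 by rewrite -[LHS]odd_double_half oi.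
set k := i./2 in ei; rewrite ei.
have w0 : 0 < Num.sqrt k.*2.+1%:R :> R by rewrite sqrtr_gt0.
have ww : Num.sqrt k.*2.+1%:R * Num.sqrt k.*2.+1%:R = k.*2.+1%:R :> R.
  by rewrite -expr2 sqr_sqrtr.
set w := Num.sqrt k.*2.+1%:R in w0 ww *.
have sw0 : 0 < s * w by rewrite mulr_gt0.
apply: (le_trans (mean_interp k.*2 sw0 D0)); rewrite ler_pdivrMr//.
apply: (@le_trans _ _ ((s * w)^-1 * (2 * expR (2 * D * h) * G * u k.+1.*2) +
     (s * w) * (2 * expR (2 * D * h) * G * u k.*2))).
  rewrite lerD// ler_wpM2l// ?invr_ge0 ?(ltW sw0)//.
    by rewrite -doubleS ev// doubleS -ei; move: i_n; clear; lia.
  by rewrite ev//; move: i_n; rewrite ei; clear; lia.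
rewrite doubleS uSS -ww.
rewrite (_ : _ + _ = 4 * expR (2 * D * h) * G * (s * w * u k.*2)); last first.
  by field; rewrite !gt_eqF.
have r : s * w * u k.*2 <= kappa^-1 * u k.*2.+1.
  rewrite ler_pdivlMl//; apply: le_trans (u_ratio _); rewrite -/w.
  by rewrite le_eqVlt; apply/orP; left; apply/eqP; ring.
rewrite [leRHS](_ : _ = 4 * expR (2 * D * h) * G * ((1 + kappa^-1) * u k.*2.+1)); last by ring.
rewrite ler_wpM2l ?mulr_ge0 ?(ltW eD0) ?(ltW G0)//.
by apply: (le_trans r); rewrite ler_wpM2r ?(ltW (u0 _))// lerDr.
Qed.

Variable K3 : R.
Hypothesis K3E : 2 * expR (2 * 2 * h) * G * (1 + kappa^-1) = K3.

Lemma chiSS j : chi R j.+2 = chi R j.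
Proof. by rewrite /chi !exprS mulrA mulrNN !mul1r. Qed.

Lemma chi_norm j : 0 <= chi R j <= 1.
Proof.
rewrite /chi -signr_odd; case: (odd j); rewrite ?expr1 ?expr0; lra.
Qed.

(** With all absolute moments bounded by their Gaussian size, each step of the recursion adds a relative
    error O(sqrt(n)/s); there are at most n steps. *)
Lemma moment_asymptotics_aux i : (i <= n)%N ->
  `|E (fun x => x ^+ i) - chi R i * u i| <= i%:R * (4 * K3 / kappa * (q / s)) * u i.
Proof.
have K30 : 0 < K3.
  by rewrite -K3E -GE !mulr_gt0 ?expR_gt0// addr_gt0 ?invr_gt0.
have c0 : 0 <= 4 * K3 / kappa * (q / s).
  by rewrite !mulr_ge0 ?invr_ge0// ltW.
suff H : ((i <= n)%N -> `|E (fun x => x ^+ i) - chi R i * u i| <= i%:R * (4 * K3 / kappa * (q / s)) * u i)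
 /\ ((i.+1 <= n)%N -> `|E (fun x => x ^+ i.+1) - chi R i.+1 * u i.+1| <= i.+1%:R * (4 * K3 / kappa * (q / s)) * u i.+1)
 by case: H.
elim: i => [|i [IH0 IH1]]; last first.
  split=> // i_n; case: i IH0 {IH1} i_n => [|j] IH0 jn.
    rewrite E2 chiSS (_ : chi R 0 = 1); last by rewrite /chi; lra.
    rewrite uSS u00 !mul1r mulr1 subrr normr0; apply: mulr_ge0; last exact: sqr_ge0.
    exact: mulr_ge0.
  have {}IH0 := IH0 (ltnW (ltnW jn)).
  rewrite chiSS.
  have -> : E (fun x => x ^+ j.+3) - chi R j.+1 * u j.+3 =
    (E (fun x => x ^+ j.+3) - j.+2%:R * s ^+ 2 * E (fun x => x ^+ j.+1)) +
     j.+2%:R * s ^+ 2 * (E (fun x => x ^+ j.+1) - chi R j.+1 * u j.+1).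
    by rewrite uSS; ring.
  apply: (le_trans (ler_normD _ _)).
  have js0 : 0 <= j.+2%:R * s ^+ 2 by nonneg.
  rewrite [X in _ + X]normrM (ger0_norm js0).
  have t1 : j.+2%:R * s ^+ 2 * `|E (fun x => x ^+ j.+1) - chi R j.+1 * u j.+1| <=
     j.+1%:R * (4 * K3 / kappa * (q / s)) * u j.+3.
    apply: (le_trans (ler_wpM2l js0 IH0)); rewrite uSS le_eqVlt; apply/orP; left; apply/eqP; ring.
  have t2 : 2 * s ^+ 2 * j.+2%:R ^+ 2 * E (fun x => (`|x| + 2) ^+ j) <=
     (4 * K3 / kappa * (q / s)) * u j.+3.
    have b := @abs_moment_bound 2 j (ler0n _ 2) (ltnW (ltnW (ltnW jn))); rewrite K3E in b.
    apply: (le_trans (ler_wpM2l _ b)); first by nonneg.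
    have w0 : 0 < Num.sqrt j.+1%:R :> R by rewrite sqrtr_gt0.
    have ww : Num.sqrt j.+1%:R * Num.sqrt j.+1%:R = j.+1%:R :> R by rewrite -expr2 sqr_sqrtr.
    have wq : Num.sqrt j.+1%:R <= q.
      rewrite -ler_sqr ?nnegrE ?sqrtr_ge0 ?(ltW q0)// sqr_sqrtr// expr2 qq ler_nat; move: jn; clear; lia.
    have rr := u_ratio j.
    set w := Num.sqrt j.+1%:R in w0 ww wq rr.
    have j2 : j.+2%:R <= 2 * (w * w) by rewrite ww -natrM ler_nat; clear; lia.
    have ur : u j <= u j.+1 / (kappa * w * s).
      by rewrite ler_pdivlMr ?mulr_gt0// mulrC.
    apply: (@le_trans _ _ (2 * s ^+ 2 * j.+2%:R ^+ 2 * (K3 * (u j.+1 / (kappa * w * s))))).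
      by rewrite ler_wpM2l ?ler_wpM2l ?(ltW K30)//; nonneg.
    rewrite uSS.
    rewrite [leLHS](_ : _ = (2 * s * j.+2%:R * K3 * u j.+1 / kappa / w) * j.+2%:R); last first.
      by field; rewrite !gt_eqF.
    apply: (@le_trans _ _ ((2 * s * j.+2%:R * K3 * u j.+1 / kappa / w) * (2 * (w * q)))).
      rewrite ler_wpM2l//; last first.
        by apply: (le_trans j2); rewrite ler_wpM2l// ler_wpM2l// ltW.
      by rewrite !mulr_ge0 ?invr_ge0// ltW.
    rewrite le_eqVlt; apply/orP; left; apply/eqP.
    by field; rewrite !gt_eqF.
  apply: (@le_trans _ _ ((4 * K3 / kappa * (q / s)) * u j.+3 +
     j.+1%:R * (4 * K3 / kappa * (q / s)) * u j.+3)).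
    by rewrite lerD//; apply: le_trans t2; exact: Estein.
  rewrite -mulrDl ler_wpM2r ?(ltW (u0 _))// -[X in X + _]mul1r -mulrDl ler_wpM2r//.
  by rewrite addrC natr1 ler_nat.
split=> _.
  rewrite (mean_cst mE) u00 (_ : chi R 0 = 1); last by rewrite /chi; lra.
  by rewrite !mul1r subrr normr0 mul0r.
rewrite (_ : E _ = 0); last by rewrite -[RHS]E1; congr E; apply/funext => x; rewrite expr1.
rewrite (_ : chi R 1 = 0); last by rewrite /chi; lra.
rewrite mul0r subrr normr0; apply: mulr_ge0; [exact: mulr_ge0|exact: ltW].
Qed.

End Functional.

Theorem moment_asymptotics (h D : R) : 0 <= h -> 0 <= D ->
  exists2 K : R, 0 < K & forall (E : (R -> R) -> R) (s : R) (n : nat),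
  mean_functional E -> 1 <= s -> (0 < n)%N -> n%:R * Num.sqrt n%:R <= h * s ->
  E (fun x => x) = 0 -> E (fun x => x ^+ 2) = s ^+ 2 ->
  (forall j,
  `|E (fun x => x ^+ j.+3) - j.+2%:R * s ^+ 2 * E (fun x => x ^+ j.+1)| <=
   2 * s ^+ 2 * j.+2%:R ^+ 2 * E (fun x => (`|x| + 2) ^+ j)) ->
  `|E (fun x => x ^+ n) - chi R n * (c n * s ^+ n)| <=
     K * (n%:R * Num.sqrt n%:R / s) * (c n * s ^+ n) /\
  forall i, (i <= n)%N -> E (fun x => (`|x| + D) ^+ i) <= K * (c i * s ^+ i).
Proof.
move=> h0 D0.
have k0 := moment_ratio_gt0.
pose e2 := expR (2 * 2 * h).
pose G := expR (12 * e2 * h).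
pose K3 := 2 * e2 * G * (1 + moment_ratio^-1).
pose K4 := 2 * expR (2 * D * h) * G * (1 + moment_ratio^-1).
have K30 : 0 < K3 by rewrite !mulr_gt0 ?expR_gt0// addr_gt0 ?invr_gt0.
have K40 : 0 < K4 by rewrite !mulr_gt0 ?expR_gt0// addr_gt0 ?invr_gt0.
have K50 : 0 < 4 * K3 / moment_ratio by apply: divr_gt0 => //; exact: mulr_gt0.
exists (4 * K3 / moment_ratio + K4); first by rewrite addr_gt0.
move=> E s n mE s1 n0 nh E1 E2 Es.
have s0 : 0 < s by rewrite (lt_le_trans _ s1).
pose q := Num.sqrt (n%:R : R).
have q1 : 1 <= q by rewrite /q -[leLHS]sqrtr1 ler_wsqrtr// ler1n.
have qq : q * q = n%:R by rewrite -expr2 sqr_sqrtr.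
pose u j := c j * s ^+ j.
have u00 : u 0%N = 1 by rewrite /u c0E mul1r.
have u0 j : 0 < u j by rewrite mulr_gt0 ?c_gt0 ?exprn_gt0.
have uSS j : u j.+2 = j.+1%:R * s ^+ 2 * u j by rewrite /u cSS !exprS; ring.
have u_even k : s ^+ k.*2 <= u k.*2.
  by rewrite ler_peMl ?exprn_ge0 ?(ltW s0)// moment_even_ge1.
have u_ratio j : moment_ratio * Num.sqrt j.+1%:R * s * u j <= u j.+1.
  rewrite /u exprS (_ : _ * _ = (moment_ratio * Num.sqrt j.+1%:R * c j) * (s * s ^+ j)); last by ring.
  by rewrite ler_wpM2r ?moment_ratioP// mulr_ge0 ?exprn_ge0// ltW.
split; last first.
  move=> i i_n.
  apply: (le_trans (abs_moment_bound mE s1 h0 q1 qq n0 nh E2 Es u00 u0 uSS u_even k0 u_ratio erefl erefl D0 i_n)).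
  by rewrite -/e2 -/G -/K4 -/(u i) ler_wpM2r ?(ltW (u0 i))// lerDr ltW.
apply: (le_trans (moment_asymptotics_aux mE s1 h0 q1 qq n0 nh E1 E2 Es u00 u0 uSS u_even k0 u_ratio erefl erefl erefl (leqnn n))).
rewrite -/e2 -/G -/K3 -/(u n) -/q ler_wpM2r ?(ltW (u0 n))//.
have nq0 : 0 <= n%:R * q / s by rewrite !mulr_ge0 ?invr_ge0 ?(ltW s0)// (le_trans ler01).
rewrite (_ : n%:R * _ = 4 * K3 / moment_ratio * (n%:R * q / s)); last by ring.
by rewrite ler_wpM2r// lerDl ltW.
Qed.

End GaussianMomentSequence.

(** * Sums over integers and over their prime factors *)

Section PrimePowerSums.
Variable R : realType.

(** Every n with p-adic valuation v is p^v m for a unique m prime to p. *)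
Lemma sum_by_valuation p v N (h : nat -> R) : prime p ->
  \sum_(1 <= n < N.+1 | logn p n == v) h n =
  \sum_(1 <= m < N.+1 | ~~ (p %| m)%N && (p ^ v * m <= N)%N) h (p ^ v * m)%N.
Proof.
move=> pp; have p0 := prime_gt0 pp.
have pv0 : (0 < p ^ v)%N by rewrite expn_gt0 p0.
rewrite -big_filter -[RHS]big_filter -(big_map (fun m => p ^ v * m)%N xpredT h).
apply: perm_big; apply: uniq_perm.
- by rewrite filter_uniq// iota_uniq.
- rewrite map_inj_in_uniq; first by rewrite filter_uniq// iota_uniq.
  by move=> a b _ _ /eqP; rewrite eqn_pmul2l// => /eqP.
move=> n; rewrite mem_filter mem_index_iota ltnS; apply/idP/mapP.
  move=> /andP[/eqP e /andP[n0 nN]].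
  have [m cm nE] := pfactor_coprime pp n0; rewrite e in nE.
  exists m; last by rewrite mulnC.
  rewrite mem_filter mem_index_iota ltnS -prime_coprime// cm /= mulnC -nE nN /=.
  have m0 : (0 < m)%N by move: n0; rewrite nE muln_gt0 => /andP[].
  by rewrite m0/= (leq_trans _ nN)// nE leq_pmulr.
move=> [m]; rewrite mem_filter mem_index_iota => /andP[/andP[pm mN] /andP[m0 _]] ->.
rewrite mN muln_gt0 pv0 m0 /= andbT lognM// lognX logn_prime// eqxx muln1.
by rewrite logn_coprime ?prime_coprime// addn0.
Qed.

Lemma ln_pfactor p v : (0 < p)%N -> ln (p ^ v)%:R = v%:R * ln p%:R :> R.
Proof. by move=> p0; rewrite natrX lnXn ?ltr0n// mulr_natl. Qed.

Lemma ln_nat_ge0 n : 0 <= ln n%:R :> R.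
Proof.
by case: n => [|n]; [rewrite ln0|rewrite ln_ge0// ler1n].
Qed.

Lemma ln_logn_sum N n : (0 < n <= N)%N ->
  ln n%:R = \sum_(1 <= p < N.+1 | prime p) (logn p n)%:R * ln p%:R :> R.
Proof.
move=> /andP[n0 nN]; apply: expR_inj; rewrite lnK ?posrE ?ltr0n// expR_sum.
rewrite -[in LHS](partnT n0) (widen_partn predT nN).
rewrite (big_morph (fun k : nat => k%:R : R) (@natrM R) (erefl _)) big_ltn//=.
rewrite (_ : logn 0 n = 0%N); last by rewrite lognE.
rewrite expn0 mul1r [RHS]big_mkcond/= big_nat [RHS]big_nat.
apply: eq_bigr => p /andP[p0 _]; case: ifP => [pp|np].
  by rewrite expRM_natl lnK ?posrE ?ltr0n// natrX.
by rewrite lognE np.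
Qed.

(** ln n is the sum of ln (p^v) over the prime powers exactly dividing n; exchanging the sums and writing n = p^v m. *)
Lemma log_weight_sum (b g : nat -> R) N :
  (forall m n, (0 < m)%N -> (0 < n)%N -> coprime m n -> b (m * n)%N = b m * b n) ->
  \sum_(1 <= n < N.+1) b n * ln n%:R * g n =
  \sum_(1 <= m < N.+1) b m * \sum_(1 <= p < N.+1 | prime p)
    \sum_(1 <= v < N.+1 | ~~ (p %| m)%N && (p ^ v * m <= N)%N)
      b (p ^ v)%N * ln (p ^ v)%:R * g (p ^ v * m)%N.
Proof.
move=> bM.
transitivity (\sum_(1 <= p < N.+1 | prime p) \sum_(1 <= v < N.+1)
   \sum_(1 <= m < N.+1 | ~~ (p %| m)%N && (p ^ v * m <= N)%N)
      b m * (b (p ^ v)%N * ln (p ^ v)%:R * g (p ^ v * m)%N)).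
  transitivity (\sum_(1 <= n < N.+1) \sum_(1 <= p < N.+1 | prime p)
     (logn p n)%:R * ln p%:R * (b n * g n)).
    rewrite big_nat [RHS]big_nat; apply: eq_bigr => n nN.
    by rewrite (@ln_logn_sum N n)// -mulr_suml mulrAC mulrC.
  rewrite exchange_big/=; apply: eq_bigr => p pp.
  transitivity (\sum_(1 <= n < N.+1) \sum_(1 <= v < N.+1 | logn p n == v)
     v%:R * ln p%:R * (b n * g n)).
    rewrite big_nat [RHS]big_nat; apply: eq_bigr => n /andP[n0 nN].
    have [l0|l0] := posnP (logn p n).
      rewrite l0 !mul0r big_nat_cond big1// => v /andP[/andP[v0 _] /eqP e].
      by rewrite -e in v0.
    rewrite (eq_bigl (pred1 (logn p n))); last by move=> v; rewrite /= eq_sym.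
    rewrite -big_filter (_ : [seq _ <- _ | _] = [:: logn p n]) ?big_seq1//.
    rewrite filter_pred1_uniq ?iota_uniq// mem_index_iota l0/=.
    by rewrite (leq_ltn_trans _ nN)// ltnW// ltn_logl.
  rewrite (exchange_big_dep xpredT)//=; apply: eq_bigr => v _.
  rewrite (sum_by_valuation v N (fun n => v%:R * ln p%:R * (b n * g n)) pp).
  rewrite [LHS]big_nat_cond [RHS]big_nat_cond.
  apply: eq_bigr => m /andP[/andP[m0 _] /andP[pm _]].
  rewrite bM ?expn_gt0 ?(prime_gt0 pp)//; last by rewrite coprimeXl// prime_coprime.
  by rewrite ln_pfactor ?prime_gt0//; ring.
pose X m p v := b m * (b (p ^ v)%N * ln (p ^ v)%:R * g (p ^ v * m)%N).
pose C m p v := ~~ (p %| m)%N && (p ^ v * m <= N)%N.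
transitivity (\sum_(1 <= m < N.+1) \sum_(1 <= p < N.+1 | prime p)
  \sum_(1 <= v < N.+1 | C m p v) X m p v); last first.
  apply: eq_bigr => m _; rewrite mulr_sumr; apply: eq_bigr => p _.
  by rewrite mulr_sumr.
rewrite [RHS]exchange_big/=; apply: eq_bigr => p pp.
by rewrite [RHS](exchange_big_dep xpredT).
Qed.

Lemma ler_sum_sub (N n : nat) (P Q : pred nat) (F : nat -> R) :
  (forall i, P i -> (0 < i <= N)%N -> Q i && (i <= n)%N) ->
  (forall i, Q i -> (0 < i)%N -> 0 <= F i) ->
  \sum_(1 <= i < N.+1 | P i) F i <= \sum_(1 <= i < n.+1 | Q i) F i.
Proof.
move=> h F0.
rewrite (@big_nat_widen _ _ _ _ _ (maxn N n).+1) ?ltnS ?leq_maxl//.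
rewrite [leRHS](@big_nat_widen _ _ _ _ _ (maxn N n).+1) ?ltnS ?leq_maxr//.
rewrite [leLHS]big_mkcond [leRHS]big_mkcond [leLHS]big_nat [leRHS]big_nat.
apply: ler_sum => i /andP[i0 _]; rewrite !ltnS.
case: ifP => [/andP[Pi iN]|_]; first by rewrite h// i0.
by case: ifP => // /andP[Qi _]; exact: F0.
Qed.

Lemma ler_sum_pred N (P : pred nat) (F G : nat -> R) :
  (forall i, P i -> (0 < i <= N)%N -> F i <= G i) ->
  \sum_(1 <= i < N.+1 | P i) F i <= \sum_(1 <= i < N.+1 | P i) G i.
Proof.
move=> h; rewrite [leLHS]big_nat_cond [leRHS]big_nat_cond.
by apply: ler_sum => i /andP[/andP[i0 iN] Pi]; apply: h; rewrite ?i0.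
Qed.

Lemma sumr_pred_ge0 N (P : pred nat) (F : nat -> R) :
  (forall i, P i -> (0 < i <= N)%N -> 0 <= F i) ->
  0 <= \sum_(1 <= i < N.+1 | P i) F i.
Proof.
move=> h; rewrite big_nat_cond.
by apply: sumr_ge0 => i /andP[/andP[i0 iN] Pi]; apply: h; rewrite ?i0.
Qed.

Lemma ln2_ge_half : 2^-1 <= ln 2 :> R.
Proof.
have := @le_ln1Dx R (- 2^-1); rewrite (_ : 1 - 2^-1 = 2^-1 :> R); last by field.
rewrite lnV ?posrE// lerN2; apply; lra.
Qed.

Lemma ln_le_powR (e t : R) : 0 < e -> 0 < t -> ln t <= e^-1 * t `^ e.
Proof.
move=> e0 t0; rewrite ler_pdivlMl// -ln_powR.
by apply/ltW/ln_sublinear; rewrite powR_gt0.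
Qed.

End PrimePowerSums.

(** * Weights on the primes: Chebyshev bounds *)

Section RegularWeights.
Variable R : realType.

(** The facts on b n = alpha n / n^sigma0 that the proof uses, with all constants explicit, so that
    the estimates below are uniform over the class: [rw_theta] is the prime number theorem for
    the weights b p p ln p, and the last three bound the contributions of repeated primes. *)
Record regular_weight (A beta eta C : R) (b : nat -> R) : Prop := RegularWeight {
  rw_ge0 : forall n, 0 <= b n;
  rw_one : b 1%N = 1;
  rw_mul : forall m n, (0 < m)%N -> (0 < n)%N -> coprime m n ->
    b (m * n)%N = b m * b n;
  rw_theta : forall n, (2 <= n)%N ->
    `|\sum_(1 <= p < n.+1 | prime p) b p * p%:R * ln p%:R - beta * n%:R| <=
    C * (n%:R / ln n%:R `^ A);
  rw_sq : forall n, \sum_(1 <= p < n.+1 | prime p) b p ^+ 2 <= C;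
  rw_pow : forall n V, \sum_(1 <= p < n.+1 | prime p) \sum_(2 <= v < V)
    b (p ^ v)%N * (p ^ v)%:R `^ eta <= C;
  rw_small : forall p, prime p -> b p <= C * p%:R `^ (- eta) }.

Variables (A beta eta C : R).
Hypotheses (A0 : 0 < A) (beta0 : 0 < beta) (eta0 : 0 < eta) (C0 : 0 < C).
Notation regular := (regular_weight A beta eta C).

Lemma ler_sum_union N (P Q S : pred nat) (F : nat -> R) :
  (forall i, P i -> Q i || S i) -> (forall i, 0 <= F i) ->
  \sum_(1 <= i < N.+1 | P i) F i <=
  \sum_(1 <= i < N.+1 | Q i) F i + \sum_(1 <= i < N.+1 | S i) F i.
Proof.
move=> h F0; rewrite [leLHS]big_mkcond [X in X + _]big_mkcond [X in _ + X]big_mkcond.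
rewrite -big_split/=; apply: ler_sum => i _.
have f0 := F0 i.
by case: ifP => [/h|_]; case: ifP => _; case: ifP => _ //=; lra.
Qed.

Lemma ln_prime_ge p : prime p -> 2^-1 <= ln p%:R :> R.
Proof.
move=> pp; apply: (le_trans (ln2_ge_half R)).
by rewrite ler_ln ?posrE ?ltr0n ?prime_gt0// ler_nat prime_gt1.
Qed.

Lemma natr_prime_gt0 p : prime p -> 0 < p%:R :> R.
Proof. by move=> /prime_gt0; rewrite ltr0n. Qed.

Definition double_const := 2 * (beta + C / ln 2 `^ A).

Lemma double_const_gt0 : 0 < double_const.
Proof.
rewrite /double_const mulr_gt0// addr_gt0// divr_gt0// powR_gt0//.
by rewrite ln_gt0// ltr1n.
Qed.

(** A dyadic block of primes: compare [rw_theta] at y, and use p > y/2 to remove the factor p. *)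
Lemma chebyshev_doubling b (y : R) N : regular b -> 0 < y ->
  \sum_(1 <= p < N.+1 | prime p && (y / 2 < p%:R <= y)) b p * ln p%:R
  <= double_const.
Proof.
move=> rb y0; have l20 : 0 < ln 2 :> R by rewrite ln_gt0// ltr1n.
have [y2|y2] := ltP y 2.
  rewrite big1 ?(ltW double_const_gt0)// => p /andP[/prime_gt1 p1 /andP[_ py]].
  have : (p%:R : R) < 2 by exact: le_lt_trans y2.
  by rewrite ltr_nat ltnNge p1.
have [ny yn] : (Num.truncn y)%:R <= y /\ (2 <= Num.truncn y)%N.
  by rewrite truncn_le truncn_ge_nat ltW.
set n := Num.truncn y in ny yn.
have n0 : 0 < n%:R :> R by rewrite ltr0n; case: (n) yn.
apply: (@le_trans _ _ (2 / y * \sum_(1 <= p < n.+1 | prime p) b p * p%:R * ln p%:R)).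
  rewrite mulr_sumr.
  apply: (@le_trans _ _ (\sum_(1 <= p < N.+1 | prime p && (y / 2 < p%:R <= y))
      2 / y * (b p * p%:R * ln p%:R))).
    apply: ler_sum_pred => p /andP[pp /andP[yp _]] _.
    rewrite (_ : 2 / y * _ = (b p * ln p%:R) * (2 * p%:R / y)); last by ring.
    have bl : 0 <= b p * ln p%:R by rewrite mulr_ge0 ?(rw_ge0 rb) ?ln_nat_ge0.
    rewrite ler_peMr// ler_pdivlMr// mul1r.
    by move: yp; rewrite ltr_pdivrMr// mulrC => /ltW.
  apply: ler_sum_sub => p.
    move=> /andP[-> /andP[_ py]] _ /=.
    by rewrite /n truncn_ge_nat// ltW.
  move=> pp _; have := rw_ge0 rb p; have := ln_nat_ge0 R p => h1 h2.
  by nonneg.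
have := rw_theta rb yn; rewrite ler_norml => /andP[_]; rewrite lerBlDl => th.
have nA : ln 2 `^ A <= ln n%:R `^ A.
  by apply: ge0_ler_powR; rewrite ?nnegrE ?(ltW A0) ?ln_nat_ge0 ?(ltW l20)// ler_ln ?posrE// ler_nat.
have l2A : 0 < ln 2 `^ A :> R by rewrite powR_gt0.
have th2 : \sum_(1 <= p < n.+1 | prime p) b p * p%:R * ln p%:R <= (beta + C / ln 2 `^ A) * y.
  apply: (le_trans th).
  apply: (@le_trans _ _ ((beta + C / ln 2 `^ A) * n%:R)); last first.
    rewrite ler_wpM2l// addr_ge0 ?(ltW beta0)// divr_ge0 ?(ltW C0)// ltW//.
  rewrite mulrDl lerD2l mulrA [leRHS]mulrAC ler_wpM2l//.
    by rewrite mulr_ge0 ?(ltW C0)// ltW.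
  by rewrite lef_pV2 ?posrE// (lt_le_trans l2A).
apply: (le_trans (ler_wpM2l _ th2)); first by rewrite divr_ge0// ltW.
rewrite /double_const le_eqVlt; apply/orP; left; apply/eqP.
by field; rewrite !gt_eqF.
Qed.

Lemma pow2_ge (H : R) : 1 <= H -> exists2 k : nat, H <= 2 ^+ k & k%:R <= 2 * (1 + ln H).
Proof.
move=> H1; have H0 : 0 < H by rewrite (lt_le_trans ltr01).
have l2 := ln2_ge_half R.
have lH : 0 <= ln H by rewrite ln_ge0.
have l20 : 0 < ln 2 :> R by lra.
have [k kH Hk] : exists2 k : nat, k%:R <= ln H / ln 2 & ln H / ln 2 < k.+1%:R.
  have /andP[h1 h2] := truncn_itv (divr_ge0 lH (ltW l20)).
  by exists (Num.truncn (ln H / ln 2)).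
exists k.+1.
  rewrite -ler_ln ?posrE ?exprn_gt0// lnXn// -[ln 2 *+ _]mulr_natl.
  by rewrite -ler_pdivrMr// ltW.
rewrite -natr1; have : ln H / ln 2 <= 2 * ln H.
  rewrite ler_pdivrMr// mulrAC ler_peMl//; lra.
lra.
Qed.

Definition interval_const := 2 * double_const.

Lemma interval_const_gt0 : 0 < interval_const.
Proof. by rewrite mulr_gt0// double_const_gt0. Qed.

(** About log_2 H dyadic blocks. *)
Lemma chebyshev_interval b (y H : R) N : regular b -> 0 < y -> 1 <= H ->
  \sum_(1 <= p < N.+1 | prime p && (y / H < p%:R <= y)) b p * ln p%:R
  <= interval_const * (1 + ln H).
Proof.
move=> rb y0 H1; have [k Hk kH] := pow2_ge H1.
have F0 p : 0 <= b p * ln p%:R by rewrite mulr_ge0 ?(rw_ge0 rb) ?ln_nat_ge0.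
have H0 : 0 < H by rewrite (lt_le_trans ltr01).
apply: (@le_trans _ _ (k%:R * double_const)); last first.
  rewrite /interval_const (_ : _ * _ * _ = 2 * (1 + ln H) * double_const); last by ring.
  by rewrite ler_wpM2r// (ltW double_const_gt0).
apply: (@le_trans _ _ (\sum_(1 <= p < N.+1 | prime p && (y / 2 ^+ k < p%:R <= y)) b p * ln p%:R)).
  apply: ler_sum_sub => // p /andP[-> /andP[yp ->]] /andP[_ ->]; rewrite !andbT/=.
  apply: le_lt_trans yp; rewrite ler_wpM2l ?(ltW y0)//.
  by rewrite lef_pV2 ?posrE ?exprn_gt0.
elim: k {Hk kH} => [|k IH].
  rewrite mul0r expr0 divr1 big1// => p /andP[_ /andP[yp py]].
  by have := lt_le_trans yp py; rewrite ltxx.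
rewrite -(natr1 k) mulrDl mul1r.
have y20 : 0 < y / 2 ^+ k by rewrite divr_gt0 ?exprn_gt0.
apply: (le_trans _ (lerD IH (@chebyshev_doubling b _ N rb y20))).
apply: ler_sum_union => // p /andP[-> /andP[yp py]] /=; rewrite py andbT.
have [//|_] /= := ltP (y / 2 ^+ k) p%:R; rewrite andbT.
by move: yp; rewrite exprSr invfM mulrA.
Qed.

Lemma powR_ge1 (x e : R) : 1 <= x -> 0 <= e -> 1 <= x `^ e.
Proof. by move=> x1 e0; apply: le_trans (ler_powR x1 e0); rewrite powRr0. Qed.

Lemma prime_power_tail b N V : regular b ->
  \sum_(1 <= p < N.+1 | prime p) \sum_(2 <= v < V) b (p ^ v)%N <= C.
Proof.
move=> rb; apply: le_trans (rw_pow rb N V).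
apply: ler_sum_pred => p pp _; apply: ler_sum => v _.
rewrite ler_peMr ?(rw_ge0 rb)//.
by rewrite powR_ge1 ?(ltW eta0)// ler1n expn_gt0 prime_gt0.
Qed.

Lemma prime_power_tail_log b N V : regular b ->
  \sum_(1 <= p < N.+1 | prime p) \sum_(2 <= v < V) b (p ^ v)%N * ln (p ^ v)%:R <= eta^-1 * C.
Proof.
move=> rb; apply: le_trans (ler_wpM2l _ (rw_pow rb N V)); last by rewrite invr_ge0 ltW.
rewrite mulr_sumr; apply: ler_sum_pred => p pp _; rewrite mulr_sumr; apply: ler_sum => v _.
rewrite mulrCA ler_wpM2l ?(rw_ge0 rb)// ln_le_powR// ltr0n expn_gt0 prime_gt0//.
Qed.

Lemma split_first_power (P : pred nat) (X : nat -> R) V : (forall v, 0 <= X v) ->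
  \sum_(1 <= v < V.+1 | P v) X v <= (P 1%N)%:R * X 1%N + \sum_(2 <= v < V.+1) X v.
Proof.
move=> X0; case: V => [|V].
  by rewrite big_geq// addr_ge0 ?mulr_ge0 ?sumr_ge0.
rewrite [leLHS]big_mkcond big_ltn//=; apply: lerD.
  by case: ifP => _; rewrite ?mul1r ?mul0r.
by apply: ler_sum => v _; case: ifP.
Qed.

Definition power_interval_const := interval_const + eta^-1 * C.

Lemma power_interval_const_gt0 : 0 < power_interval_const.
Proof. by rewrite addr_gt0 ?interval_const_gt0 ?mulr_gt0 ?invr_gt0. Qed.

Lemma chebyshev_power_interval b (y H : R) N V : regular b -> 0 < y -> 1 <= H ->
  \sum_(1 <= p < N.+1 | prime p)
    \sum_(1 <= v < V.+1 | y / H < (p ^ v)%:R <= y) b (p ^ v)%N * ln (p ^ v)%:R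
  <= power_interval_const * (1 + ln H).
Proof.
move=> rb y0 H1.
have F0 p : 0 <= b p * ln p%:R by rewrite mulr_ge0 ?(rw_ge0 rb) ?ln_nat_ge0.
apply: (@le_trans _ _ (\sum_(1 <= p < N.+1 | prime p && (y / H < p%:R <= y)) b p * ln p%:R +
   \sum_(1 <= p < N.+1 | prime p) \sum_(2 <= v < V.+1) b (p ^ v)%N * ln (p ^ v)%:R)).
  rewrite big_mkcondr -big_split/=; apply: ler_sum_pred => p pp _.
  apply: (le_trans (split_first_power _ _ _)) => [v|]; first exact: F0.
  by rewrite lerD2r expn1; case: ifP; rewrite ?mul1r ?mul0r.
rewrite mulrDl lerD ?chebyshev_interval//.
apply: (le_trans (prime_power_tail_log N V.+1 rb)).
rewrite ler_peMr ?lerDl ?ln_ge0// mulr_ge0 ?(ltW C0)// invr_ge0 ltW//.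
Qed.

(** Induction from sqrt N to N: the primes in (sqrt N, N] contribute O((ln N)^g) by [chebyshev_interval],
    while (ln sqrt N)^g is smaller than (ln N)^g by the factor 2^(-g) < 1. *)
Lemma prime_log_power g : 0 < g <= 1 -> exists2 K : R, 0 < K &
  forall b N, regular b ->
  \sum_(1 <= p < N.+1 | prime p) b p * ln p%:R `^ g <= K * ln N%:R `^ g.
Proof.
move=> /andP[g0 g1].
have i0 := interval_const_gt0.
have hg : 2 `^ (- g) < 1 :> R.
  rewrite powRN invf_lt1 ?powR_gt0//.
  have := @gt0_ltr_powR R g g0 1 2; rewrite !nnegrE powR1; apply => //.
  by rewrite ltr1n.
have [D D0 DE] : exists2 D, 0 < D & D * (1 - 2 `^ (- g)) = 6 * interval_const.
  exists (6 * interval_const / (1 - 2 `^ (- g))).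
    by apply: divr_gt0; [exact: mulr_gt0|rewrite subr_gt0].
  by rewrite divfK// subr_eq0 eq_sym lt_eqF.
have ci := chebyshev_interval.
move: interval_const i0 ci DE => ic i0 ci DE.
exists D => // b N rb; move: N.
have F0 p : 0 <= b p * ln p%:R `^ g by rewrite mulr_ge0 ?(rw_ge0 rb) ?powR_ge0.
apply: ltn_ind => N IH.
have [N2|N2] := ltnP N 2.
  rewrite big_nat_cond big1 ?mulr_ge0 ?powR_ge0 ?(ltW D0)// => p /andP[/andP[p0 pN] pp].
  by have := leq_trans pN N2; rewrite ltnNge prime_gt1.
have NR : 0 < N%:R :> R by rewrite ltr0n; case: (N) N2.
pose s := Num.sqrt (N%:R : R).
have ss : s * s = N%:R by rewrite -expr2 sqr_sqrtr// ltW.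
have s0 : 0 < s by rewrite sqrtr_gt0.
have s1 : 1 <= s by rewrite /s -[leLHS]sqrtr1 ler_wsqrtr// ler1n; case: (N) N2.
have lnN : ln N%:R = 2 * ln s by rewrite -ss lnM ?posrE//; ring.
have l2N : ln 2 <= ln N%:R :> R by rewrite ler_ln ?posrE// ler_nat.
have l2 := ln2_ge_half R.
have ls0 : 0 < ln s by lra.
have lN0 : 0 < ln N%:R :> R by lra.
pose n := Num.truncn s.
have ns : n%:R <= s by rewrite truncn_le ltW.
have nN : (n < N)%N.
  rewrite -(ltr_nat R); apply: (le_lt_trans ns).
  rewrite -ss -[ltLHS]mulr1 ltr_pM2l// ltNge; apply/negP => s1'.
  have : s = 1 by apply/eqP; rewrite eq_le s1 s1'.
  by move=> se; move: ls0; rewrite se ln1 ltxx.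
have part1 : \sum_(1 <= p < n.+1 | prime p) b p * ln p%:R `^ g <= D * (2 `^ (- g) * ln N%:R `^ g).
  apply: (le_trans (IH n nN)); rewrite ler_wpM2l ?(ltW D0)//.
  have -> : 2 `^ (- g) * ln N%:R `^ g = ln s `^ g.
    rewrite lnN powRM ?(ltW ls0)// mulrA -powRD ?addNr ?powRr0 ?mul1r//.
    by rewrite pnatr_eq0 implybT.
  apply: ge0_ler_powR; rewrite ?nnegrE ?(ltW g0) ?ln_nat_ge0 ?(ltW ls0)//.
  case: (posnP n) => [->|n0]; first by rewrite ln0// ltW.
  by rewrite ler_ln ?posrE// ltr0n.
have part2 : \sum_(1 <= p < N.+1 | prime p && (N%:R / s < p%:R <= (N%:R : R))) b p * ln p%:R `^ g
   <= 6 * ic * ln N%:R `^ g.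
  apply: (@le_trans _ _ ((ln s) `^ (g - 1) *
     \sum_(1 <= p < N.+1 | prime p && (N%:R / s < p%:R <= (N%:R : R))) b p * ln p%:R)).
    rewrite mulr_sumr; apply: ler_sum_pred => p /andP[pp /andP[sp pN]] _.
    rewrite mulrCA ler_wpM2l ?(rw_ge0 rb)//.
    have sp' : s <= p%:R by move: sp; rewrite -ss mulfK ?gt_eqF// => /ltW.
    have lp0 : 0 < ln p%:R :> R by have := ln_prime_ge pp; lra.
    rewrite -[in leLHS](subrK 1 g) powRD ?(gt_eqF lp0) ?implybT// powRr1 ?(ltW lp0)//.
    rewrite ler_wpM2r ?(ltW lp0)//.
    rewrite -(opprB 1 g) !powRN lef_pV2 ?posrE ?powR_gt0//.
    apply: ge0_ler_powR; rewrite ?nnegrE ?subr_ge0 ?(ltW lp0) ?(ltW ls0)//.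
    by rewrite ler_ln ?posrE// (lt_le_trans s0).
  apply: (le_trans (ler_wpM2l _ (ci _ _ _ N rb NR s1))); first by rewrite powR_ge0.
  have l3 : 1 + ln s <= 3 * ln N%:R by lra.
  have l4 : ln s `^ (g - 1) <= 2 * ln N%:R `^ (g - 1).
    rewrite lnN -(opprB 1 g) !powRN powRM ?(ltW ls0)// invfM mulrA.
    rewrite ler_peMl ?invr_ge0 ?powR_ge0// ler_pdivlMr ?powR_gt0// mul1r.
    by rewrite ler1_powR ?ler1n// lerBlDr lerDl ltW.
  apply: (@le_trans _ _ ((2 * ln N%:R `^ (g - 1)) * (ic * (3 * ln N%:R)))).
    rewrite ler_pM ?powR_ge0//; first by rewrite mulr_ge0 ?(ltW i0)// addr_ge0// ltW.
    by rewrite ler_wpM2l// ltW.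
  have -> : ln N%:R `^ g = ln N%:R `^ (g - 1) * ln N%:R.
    by rewrite -[in LHS](subrK 1 g) powRD ?(gt_eqF lN0) ?implybT// powRr1 ?(ltW lN0).
  by rewrite le_eqVlt; apply/orP; left; apply/eqP; ring.
apply: (@le_trans _ _ (\sum_(1 <= p < n.+1 | prime p) b p * ln p%:R `^ g +
   \sum_(1 <= p < N.+1 | prime p && (N%:R / s < p%:R <= (N%:R : R))) b p * ln p%:R `^ g)).
  apply: (@le_trans _ _ (\sum_(1 <= p < N.+1 | prime p && (p%:R <= s)) b p * ln p%:R `^ g +
     \sum_(1 <= p < N.+1 | prime p && (s < p%:R)) b p * ln p%:R `^ g)).
    apply: ler_sum_union => // p ->/=; by case: leP.
  apply: lerD.
    by apply: ler_sum_sub => // p /andP[-> ps] /andP[p0 _]; rewrite /n truncn_ge_nat// ltW.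
  apply: ler_sum_sub => // p /andP[-> ps] /andP[p0 pN].
  by rewrite pN andbT/= ler_nat pN andbT -ss mulfK// gt_eqF.
apply: (le_trans (lerD part1 part2)); rewrite -DE.
by rewrite le_eqVlt; apply/orP; left; apply/eqP; ring.
Qed.

Lemma prime_divisor_count m N : (0 < m <= N)%N ->
  \sum_(1 <= p < N.+1 | prime p && (p %| m)%N) (1 : R) <= 2 * ln (m%:R : R).
Proof.
move=> mN; rewrite (ln_logn_sum R mN) mulr_sumr big_mkcondr.
apply: ler_sum_pred => p pp _; case: ifP => pm; last first.
  by rewrite !mulr_ge0// ln_nat_ge0.
have lp := ln_prime_ge pp.
have : 1 <= (logn p m)%:R :> R.
  by rewrite ler1n logn_gt0 mem_primes pp pm; case/andP: mN => ->.
nra.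
Qed.

End RegularWeights.

(** * Weights on the primes: a lower Mertens bound *)

Section MertensLower.
Variable R : realType.
Variables (A beta eta C : R).
Hypotheses (A0 : 0 < A) (beta0 : 0 < beta) (eta0 : 0 < eta) (C0 : 0 < C).
Notation regular := (regular_weight A beta eta C).

(** lam is so large that the main term beta (lam - 1) n of [rw_theta] over (n, lam n] exceeds the two errors
    when ln n is large. *)
Lemma mertens_block : exists lam n1 : nat, [/\ (2 <= lam)%N, (lam <= n1)%N &
  forall b n, regular b -> (n1 <= n)%N ->
  (2 * lam%:R * ln n%:R)^-1 <= \sum_(n.+1 <= q < (lam * n).+1 | prime q) b q].
Proof.
pose lam := (Num.truncn (2 / beta)).+2.
have lamR : 2 <= beta * (lam%:R - 1).
  have h : 2 / beta < (Num.truncn (2 / beta)).+1%:R by exact: truncnS_gt.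
  rewrite mulrC -ler_pdivrMr// /lam -(natr1 (Num.truncn (2 / beta)).+1) addrK; exact: ltW.
pose T := (C * (lam%:R + 1)) `^ (A^-1).
have T0 : 0 <= T by exact: powR_ge0.
have TA : T `^ A = C * (lam%:R + 1).
  by rewrite -powRrM mulVf ?gt_eqF// powRr1// mulr_ge0 ?(ltW C0).
pose n1 := maxn lam (Num.truncn (expR T)).+1.
exists lam, n1; split; [by []|exact: leq_maxl|].
move=> b n rb n1n.
have lamn : (lam <= n)%N by rewrite (leq_trans _ n1n)// leq_maxl.
have lam2 : (2 <= lam)%N by [].
have n2 : (2 <= n)%N by rewrite (leq_trans lam2).
have nR : 0 < n%:R :> R by rewrite ltr0n (leq_trans _ n2).
have lamR0 : 0 < lam%:R :> R by rewrite ltr0n.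
clearbody lam.
have Tn : T <= ln n%:R.
  rewrite -(expRK T) ler_ln ?posrE ?expR_gt0//.
  apply/ltW/(lt_le_trans (truncnS_gt _)); rewrite ler_nat.
  by rewrite (leq_trans _ n1n)// leq_maxr.
have lnn0 : 0 < ln n%:R :> R by rewrite ln_gt0// ltr1n.
have lln : ln n%:R <= ln (lam * n)%:R :> R.
  by rewrite ler_ln ?posrE ?ltr0n ?muln_gt0 ?ler_nat ?leq_pmull ?(leq_trans _ n2)//; case: (lam) lam2.
have lnA : C * (lam%:R + 1) <= ln n%:R `^ A.
  by rewrite -TA; apply: ge0_ler_powR; rewrite ?nnegrE ?(ltW A0) ?(ltW lnn0).
have lnA0 : 0 < ln n%:R `^ A by rewrite powR_gt0.
have lnA' : ln n%:R `^ A <= ln (lam * n)%:R `^ A.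
  by apply: ge0_ler_powR; rewrite ?nnegrE ?(ltW A0) ?ln_nat_ge0.
have ln_n : (n <= lam * n)%N by rewrite leq_pmull// (leq_trans _ lam2).
have := rw_theta rb (leq_trans n2 ln_n); have := rw_theta rb n2.
rewrite (@big_cat_nat _ _ _ n.+1 1 (lam * n).+1)//=.
set th := \sum_(1 <= p < n.+1 | _) _.
rewrite !ler_norml => /andP[_ h1] /andP[h2 _].
have k1 : n%:R / ln n%:R `^ A <= n%:R / (C * (lam%:R + 1)).
  rewrite ler_wpM2l ?(ltW nR)// lef_pV2 ?posrE// mulr_gt0// addr_gt0//.
have k2 : (lam * n)%:R / ln (lam * n)%:R `^ A <= (lam * n)%:R / (C * (lam%:R + 1)).
  have p1 : 0 < C * (lam%:R + 1) by rewrite mulr_gt0// addr_gt0.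
  have p2 := lt_le_trans lnA0 lnA'.
  by rewrite ler_wpM2l// lef_pV2 ?posrE//; exact: le_trans lnA'.
have k3 : C * (n%:R / (C * (lam%:R + 1))) + C * ((lam * n)%:R / (C * (lam%:R + 1))) = n%:R.
  rewrite natrM; field; rewrite gt_eqF//= gt_eqF// addr_gt0//.
have big : n%:R <= \sum_(n.+1 <= q < (lam * n).+1 | prime q) b q * q%:R * ln q%:R.
  have k1' := ler_wpM2l (ltW C0) k1; have k2' := ler_wpM2l (ltW C0) k2.
  have : 2 * n%:R <= beta * (lam%:R - 1) * n%:R by rewrite ler_wpM2r// ltW.
  have mE : (lam * n)%:R = lam%:R * n%:R :> R by rewrite natrM.
  move: h1 h2 k1' k2' k3.
  set X := \sum_(_ <= q < _ | _) _; 
  set c1 := C * (n%:R / _ `^ A); set c2 := C * ((lam * n)%:R / _ `^ A).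
  set c3 := C * (n%:R / _); set c4 := C * ((lam * n)%:R / _).
  rewrite mE; move: c1 c2 c3 c4 => c1 c2 c3 c4; lra.
have lnl : ln (lam * n)%:R <= 2 * ln n%:R :> R.
  rewrite natrM lnM ?posrE//.
  suff : ln lam%:R <= ln n%:R :> R by lra.
  by rewrite ler_ln ?posrE// ler_nat.
have up : \sum_(n.+1 <= q < (lam * n).+1 | prime q) b q * q%:R * ln q%:R <=
   (lam%:R * n%:R * (2 * ln n%:R)) * \sum_(n.+1 <= q < (lam * n).+1 | prime q) b q.
  rewrite mulr_sumr big_nat_cond [leRHS]big_nat_cond.
  apply: ler_sum => q /andP[/andP[nq qn] pq].
  rewrite [leRHS]mulrC -mulrA ler_wpM2l ?(rw_ge0 rb)// ler_pM ?ln_nat_ge0//.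
    by rewrite -natrM ler_nat -ltnS.
  have lamn0 : 0 < (lam * n)%:R :> R by rewrite natrM mulr_gt0.
  by apply: le_trans lnl; rewrite ler_ln ?posrE ?(natr_prime_gt0 R pq)// ler_nat -ltnS.
have h := le_trans big up.
rewrite (_ : _ * _ * (2 * _) = n%:R * (2 * lam%:R * ln n%:R)) in h; last by ring.
rewrite -mulrA -[leLHS]mulr1 ler_pM2l// in h.
by rewrite -[leLHS]mul1r ler_pdivrMr ?mulr_gt0// mulrC.
Qed.

(** A lower bound of order ln (ln N / ln k), with some positive constant g, suffices.  Each
    block (n, lam n] contributes at least a constant over ln n, by [mertens_block], which is the order of the
    increment of ln ln from n to lam n; the induction moves k to lam k. *)
Lemma mertens_lower : exists g K : R, [/\ 0 < g <= 1, 0 <= K &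
  forall b k N, regular b -> (2 <= k <= N)%N ->
  g * (ln (ln N%:R) - ln (ln k%:R)) - K <= \sum_(k.+1 <= q < N.+1 | prime q) b q].
Proof.
have [lam [n1 [lam2 lamn1 blk]]] := mertens_block.
have lamR : 2 <= lam%:R :> R by rewrite ler_nat.
have n12 : (2 <= n1)%N := leq_trans lam2 lamn1.
pose g : R := (2 * lam%:R * lam%:R)^-1.
have ll0 : 0 < 2 * lam%:R * lam%:R :> R by rewrite !mulr_gt0//; lra.
have g0 : 0 < g by rewrite invr_gt0.
have g1 : g <= 1.
  rewrite /g invf_le1//; move: (lam%:R : R) lamR => t t2; nra.
have lnk (k : nat) : (2 <= k)%N -> 2^-1 <= ln k%:R :> R.
  move=> k2; apply: (le_trans (ln2_ge_half R)).
  by rewrite ler_ln ?posrE ?ltr0n ?ler_nat// (leq_trans _ k2).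
have lnle (k l : nat) : (2 <= k)%N -> (k <= l)%N -> ln k%:R <= ln l%:R :> R.
  move=> k2 kl; rewrite ler_ln ?posrE ?ltr0n ?ler_nat// ?(leq_trans _ k2)//.
  by rewrite (leq_trans _ kl)// (leq_trans _ k2).
have lnlnle (k l : nat) : (2 <= k)%N -> (k <= l)%N -> ln (ln k%:R) <= ln (ln l%:R) :> R.
  move=> k2 kl; have := lnk k k2; have := lnle k l k2 kl => h1 h2.
  by rewrite ler_ln ?posrE//; lra.
pose D : R := ln (ln n1%:R) - ln (ln 2).
have D0 : 0 <= D by rewrite subr_ge0 (lnlnle 2%N).
exists g, (g + g * D); split; [by rewrite g0|by clearbody g D; nonneg|].
move=> b k N rb /andP[k2 kN].
have S0 u v : 0 <= \sum_(u <= q < v | prime q) b q.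
  by apply: sumr_ge0 => q _; exact: rw_ge0 rb q.
have main d : forall k, (n1 <= k)%N -> (k <= N)%N -> (N - k <= d)%N ->
    g * (ln (ln N%:R) - ln (ln k%:R)) - g <= \sum_(k.+1 <= q < N.+1 | prime q) b q.
  elim: d => [|d IH] {k2 kN}k n1k kN kd.
    have -> : k = N by apply/eqP; rewrite eqn_leq kN -subn_eq0 -leqn0.
    by rewrite subrr mulr0 sub0r big_geq// oppr_le0 ltW.
  have k2 := leq_trans n12 n1k.
  have kR : 0 < k%:R :> R by rewrite ltr0n (leq_trans _ k2).
  have lk := lnk k k2.
  have lk0 : 0 < ln k%:R :> R by lra.
  have ll : ln lam%:R <= ln k%:R :> R by apply: lnle => //; exact: leq_trans n1k.
  have l2 : ln (lam * k)%:R <= 2 * ln k%:R :> R.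
    by rewrite natrM lnM ?posrE//; lra.
  have [Nlk|lkN] := ltnP N (lam * k).
    apply: le_trans (S0 _ _).
    have : ln N%:R <= 2 * ln k%:R :> R.
      by apply: le_trans l2; apply: lnle (ltnW Nlk); exact: leq_trans kN.
    have lN := lnk N (leq_trans k2 kN).
    rewrite -ler_ln ?posrE; [|lra|lra]; rewrite lnM ?posrE// => h.
    have l21 : ln 2 <= 1 :> R by apply: (@le_ln1Dx R 1); lra.
    rewrite subr_le0 ler_piMr ?(ltW g0)//; lra.
  have klk : (k < lam * k)%N by rewrite ltn_Pmull// (leq_trans _ k2).
  have := IH (lam * k)%N (leq_trans n1k (ltnW klk)) lkN.
  have -> : (N - lam * k <= d)%N by move: klk kd lkN; clear; lia.
  move=> /(_ isT) h.
  rewrite (@big_cat_nat _ _ _ (lam * k).+1)//=; last by rewrite ltnS ltnW.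
  have h2 := blk b k rb n1k.
  have : g * (ln (ln (lam * k)%:R) - ln (ln k%:R)) <= (2 * lam%:R * ln k%:R)^-1.
    have -> : ln (lam * k)%:R = ln k%:R * (1 + ln lam%:R / ln k%:R) :> R.
      by rewrite natrM lnM ?posrE//; [field; rewrite gt_eqF|lra].
    have lam0 : 0 < ln lam%:R :> R by have := lnk _ lam2; lra.
    have q0 : 0 < ln lam%:R / ln k%:R :> R by rewrite divr_gt0.
    rewrite lnM ?posrE//; last by rewrite addr_gt0.
    rewrite addrC addKr.
    apply: (@le_trans _ _ (g * (lam%:R / ln k%:R))).
      rewrite ler_wpM2l ?(ltW g0)//.
      apply: le_trans (le_ln1Dx _) _; first by lra.
      by rewrite ler_wpM2r ?invr_ge0 ?(ltW lk0)// ltW// ln_sublinear//; lra.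
    rewrite /g le_eqVlt; apply/orP; left; apply/eqP; field.
    by rewrite !gt_eqF//; lra.
  move: h h2; set X := \sum_(k.+1 <= q < _ | _) _; set Y := \sum_(_ <= q < N.+1 | _) _.
  move: (_^-1) => z; rewrite !mulrBr; lra.
have gD : 0 <= g * D by rewrite mulr_ge0// ltW.
have [n1k|kn1] := leqP n1 k.
  have := main (N - k)%N k n1k kN (leqnn _); lra.
have [n1N|Nn1] := leqP n1 N.
  rewrite (@big_cat_nat _ _ _ n1.+1)//=; last exact: ltnW.
  have := main (N - n1)%N n1 (leqnn _) n1N (leqnn _).
  have := S0 k.+1 n1.+1; have : g * (ln (ln n1%:R) - ln (ln k%:R)) <= g * D.
    by rewrite ler_wpM2l ?(ltW g0)// lerB// (lnlnle 2%N).
  rewrite !mulrBr; lra.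
apply: le_trans (S0 _ _).
have : g * (ln (ln N%:R) - ln (ln k%:R)) <= g * D.
  rewrite ler_wpM2l ?(ltW g0)// lerB// ?(lnlnle 2%N)//.
  by apply: lnlnle (ltnW Nn1); exact: leq_trans kN.
lra.
Qed.

End MertensLower.

(** * Partial summation against powers *)

Section PrimePowerWeights.
Variable R : realType.

Lemma powR_mean_value (s x y : R) : 0 < x -> x < y ->
  exists2 z, x < z < y & y `^ s - x `^ s = s * z `^ (s - 1) * (y - x).
Proof.
move=> x0 xy.
have dF (z : R) : z \in `]x, y[ -> is_derive z 1 (fun t : R => t `^ s) (s * z `^ (s - 1)).
  by rewrite in_itv/= => /andP[xz _]; apply: is_derive1_powR; exact: lt_trans xz.
have cF : {within `[x, y], continuous (fun t : R => t `^ s)}.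
  apply: derivable_within_continuous => z; rewrite in_itv/= => /andP[xz _].
  by apply: derivable_powR; rewrite in_itv/= andbT (lt_le_trans x0).
have [z zxy ->] := MVT xy dF cF.
by exists z => //; move: zxy; rewrite in_itv.
Qed.

Lemma powR_sub1 (s x : R) : 0 < x -> x `^ (s - 1) = x `^ s / x.
Proof.
move=> x0; rewrite powRD ?(gt_eqF x0) ?implybT// powRN powRr1 ?(ltW x0)//.
Qed.

Variables (s : R).
Hypothesis s0 : 0 < s.

(** Increments of n^s, the weights natural for partial summation when s may be smaller than 1. *)
Definition pgap (n : nat) : R := n.+1%:R `^ s - n%:R `^ s.
Definition gap_const : R := 2 `^ s / s.

Lemma gap_const_gt0 : 0 < gap_const.
Proof. by rewrite divr_gt0// powR_gt0. Qed.

Lemma pgap_ge0 n : 0 <= pgap n.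
Proof. by rewrite subr_ge0 ge0_ler_powR ?nnegrE ?ler_nat// ltW. Qed.

Lemma pgap_lower n : (0 < n)%N -> n.+1%:R `^ (s - 1) <= gap_const * pgap n.
Proof.
move=> n0; have nR : 0 < n%:R :> R by rewrite ltr0n.
have nn : n%:R < n.+1%:R :> R by rewrite ltr_nat.
have [z /andP[nz zn]] := powR_mean_value s nR nn.
have e : n.+1%:R - n%:R = 1 :> R by rewrite -natr1 addrC addKr.
have N0 : 0 < n.+1%:R :> R by [].
rewrite -/(pgap n) e mulr1 => ->.
have z0 : 0 < z := lt_trans nR nz.
rewrite /gap_const !powR_sub1// mulrA divfK ?gt_eqF// mulrA -powRM ?(ltW z0)//.
rewrite ler_pM ?powR_ge0 ?invr_ge0//.
- apply: ge0_ler_powR; rewrite ?nnegrE ?mulr_ge0 ?(ltW s0) ?(ltW z0)//.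
  have : 1 <= n%:R :> R by rewrite ler1n.
  lra.
- by rewrite lef_pV2 ?posrE// ltW.
Qed.

Lemma powR_sub1_variation n z : (0 < n)%N -> n%:R <= z <= n.+1%:R ->
  `|n.+1%:R `^ (s - 1) - z `^ (s - 1)| <= (gap_const + 1) * pgap n / n%:R.
Proof.
move=> n0 /andP[nz zn]; have nR : 0 < n%:R :> R by rewrite ltr0n.
have z0 : 0 < z := lt_le_trans nR nz.
have g := pgap_lower n0.
have N0 : 0 < n.+1%:R :> R by [].
rewrite ler_pdivlMr//.
apply: (@le_trans _ _ (`|n.+1%:R `^ (s - 1) - z `^ (s - 1)| * z)).
  by rewrite ler_wpM2l.
rewrite -[X in _ * X](gtr0_norm z0) -normrM mulrBl.
have -> : z `^ (s - 1) * z = z `^ s by rewrite powR_sub1// divfK// gt_eqF.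
have z1 : z `^ s <= n.+1%:R `^ s by rewrite ge0_ler_powR ?nnegrE// ltW.
have z2 : n%:R `^ s <= z `^ s by rewrite ge0_ler_powR ?nnegrE// ltW.
have e1 : n.+1%:R `^ (s - 1) * n.+1%:R = n.+1%:R `^ s by rewrite powR_sub1// divfK.
have e2 : n.+1%:R `^ (s - 1) * n%:R = n.+1%:R `^ s - n.+1%:R `^ (s - 1).
  by rewrite -e1 -natr1 mulrDr mulr1 addrK.
have p0 : 0 <= n.+1%:R `^ (s - 1) by exact: powR_ge0.
have h1 : n.+1%:R `^ (s - 1) * z <= n.+1%:R `^ s by rewrite -e1 ler_wpM2l.
have h2 : n.+1%:R `^ s - n.+1%:R `^ (s - 1) <= n.+1%:R `^ (s - 1) * z by rewrite -e2 ler_wpM2l.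
rewrite mulrDl mul1r ler_norml; rewrite {2 4}/pgap; move: g.
move: (gap_const * pgap n) h1 h2 z1 z2 p0.
move: (n.+1%:R `^ (s - 1) * z) (n.+1%:R `^ (s - 1)) (z `^ s) (n%:R `^ s) (n.+1%:R `^ s).
by move=> a b c d e f *; apply/andP; split; lra.
Qed.

Variable A : R.
Hypotheses (A0 : 0 < A) (A1 : A <= 1).

Lemma lnA_le (x : R) : 1 <= x -> ln x `^ A <= x.
Proof.
move=> x1; have x0 : 0 < x by rewrite (lt_le_trans ltr01).
have [l1|l1] := leP 1 (ln x).
  apply: le_trans (ler1_powR l1 A1) _; exact/ltW/ln_sublinear.
apply: (le_trans _ x1); apply: (@le_trans _ _ (1 `^ A)); last by rewrite powR1.
by apply: ge0_ler_powR; rewrite ?nnegrE ?(ltW A0)// ?ln_ge0// ltW.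
Qed.

Lemma lnA_gt0 n : (2 <= n)%N -> 0 < ln n%:R `^ A :> R.
Proof. by move=> n2; rewrite powR_gt0// ln_gt0// ltr1n. Qed.

Lemma sum_pgap m n : (m <= n)%N -> \sum_(m <= j < n) pgap j = n%:R `^ s - m%:R `^ s.
Proof. by move=> mn; rewrite telescope_sumr. Qed.

Lemma lnA_le_powR : exists2 K : R, 0 < K &
  forall n, (1 <= n)%N -> ln n%:R `^ A <= K * n%:R `^ (s / 2).
Proof.
have sA : 0 < s / 2 / A by rewrite !divr_gt0.
exists ((s / 2 / A)^-1 `^ A); first by rewrite powR_gt0// invr_gt0.
move=> n n1; have nR : 0 < n%:R :> R by rewrite ltr0n.
have -> : n%:R `^ (s / 2) = (n%:R `^ (s / 2 / A)) `^ A.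
  by rewrite -powRrM divfK// gt_eqF.
rewrite -powRM ?powR_ge0 ?invr_ge0 ?(ltW sA)//.
apply: ge0_ler_powR; rewrite ?nnegrE ?(ltW A0) ?ln_nat_ge0 ?ln_le_powR//.
by rewrite mulr_ge0 ?powR_ge0 ?invr_ge0 ?(ltW sA).
Qed.

(** Terms with ln j >= (ln n)/2 have the right size; the others add up to at most n^(s/2), which is
    absorbed by [lnA_le_powR]. *)
Lemma weighted_gap_sum : exists2 K : R, 0 < K &
  forall n, (2 <= n)%N ->
  \sum_(2 <= j < n) pgap j / ln j%:R `^ A <= K * (n%:R `^ s / ln n%:R `^ A).
Proof.
have [K K0 hK] := lnA_le_powR.
have l2A : 0 < ln 2 `^ A :> R by apply: (lnA_gt0 (n := 2)).
exists (2 `^ s * K / ln 2 `^ A + 2 `^ A).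
  apply: addr_gt0; last exact: powR_gt0.
  by apply: divr_gt0 => //; apply: mulr_gt0 => //; exact: powR_gt0.
move=> n n2; have nR : 0 < n%:R :> R by rewrite ltr0n (leq_trans _ n2).
have lA := lnA_gt0 n2.
pose q := Num.sqrt (n%:R : R).
have qq : q * q = n%:R by rewrite -expr2 sqr_sqrtr// ltW.
have q0 : 0 < q by rewrite sqrtr_gt0.
have q1 : 1 <= q by rewrite /q -[leLHS]sqrtr1 ler_wsqrtr// ler1n (leq_trans _ n2).
have lq : ln n%:R = 2 * ln q by rewrite -qq lnM ?posrE//; ring.
have ln0 : 0 < ln n%:R :> R by rewrite ln_gt0// ltr1n.
have lq0 : 0 < ln q by lra.
pose m := Num.truncn q.
have mq : m%:R <= q by rewrite truncn_le ltW.
have m1 : (1 <= m)%N by rewrite truncn_ge_nat// ltW.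
have qm : q < m.+1%:R by exact: truncnS_gt.
have t1 : \sum_(2 <= j < n) pgap j / ln j%:R `^ A <=
   \sum_(2 <= j < n | (j <= m)%N) pgap j / ln 2 `^ A +
   \sum_(2 <= j < n) pgap j * (2 `^ A / ln n%:R `^ A).
  rewrite [X in X + _]big_mkcond -big_split/= big_nat [leRHS]big_nat.
  apply: ler_sum => j /andP[j2 jn].
  have t0 : 0 <= pgap j * (2 `^ A / ln n%:R `^ A).
    by rewrite !mulr_ge0 ?pgap_ge0 ?invr_ge0 ?powR_ge0.
  have lj := lnA_gt0 j2.
  case: leqP => jm.
    rewrite -[leLHS]addr0 lerD// ler_wpM2l ?pgap_ge0// lef_pV2 ?posrE//.
    apply: ge0_ler_powR; rewrite ?nnegrE ?(ltW A0) ?ln_nat_ge0 ?(ln_nat_ge0 R 2)//.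
    by rewrite ler_ln ?posrE ?ltr0n ?ler_nat// (leq_trans _ j2).
  rewrite add0r ler_wpM2l ?pgap_ge0// ler_pdivlMr// mulrC ler_pdivrMr//.
  rewrite -powRM ?ln_nat_ge0//.
  apply: ge0_ler_powR; rewrite ?nnegrE ?(ltW A0) ?ln_nat_ge0 ?mulr_ge0 ?ln_nat_ge0//.
  rewrite lq ler_wpM2l// ler_ln ?posrE// ?ltr0n ?(leq_trans _ j2)//.
  by apply/ltW/(lt_le_trans qm); rewrite ler_nat.
apply: (le_trans t1); rewrite [leRHS]mulrDl lerD//.
  rewrite -mulr_suml.
  have t2 : \sum_(2 <= j < n | (j <= m)%N) pgap j <= m.+1%:R `^ s.
    have [nm|mn] := leqP n m.+1.
      apply: (@le_trans _ _ (\sum_(2 <= j < n) pgap j)).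
        rewrite big_mkcond; apply: ler_sum => j _; case: ifP => // _; exact: pgap_ge0.
      rewrite sum_pgap// lerBlDr (@le_trans _ _ (m.+1%:R `^ s)) ?lerDl ?powR_ge0//.
      by rewrite ge0_ler_powR ?nnegrE ?ler_nat// ltW.
    rewrite (eq_bigl (fun j => true && (j < m.+1)%N)); last by move=> j; rewrite ltnS.
    by rewrite -(@big_nat_widen _ _ _ 2 m.+1 n xpredT) ?(ltnW mn)// sum_pgap// gerBl powR_ge0.
  have t3 : m.+1%:R `^ s <= 2 `^ s * n%:R `^ (s / 2).
    have -> : n%:R `^ (s / 2) = q `^ s.
      by rewrite /q -powR12_sqrt ?(ltW nR)// -powRrM mulrC.
    rewrite -powRM ?(ltW q0)//; apply: ge0_ler_powR; rewrite ?nnegrE ?(ltW s0) ?mulr_ge0 ?(ltW q0)//.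
    by rewrite -natr1; lra.
  apply: (@le_trans _ _ (2 `^ s * n%:R `^ (s / 2) / ln 2 `^ A)).
    by rewrite ler_wpM2r ?invr_ge0 ?(ltW l2A)// (le_trans t2).
  rewrite (_ : 2 `^ s * K / _ * _ = (2 `^ s / ln 2 `^ A) * (K * (n%:R `^ s / ln n%:R `^ A))); last by ring.
  rewrite mulrAC ler_wpM2l ?mulr_ge0 ?invr_ge0 ?powR_ge0//.
  rewrite mulrA ler_pdivlMr//.
  have -> : n%:R `^ s = n%:R `^ (s / 2) * n%:R `^ (s / 2).
    by rewrite -powRD ?(gt_eqF nR) ?implybT//; congr (_ `^ _); field.
  by rewrite mulrCA ler_wpM2l ?powR_ge0// hK// (leq_trans _ n2).
rewrite -mulr_suml sum_pgap// [leRHS]mulrCA ler_wpM2r//.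
  by rewrite divr_ge0 ?powR_ge0.
by rewrite gerBl powR_ge0.
Qed.

End PrimePowerWeights.

(** * Weighted prime power sums *)

Section WeightedPrimeSums.
Variable R : realType.
Variables (s A beta eta C : R).
Hypotheses (s0 : 0 < s) (A0 : 0 < A) (A1 : A <= 1) (beta0 : 0 < beta)
  (eta0 : 0 < eta) (etas : eta <= s) (C0 : 0 < C).
Notation regular := (regular_weight A beta eta C).
Notation c5 := (gap_const s + 1).

Section Fixed.
Variable b : nat -> R.
Hypothesis rb : regular b.

Definition theta n := \sum_(1 <= p < n.+1 | prime p) b p * p%:R * ln p%:R.
Definition psi1 n := \sum_(1 <= p < n.+1 | prime p) b p * p%:R `^ s * ln p%:R.
Let Rm n := theta n - beta * n%:R.
Let E n := psi1 n - beta / s * n%:R `^ s - n%:R `^ (s - 1) * Rm n.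

(** Partial summation in differenced form: the remainder of theta is multiplied by the increment of
    n^(s-1) only. *)
Lemma psi1_remainder_step n : (1 <= n)%N ->
  `|E n.+1 - E n| <= c5 * pgap s n / n%:R * (beta + `|Rm n|).
Proof.
move=> n1; have nR : 0 < n%:R :> R by rewrite ltr0n.
have nn : n%:R < n.+1%:R :> R by rewrite ltr_nat.
have [z /andP[nz zn]] := powR_mean_value s nR nn.
have e : n.+1%:R - n%:R = 1 :> R by rewrite -natr1 addrC addKr.
rewrite -/(pgap s n) e mulr1 => gz.
have v1 := powR_sub1_variation s0 n1 (z := n%:R).
rewrite lexx (ltW nn) in v1; have {}v1 := v1 isT.
have v2 := powR_sub1_variation s0 n1 (z := z).
rewrite (ltW nz) (ltW zn) in v2; have {}v2 := v2 isT.
have t : psi1 n.+1 - psi1 n = n.+1%:R `^ (s - 1) * (theta n.+1 - theta n).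
  rewrite /psi1 /theta !(big_mkcond prime) !big_nat_recr//= [LHS]addrC addKr [X in _ = _ * X]addrC addKr.
  case: ifP => _; last by rewrite mulr0.
  by rewrite powR_sub1//; field.
have -> : E n.+1 - E n = beta * (n.+1%:R `^ (s - 1) - z `^ (s - 1)) -
    Rm n * (n.+1%:R `^ (s - 1) - n%:R `^ (s - 1)).
  have p1 : psi1 n.+1 = psi1 n + n.+1%:R `^ (s - 1) * (theta n.+1 - theta n) by rewrite -t addrC subrK.
  have p2 : n.+1%:R `^ s = n%:R `^ s + s * z `^ (s - 1) by rewrite -gz addrC subrK.
  rewrite /E /Rm p1 p2 -natr1; move: (_ `^ (s - 1)) (_ `^ (s - 1)) (_ `^ (s - 1)) => a a' a''.
  by field; rewrite gt_eqF.
apply: (le_trans (ler_normB _ _)); rewrite !normrM (gtr0_norm beta0) mulrDr lerD//.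
  by rewrite mulrC ler_wpM2r// ltW.
by rewrite mulrC ler_wpM2r.
Qed.

Lemma psi1_remainder : `|E 2| <= `|beta - beta / s| + c5 * pgap s 1 * (2 * beta).
Proof.
have Rm1 : Rm 1 = - beta.
  by rewrite /Rm /theta (big_mkcond prime)/= big_nat1 (_ : prime 1 = false)// mulr1 sub0r.
have E1 : E 1 = beta - beta / s.
  by rewrite /E Rm1 /psi1 (big_mkcond prime)/= big_nat1 (_ : prime 1 = false)// !powR1; ring.
have := psi1_remainder_step (leqnn 1).
rewrite Rm1 normrN (gtr0_norm beta0) divr1 -mulr2n -[beta *+ 2]mulr_natl E1 => h.
rewrite (_ : E 2 = (beta - beta / s) + (E 2 - (beta - beta / s))); last by rewrite addrC subrK.
by apply: (le_trans (ler_normD _ _)); rewrite lerD2l.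
Qed.

Lemma psi1_remainder_sum n : (2 <= n)%N ->
  `|E n - E 2| <= c5 * (beta + C) * \sum_(2 <= j < n) pgap s j / ln j%:R `^ A.
Proof.
move=> n2; rewrite -(telescope_sumr E n2).
apply: (le_trans (ler_norm_sum _ _ _)); rewrite mulr_sumr big_nat [leRHS]big_nat.
apply: ler_sum => j /andP[j2 jn].
have j1 : (1 <= j)%N by rewrite (leq_trans _ j2).
have jR : 0 < j%:R :> R by rewrite ltr0n.
apply: (le_trans (psi1_remainder_step j1)).
have lA := lnA_gt0 A j2.
have h : beta + `|Rm j| <= (beta + C) * (j%:R / ln j%:R `^ A).
  rewrite mulrDl lerD ?(rw_theta rb j2)//.
  rewrite ler_peMr ?(ltW beta0)// ler_pdivlMr// mul1r.
  by apply: lnA_le => //; rewrite ler1n.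
have c50 : 0 <= c5 * pgap s j / j%:R.
  by have g1 := gap_const_gt0 s0; have g2 := pgap_ge0 s0 j; nonneg.
apply: (le_trans (ler_wpM2l c50 h)).
by rewrite le_eqVlt; apply/orP; left; apply/eqP; field; rewrite !gt_eqF.
Qed.

Lemma psi1_main n : (2 <= n)%N ->
  `|psi1 n - beta / s * n%:R `^ s| <= `|E n - E 2| + `|E 2| + C * (n%:R `^ s / ln n%:R `^ A).
Proof.
move=> n2; have nR : 0 < n%:R :> R by rewrite ltr0n (leq_trans _ n2).
have -> : psi1 n - beta / s * n%:R `^ s = (E n - E 2) + E 2 + n%:R `^ (s - 1) * Rm n.
  by rewrite subrK /E subrK.
apply: (le_trans (ler_normD _ _)); rewrite lerD ?ler_normD//.
rewrite normrM ger0_norm ?powR_ge0//.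
apply: (le_trans (ler_wpM2l _ (rw_theta rb n2))); first exact: powR_ge0.
rewrite powR_sub1// le_eqVlt; apply/orP; left; apply/eqP.
by field; rewrite !gt_eqF// lnA_gt0.
Qed.

End Fixed.

(** Partial summation turns [rw_theta], of growth n, into a sum of growth n^s; beta/s comes from
    integrating beta t^(s-1) up to n. *)
Lemma psi1_asymptotics : exists2 K : R, 0 < K & forall b n, regular b -> (2 <= n)%N ->
  `|psi1 b n - beta / s * n%:R `^ s| <= K * (n%:R `^ s / ln n%:R `^ A).
Proof.
have [K K0 hK] := lnA_le_powR s0 A0.
have [K' K'0 hK'] := weighted_gap_sum s0 A0.
pose e2 := `|beta - beta / s| + c5 * pgap s 1 * (2 * beta).
have c50 : 0 < c5 by rewrite addr_gt0// gap_const_gt0.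
have e20 : 0 <= e2.
  by have g1 := gap_const_gt0 s0; have g2 := pgap_ge0 s0 1; rewrite /e2; nonneg.
exists (c5 * (beta + C) * K' + e2 * K + C).
  by clearbody e2; rewrite ltr_wpDl//; nonneg.
move=> b n rb n2; have nR : 1 <= n%:R :> R by rewrite ler1n (leq_trans _ n2).
have lA := lnA_gt0 A n2.
apply: (le_trans (psi1_main rb n2)); rewrite [leRHS]mulrDl lerD// [leRHS]mulrDl lerD//.
  apply: (le_trans (psi1_remainder_sum rb n2)); rewrite -[leRHS]mulrA ler_wpM2l ?hK'//.
  by nonneg.
apply: (le_trans (psi1_remainder b)); rewrite -/e2 -mulrA ler_peMr// mulrA ler_pdivlMr// mul1r.
apply: (le_trans (hK n _)); first by rewrite (leq_trans _ n2).
by rewrite ler_wpM2l ?(ltW K0)// ler_powR// ler_pdivrMr// ler_peMr// ?ler1n// ltW.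
Qed.

Lemma psi1_real : exists2 K : R, 0 < K & forall b (y : R) N, regular b -> 2 <= y -> y <= N%:R ->
  `|\sum_(1 <= p < N.+1 | prime p && (p%:R <= y)) b p * p%:R `^ s * ln p%:R - beta / s * y `^ s|
  <= K * (y `^ s / ln y `^ A).
Proof.
have [K K0 hK] := psi1_asymptotics.
exists ((K + beta / s * (s * 2 `^ s)) * 2 `^ A).
  by rewrite mulr_gt0 ?powR_gt0// addr_gt0// !mulr_gt0 ?invr_gt0 ?powR_gt0.
move=> b y N rb y2 yN; have y0 : 0 < y by lra.
pose n := Num.truncn y.
have ny : n%:R <= y by rewrite truncn_le ltW.
have yn : y < n.+1%:R by exact: truncnS_gt.
have n2 : (2 <= n)%N by rewrite truncn_ge_nat// ltW.
have nN : (n <= N)%N by rewrite -(ler_nat R) (le_trans ny).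
have nR : 0 < n%:R :> R by rewrite ltr0n (leq_trans _ n2).
have -> : \sum_(1 <= p < N.+1 | prime p && (p%:R <= y)) b p * p%:R `^ s * ln p%:R = psi1 b n.
  rewrite /psi1 [RHS](@big_nat_widen _ _ _ 1 n.+1 N.+1)//; apply: eq_bigl => p.
  by rewrite ltnS /n truncn_ge_nat// ltW.
have lA := lnA_gt0 A n2.
have ns : n%:R `^ s <= y `^ s by rewrite ge0_ler_powR ?nnegrE ?(ltW y0) ?(ltW s0).
have ly0 : 0 < ln y by rewrite ln_gt0//; lra.
have lly : ln y <= 2 * ln n%:R.
  have -> : 2 * ln n%:R = ln (n ^ 2)%:R :> R by rewrite natrX lnXn// mulr_natl.
  rewrite ler_ln ?posrE ?ltr0n ?expn_gt0 ?(leq_trans _ n2)//.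
  apply/ltW/(lt_le_trans yn); rewrite ler_nat; move: n2; clear; nia.
have lyA : (ln n%:R `^ A)^-1 <= 2 `^ A * (ln y `^ A)^-1.
  rewrite ler_pdivlMr ?powR_gt0// mulrC ler_pdivrMr//.
  rewrite -powRM ?ln_nat_ge0//.
  by apply: ge0_ler_powR; rewrite ?nnegrE ?(ltW A0) ?(ltW ly0) ?mulr_ge0 ?ln_nat_ge0.
have d : y `^ s - n%:R `^ s <= s * 2 `^ s * (y `^ s / ln n%:R `^ A).
  have nn : n%:R < n.+1%:R :> R by rewrite ltr_nat.
  have [z /andP[nz zn]] := powR_mean_value s nR nn.
  have e : n.+1%:R - n%:R = 1 :> R by rewrite -natr1 addrC addKr.
  have z0 : 0 < z := lt_trans nR nz.
  rewrite e mulr1 powR_sub1// => gz.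
  apply: (@le_trans _ _ (n.+1%:R `^ s - n%:R `^ s)).
    by rewrite lerD2r ge0_ler_powR ?nnegrE ?(ltW y0) ?(ltW s0)// ltW.
  rewrite gz -mulrA ler_wpM2l ?(ltW s0)// mulrA ler_pM ?powR_ge0 ?invr_ge0 ?(ltW z0)//.
    apply: (@le_trans _ _ (2 `^ s * n%:R `^ s)); last by rewrite ler_wpM2l ?powR_ge0.
    rewrite -powRM ?(ltW nR)// ge0_ler_powR ?nnegrE ?mulr_ge0 ?(ltW nR) ?(ltW z0) ?(ltW s0)//.
    have : 2 <= n%:R :> R by rewrite ler_nat.
    move: zn; rewrite -natr1; lra.
  rewrite lef_pV2 ?posrE//; apply: (le_trans (lnA_le A0 A1 _)); last exact: ltW.
  by rewrite ler1n (leq_trans _ n2).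
have main := hK b n rb n2.
have bs0 : 0 < beta / s by rewrite divr_gt0.
have Y0 : 0 <= y `^ s by exact: powR_ge0.
apply: (@le_trans _ _ ((K + beta / s * (s * 2 `^ s)) * (y `^ s / ln n%:R `^ A))); last first.
  rewrite -[leRHS]mulrA ler_wpM2l//.
    by rewrite addr_ge0 ?(ltW K0)// !mulr_ge0 ?invr_ge0 ?powR_ge0// ltW.
  by rewrite mulrCA ler_wpM2l.
rewrite (_ : _ - _ = (psi1 b n - beta / s * n%:R `^ s) - beta / s * (y `^ s - n%:R `^ s)); last by ring.
apply: (le_trans (ler_normB _ _)); rewrite mulrDl lerD//.
  apply: (le_trans main); rewrite ler_wpM2l ?(ltW K0)// ler_wpM2r//.
  by rewrite invr_ge0 ltW.
rewrite normrM (gtr0_norm bs0) -mulrA ler_wpM2l ?(ltW bs0)// ger0_norm ?subr_ge0//.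
Qed.

(** The sum over the prime powers that may be adjoined to m without exceeding N, weighted by alpha instead of b. *)
Definition psim (b : nat -> R) N m := \sum_(1 <= p < N.+1 | prime p)
  \sum_(1 <= v < N.+1 | ~~ (p %| m)%N && (p ^ v * m <= N)%N)
    b (p ^ v)%N * (p ^ v)%:R `^ s * ln (p ^ v)%:R.

Lemma psim_decomposition b N m : regular b -> (0 < m <= N)%N ->
  \sum_(1 <= p < N.+1 | prime p && (p%:R <= N%:R / m%:R :> R)) b p * p%:R `^ s * ln p%:R -
  \sum_(1 <= p < N.+1 | prime p && (p %| m)%N)
     (if p%:R <= N%:R / m%:R :> R then b p * p%:R `^ s * ln p%:R else 0)
  <= psim b N m <=
  \sum_(1 <= p < N.+1 | prime p && (p%:R <= N%:R / m%:R :> R)) b p * p%:R `^ s * ln p%:R +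
  \sum_(1 <= p < N.+1 | prime p) \sum_(2 <= v < N.+1 | (p ^ v)%:R <= N%:R / m%:R :> R)
     b (p ^ v)%N * (p ^ v)%:R `^ s * ln (p ^ v)%:R.
Proof.
move=> rb /andP[m0 mN].
pose X p v := b (p ^ v)%N * (p ^ v)%:R `^ s * ln (p ^ v)%:R.
have mR : 0 < m%:R :> R by rewrite ltr0n.
have cond q : (q * m <= N)%N = (q%:R <= N%:R / m%:R :> R).
  by rewrite ler_pdivlMr// -natrM ler_nat.
have X0 p v : 0 <= X p v.
  by rewrite !mulr_ge0 ?(rw_ge0 rb) ?powR_ge0 ?ln_nat_ge0.
have N1 : (1 < N.+1)%N by rewrite ltnS (leq_trans m0).
rewrite /psim big_mkcondr/= [X in _ - X]big_mkcondr/=.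
rewrite -sumrB -big_split/=; apply/andP; split; apply: ler_sum_pred => p pp _.
  rewrite (big_mkcond (fun v => _ && _)) big_ltn//= -[leLHS]addr0 lerD//; last first.
    by apply: sumr_ge0 => v _; case: ifP => // _; exact: X0.
  have := X0 p 1%N; rewrite /X expn1 cond => x0.
  by case: (p %| m)%N; case: ifP => //= _; rewrite ?subrr ?subr0.
rewrite (big_mkcond (fun v => _ && _)) big_ltn//= lerD//.
  have := X0 p 1%N; rewrite /X expn1 cond => x0.
  by case: (p %| m)%N; case: ifP => //=.
rewrite [leRHS]big_mkcond; apply: ler_sum => v _; rewrite cond.
by have := X0 p v; case: (p %| m)%N => /=; case: ifP.
Qed.

(** The sum differs from the sum over the primes p <= N/m by the primes dividing m, O(ln m) in number, and
    the proper prime powers, so when ln (N/m) >= sqrt(ln N) both corrections are smaller than the main term by a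
    power of N/m, which beats (ln N)^(A/2). *)
Lemma psim_bounds : exists2 K : R, 0 < K & forall b N m, regular b -> (0 < m <= N)%N ->
  psim b N m <= K * (N%:R / m%:R) `^ s /\
  (1 <= ln (N%:R : R) -> Num.sqrt (ln N%:R) <= ln (N%:R / m%:R : R) ->
   `|psim b N m - beta / s * (N%:R / m%:R) `^ s| <=
     K * ((N%:R / m%:R) `^ s / ln N%:R `^ (A / 2))).
Proof.
have [K K0 hK] := psi1_real.
have l2A : 0 < ln 2 `^ A :> R by exact: (@lnA_gt0 R A 2).
pose K1 := beta / s + K / ln 2 `^ A + C / eta.
have bs0 : 0 < beta / s by rewrite divr_gt0.
have K10 : 0 < K1 by rewrite /K1 !addr_gt0// divr_gt0.
pose e4 := eta / 4.
have e40 : 0 < e4 by rewrite divr_gt0.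
pose K2 := K + 4 * C * e4^-1 ^+ 4.
have K20 : 0 < K2.
  by apply: addr_gt0 => //; apply: mulr_gt0; [exact: mulr_gt0|by apply: exprn_gt0; rewrite invr_gt0].
exists (K1 + K2); first exact: addr_gt0.
move=> b N m rb mN; have /andP[m0 m_N] := mN.
have mR : 0 < m%:R :> R by rewrite ltr0n.
have NR : 0 < N%:R :> R by rewrite ltr0n (leq_trans m0).
set y : R := N%:R / m%:R.
have y1 : 1 <= y by rewrite ler_pdivlMr// mul1r ler_nat.
have y0 : 0 < y by lra.
have yN : y <= N%:R by rewrite ler_pdivrMr// ler_peMr ?(ltW NR)// ler1n.
have := psim_decomposition rb mN; rewrite -/y.
set T3 := \sum_(1 <= p < _ | _) _; set T1 := \sum_(1 <= p < _ | _) _.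
set T2 := \sum_(1 <= p < _ | _) _ => /= /andP[lo up].
have Y0 : 0 <= y `^ s by exact: powR_ge0.
have pv0 p v : prime p -> 0 < (p ^ v)%:R :> R by move=> pp; rewrite ltr0n expn_gt0 prime_gt0.
have pv1 p v : prime p -> 1 <= (p ^ v)%:R :> R by move=> pp; rewrite ler1n expn_gt0 prime_gt0.
split.
  apply: (@le_trans _ _ (K1 * y `^ s)); last by rewrite ler_wpM2r// lerDl ltW.
  apply: (le_trans up); rewrite /K1 [leRHS]mulrDl lerD//.
    have [y2|y2] := ltP y 2.
      rewrite /T1 big1 ?mulr_ge0 ?addr_ge0 ?divr_ge0 ?(ltW l2A) ?(ltW K0) ?(ltW beta0) ?(ltW s0)//.
      move=> p /andP[/prime_gt1 p1 py].
      by have := le_lt_trans py y2; rewrite ltr_nat ltnNge p1.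
    have := hK b y N rb y2 yN; rewrite -/T1 ler_norml => /andP[_]; rewrite lerBlDr => h.
    apply: (le_trans h); rewrite mulrDl addrC lerD2l mulrA [leRHS]mulrAC ler_wpM2l ?mulr_ge0 ?(ltW K0)//.
    rewrite lef_pV2 ?posrE//; last by rewrite powR_gt0// ln_gt0//; lra.
    by apply: ge0_ler_powR; rewrite ?nnegrE ?(ltW A0) ?ln_ge0 ?ler_ln ?posrE//; lra.
  apply: (@le_trans _ _ (y `^ s * \sum_(1 <= p < N.+1 | prime p) \sum_(2 <= v < N.+1) b (p ^ v)%N * ln (p ^ v)%:R)).
    rewrite mulr_sumr; apply: ler_sum_pred => p pp _; rewrite mulr_sumr big_mkcond.
    apply: ler_sum => v _; have bl : 0 <= b (p ^ v)%N * ln (p ^ v)%:R by rewrite mulr_ge0 ?(rw_ge0 rb) ?ln_nat_ge0.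
    case: ifP => [py|_]; last by rewrite mulr_ge0.
    rewrite mulrAC mulrC ler_wpM2r//.
    by apply: ge0_ler_powR; rewrite ?nnegrE ?(ltW s0) ?(ltW y0)// ltW// pv0.
  rewrite mulrC ler_wpM2r// (le_trans (prime_power_tail_log eta0 N N.+1 rb))//.
  by rewrite mulrC.
move=> L1; set L := ln (N%:R : R) in L1 *; set l := ln y => sl.
have L0 : 0 < L by lra.
have sL1 : 1 <= Num.sqrt L by rewrite -[leLHS]sqrtr1 ler_wsqrtr.
have l1 : 1 <= l := le_trans sL1 sl.
have ll : L <= l ^+ 2 by rewrite -(sqr_sqrtr (ltW L0)) lerXn2r ?nnegrE//; lra.
have y2 : 2 <= y.
  have h : ln (1 + (y - 1)) <= y - 1 by apply: le_ln1Dx; lra.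
  by move: h; rewrite (_ : 1 + (y - 1) = y) -/l; [lra|ring].
have lA : L `^ (A / 2) <= l `^ A.
  have -> : l `^ A = (l ^+ 2) `^ (A / 2).
    by rewrite -powR_mulrn -?powRrM; [congr (_ `^ _); field|lra].
  apply: ge0_ler_powR; rewrite ?nnegrE ?sqr_ge0 ?divr_ge0 ?(ltW A0) ?(ltW L0)//.
have LA0 : 0 < L `^ (A / 2) by rewrite powR_gt0.
have ye0 : 0 <= y `^ (s - eta) by exact: powR_ge0.
have key (q : nat) : 1 <= q%:R :> R -> q%:R <= y -> q%:R `^ s * ln q%:R <= q%:R `^ eta * (y `^ (s - eta) * l).
  move=> q1 qy; have q0 : 0 < q%:R :> R by lra.
  have -> : q%:R `^ s = q%:R `^ eta * q%:R `^ (s - eta).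
    by rewrite -powRD ?(gt_eqF q0) ?implybT// addrC subrK.
  rewrite -mulrA ler_wpM2l ?powR_ge0// ler_pM ?powR_ge0 ?ln_ge0//.
    by apply: ge0_ler_powR; rewrite ?nnegrE ?subr_ge0 ?(ltW q0) ?(ltW y0).
  by rewrite ler_ln.
have T3b : T3 <= C * (y `^ (s - eta) * l).
  apply: (@le_trans _ _ (\sum_(1 <= p < N.+1 | prime p) \sum_(2 <= v < N.+1) b (p ^ v)%N * (p ^ v)%:R `^ eta * (y `^ (s - eta) * l))).
    apply: ler_sum_pred => p pp _; rewrite big_mkcond; apply: ler_sum => v _.
    case: ifP => [py|_]; last by rewrite !mulr_ge0 ?(rw_ge0 rb) ?powR_ge0//; lra.
    by rewrite -!mulrA ler_wpM2l ?(rw_ge0 rb)// key// pv1.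
  under eq_bigr do rewrite -mulr_suml.
  rewrite -mulr_suml ler_wpM2r ?(rw_pow rb)// mulr_ge0//; lra.
have T2b : T2 <= C * (y `^ (s - eta) * l) * (2 * L).
  apply: (@le_trans _ _ (\sum_(1 <= p < N.+1 | prime p && (p %| m)%N) C * (y `^ (s - eta) * l) * 1)).
    apply: ler_sum_pred => p /andP[pp pm] _; rewrite mulr1.
    case: ifP => [py|_]; last by rewrite !mulr_ge0 ?(ltW C0)//; lra.
    have p1 : 1 <= p%:R :> R by rewrite ler1n prime_gt0.
    have p0 : 0 < p%:R :> R by lra.
    have k := key p p1 py.
    rewrite -mulrA; apply: (le_trans (ler_wpM2l (rw_ge0 rb p) k)).
    rewrite [leLHS]mulrA ler_wpM2r//; first by rewrite mulr_ge0//; lra.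
    have := rw_small rb pp; rewrite powRN => h.
    by rewrite -ler_pdivlMr ?powR_gt0.
  rewrite -mulr_sumr ler_wpM2l//.
    by rewrite !mulr_ge0 ?(ltW C0)//; lra.
  apply: (le_trans (prime_divisor_count R mN)).
  by rewrite ler_wpM2l// ler_ln ?posrE ?ler_nat.
have small : y `^ (s - eta) * l * (1 + 2 * L) <= 4 * e4^-1 ^+ 4 * (y `^ s / L `^ (A / 2)).
  have l0 : 0 <= l by lra.
  have h1 : l ^+ 4 <= e4^-1 ^+ 4 * y `^ eta.
    have -> : y `^ eta = (y `^ e4) ^+ 4.
      by rewrite -powR_mulrn ?powR_ge0// -powRrM; congr (_ `^ _); rewrite /e4; field.
    rewrite -exprMn lerXn2r ?nnegrE ?mulr_ge0 ?invr_ge0 ?powR_ge0 ?(ltW e40)//.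
    exact: ln_le_powR.
  have h2 : L `^ (A / 2) <= l.
    by apply: (le_trans lA); exact: ler1_powR.
  have ys : y `^ s = y `^ (s - eta) * y `^ eta.
    by rewrite -powRD ?(gt_eqF y0) ?implybT// subrK.
  rewrite mulrA ler_pdivlMr// ys.
  apply: (@le_trans _ _ (y `^ (s - eta) * (4 * l ^+ 4))).
    rewrite -!mulrA ler_wpM2l// (_ : 4 * l ^+ 4 = l * ((4 * l ^+ 2) * l)); last by ring.
    rewrite ler_wpM2l// ler_pM ?(ltW LA0)//; [lra|nra].
  rewrite (_ : 4 * _ * (_ * _) = y `^ (s - eta) * (4 * (e4^-1 ^+ 4 * y `^ eta))); last by ring.
  by rewrite ler_wpM2l// ler_wpM2l.
have main := hK b y N rb y2 yN; rewrite -/T1 -/l in main.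
have T20 : 0 <= T2.
  apply: sumr_pred_ge0 => p _ _; case: ifP => // _.
  by rewrite !mulr_ge0 ?(rw_ge0 rb) ?powR_ge0 ?ln_nat_ge0.
have T30 : 0 <= T3.
  apply: sumr_pred_ge0 => p _ _; apply: sumr_ge0 => v _.
  by rewrite !mulr_ge0 ?(rw_ge0 rb) ?powR_ge0 ?ln_nat_ge0.
have d1 : `|psim b N m - T1| <= T2 + T3 by rewrite ler_norml; apply/andP; split; lra.
have d2 : T2 + T3 <= C * (4 * e4^-1 ^+ 4 * (y `^ s / L `^ (A / 2))).
  apply: (le_trans (lerD T2b T3b)).
  rewrite (_ : _ + _ = C * (y `^ (s - eta) * l * (1 + 2 * L))); last by ring.
  by rewrite ler_wpM2l ?(ltW C0).
have d3 : K * (y `^ s / l `^ A) <= K * (y `^ s / L `^ (A / 2)).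
  rewrite ler_wpM2l ?(ltW K0)// ler_wpM2l// lef_pV2 ?posrE// (lt_le_trans LA0)//.
rewrite (_ : _ - _ = (psim b N m - T1) + (T1 - beta / s * y `^ s)); last by rewrite addrA subrK.
apply: (le_trans (ler_normD _ _)); apply: (le_trans (lerD (le_trans d1 d2) (le_trans main d3))).
rewrite [leLHS](_ : _ = K2 * (y `^ s / L `^ (A / 2))); last by rewrite /K2; ring.
by rewrite ler_wpM2r ?divr_ge0 ?powR_ge0// lerDr ltW.
Qed.

End WeightedPrimeSums.

(** * Expanding the logarithm *)

Section LogReduction.
Variable R : realType.
Variables (s A beta eta C : R).
Hypotheses (s0 : 0 < s) (A0 : 0 < A) (A1 : A <= 1) (beta0 : 0 < beta)
  (eta0 : 0 < eta) (etas : eta <= s) (C0 : 0 < C).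
Notation regular := (regular_weight A beta eta C).
Notation Kc := (power_interval_const A beta eta C).

(** Expanding ln n over prime powers and bounding G (p^v m) by G2 m, the sum over p^v runs over an interval of ratio H
    for each m, where [chebyshev_power_interval] applies. *)
Lemma log_trick_upper b (G G2 : nat -> R) (y H : R) N : regular b ->
  0 < y -> 1 <= H -> (forall n, 0 <= G n) -> (forall n, 0 <= G2 n) ->
  (forall m p v, (0 < m)%N -> prime p -> (0 < v)%N -> ~~ (p %| m)%N ->
     G (p ^ v * m)%N <= G2 m) ->
  \sum_(1 <= n < N.+1 | y / H < n%:R <= y) b n * ln n%:R * G n <=
  Kc * (1 + ln H) * \sum_(1 <= m < N.+1 | m%:R <= y) b m * G2 m.
Proof.
move=> rb y0 H1 G0 G20 hG.
have H0 : 0 < H by rewrite (lt_le_trans ltr01).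
have KH0 : 0 <= Kc * (1 + ln H).
  apply: mulr_ge0; first exact/ltW/power_interval_const_gt0.
  by apply: addr_ge0 => //; exact: ln_ge0.
pose g n := if y / H < n%:R <= y then G n else 0.
have -> : \sum_(1 <= n < N.+1 | y / H < n%:R <= y) b n * ln n%:R * G n =
    \sum_(1 <= n < N.+1) b n * ln n%:R * g n.
  by rewrite big_mkcond; apply: eq_bigr => n _; rewrite /g; case: ifP; rewrite ?mulr0.
rewrite (log_weight_sum g N (rw_mul rb)) mulr_sumr [leRHS]big_mkcond [leLHS]big_nat [leRHS]big_nat.
apply: ler_sum => m /andP[m0 mN]; have mR : 0 < m%:R :> R by rewrite ltr0n.
case: ifP => my; last first.
  rewrite le_eqVlt; apply/orP; left; apply/eqP.
  rewrite big1 ?mulr0// => p pp; rewrite big1// => v _.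
  rewrite /g ifF ?mulr0//; apply/negbTE/negP => /andP[_ h].
  have : m%:R <= y by apply: le_trans h; rewrite ler_nat leq_pmull// expn_gt0 prime_gt0.
  by rewrite my.
rewrite [leRHS]mulrCA ler_wpM2l ?(rw_ge0 rb)//.
have ym0 : 0 < y / m%:R by rewrite divr_gt0.
have ch := chebyshev_power_interval A0 beta0 eta0 C0 N N rb ym0 H1.
apply: (@le_trans _ _ (G2 m * \sum_(1 <= p < N.+1 | prime p)
  \sum_(1 <= v < N.+1 | y / m%:R / H < (p ^ v)%:R <= y / m%:R) b (p ^ v)%N * ln (p ^ v)%:R)); last first.
  by rewrite [leLHS]mulrC ler_wpM2r.
rewrite mulr_sumr; apply: ler_sum_pred => p pp _.
rewrite mulr_sumr [leLHS]big_mkcond [leRHS]big_mkcond [leLHS]big_nat [leRHS]big_nat.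
apply: ler_sum => v /andP[v0 _].
have bl : 0 <= b (p ^ v)%N * ln (p ^ v)%:R by rewrite mulr_ge0 ?(rw_ge0 rb) ?ln_nat_ge0.
have -> : (y / m%:R / H < (p ^ v)%:R <= y / m%:R) = (y / H < (p ^ v * m)%:R <= y).
  rewrite natrM -[in RHS]ltr_pdivrMr// -[in RHS]ler_pdivlMr//.
  by rewrite mulrAC.
have Gbl : 0 <= G2 m * (b (p ^ v)%N * ln (p ^ v)%:R) by apply: mulr_ge0.
rewrite /g; case: ifP => [/andP[pm _]|_]; last by case: ifP.
by case: ifP => _; [rewrite mulrC ler_wpM2r// hG|rewrite mulr0].
Qed.

(** Expand ln n = sum ln (p^v) and write n = p^v m.  Three errors arise: replacing g(p^v m) by g m, which
    costs g1; replacing the sum over p^v by its asymptotic value; and replacing ln n by ln N.  The last two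
    are small unless ln (N/m) < sqrt(ln N), and such m carry little mass by [log_trick_upper]. *)
Lemma log_reduction : exists2 K : R, 0 < K &
  forall b N (g g1 g2 : nat -> R), regular b -> 4 <= ln (N%:R : R) ->
  (forall n, 0 <= g1 n) -> (forall n, 0 <= g2 n) ->
  (forall m, `|g m| <= g2 m) ->
  (forall m p v, (0 < m)%N -> prime p -> (0 < v)%N -> ~~ (p %| m)%N ->
     `|g (p ^ v * m)%N - g m| <= g1 m /\ `|g (p ^ v * m)%N| <= g2 m) ->
  `|ln N%:R * \sum_(1 <= n < N.+1) b n * n%:R `^ s * g n
    - beta / s * N%:R `^ s * \sum_(1 <= n < N.+1) b n * g n| <=
  K * N%:R `^ s * (\sum_(1 <= n < N.+1) b n * g1 n +
     (ln N%:R `^ (A / 2))^-1 * \sum_(1 <= n < N.+1) b n * g2 n).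
Proof.
have [K K0 hK] := psim_bounds s0 A0 A1 beta0 eta0 etas C0.
have Kc0 : 0 < Kc by exact: power_interval_const_gt0.
have bs0 : 0 < beta / s by rewrite divr_gt0.
pose Kn := K + beta / s + s^-1.
have Kn0 : 0 < Kn by rewrite !addr_gt0// invr_gt0.
have is0 : 0 < (s / 2)^-1 by rewrite invr_gt0 divr_gt0.
pose Kf := K + (s / 2)^-1 ^+ 2.
have Kf0 : 0 < Kf by rewrite addr_gt0// exprn_gt0.
exists (K + Kf + Kn * (4 * Kc)).
  by apply: addr_gt0; [exact: addr_gt0|apply: mulr_gt0 => //; exact: mulr_gt0].
move=> b N g g1 g2 rb L4 g10 g20 gg2 hg.
have b0 := rw_ge0 rb.
set L := ln (N%:R : R) in L4 *.
have L0 : 0 < L by lra.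
have N1 : (1 <= N)%N.
  by rewrite lt0n; apply/eqP => N0; move: L4; rewrite /L N0 ln0//; lra.
have NR : 0 < N%:R :> R by rewrite ltr0n.
set S1 := \sum_(1 <= n < N.+1) b n * g1 n; set S2 := \sum_(1 <= n < N.+1) b n * g2 n.
have S20 : 0 <= S2 by apply: sumr_ge0 => n _; rewrite mulr_ge0.
have S10 : 0 <= S1 by apply: sumr_ge0 => n _; rewrite mulr_ge0.
pose q := Num.sqrt L.
have q2 : 2 <= q.
  have -> : 2 = Num.sqrt (2 ^+ 2) :> R by rewrite sqrtr_sqr ger0_norm.
  by rewrite ler_wsqrtr//; lra.
have qq : q * q = L by rewrite -expr2 sqr_sqrtr// ltW.
pose eps := (L `^ (A / 2))^-1.
have eps0 : 0 < eps by rewrite invr_gt0 powR_gt0.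
have qeps : q^-1 <= eps.
  rewrite /eps lef_pV2 ?posrE ?powR_gt0//; last by lra.
  rewrite /q -powR12_sqrt ?(ltW L0)// ler_powR//; first by apply: le_trans L4; rewrite ler1n.
  by rewrite -[leRHS]mul1r ler_wpM2r// invr_ge0.
pose alpha n := b n * n%:R `^ s.
have alphaM m n : (0 < m)%N -> (0 < n)%N -> coprime m n -> alpha (m * n)%N = alpha m * alpha n.
  by move=> m0 n0 mn; rewrite /alpha (rw_mul rb)// natrM powRM//; ring.
have a0 n : 0 <= alpha n by rewrite mulr_ge0 ?powR_ge0.
have mNs m : (0 < m)%N -> m%:R `^ s * (N%:R / m%:R) `^ s = N%:R `^ s.
  move=> m0; rewrite -powRM ?divr_ge0//; congr (_ `^ _).
  by rewrite mulrC divfK// pnatr_eq0 -lt0n.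
(* For m close to N the prime sum over p^v <= N/m is too short for its
   asymptotics; those m have total weight O(L^(-1/2)). *)
pose near m := (ln (N%:R / m%:R : R) < q).
have nearS : \sum_(1 <= m < N.+1 | near m) b m * `|g m| <= 4 * Kc * (eps * S2).
  have H1 : 1 <= expR q by rewrite -[leLHS]expR0 ler_expR; lra.
  have ub := @log_trick_upper b (fun n => `|g n|) g2 N%:R (expR q) N rb NR H1
    (fun n => normr_ge0 _) g20 (fun m p v m0 pp v0 pm => (hg m p v m0 pp v0 pm).2).
  rewrite expRK in ub.
  have ub2 : L / 2 * \sum_(1 <= m < N.+1 | near m) b m * `|g m| <= Kc * (1 + q) * S2.
    apply: (@le_trans _ _ (\sum_(1 <= n < N.+1 | N%:R / expR q < n%:R <= (N%:R : R)) b n * ln n%:R * `|g n|)).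
      rewrite mulr_sumr [leLHS]big_mkcond [leRHS]big_mkcond [leLHS]big_nat [leRHS]big_nat.
      apply: ler_sum => m /andP[m0 mN]; have mR : 0 < m%:R :> R by rewrite ltr0n.
      have lm : ln (N%:R / m%:R) = L - ln m%:R :> R by rewrite ln_div ?posrE.
      have -> : (N%:R / expR q < m%:R <= (N%:R : R)) = near m.
        rewrite ler_nat -ltnS mN andbT /near -[RHS]ltr_expR lnK ?posrE ?divr_gt0//.
        by rewrite ltr_pdivrMr ?expR_gt0// ltr_pdivrMr// mulrC.
      case: ifP => // nm; rewrite mulrCA -mulrA ler_wpM2l// ler_wpM2r//.
      by move: nm; rewrite /near lm; nra.
    apply: (le_trans ub); rewrite ler_wpM2l//; first by rewrite mulr_ge0 ?(ltW Kc0)//; lra.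
    rewrite big_mkcond; apply: ler_sum => n _; case: ifP => // _; exact: mulr_ge0.
  have q0 : 0 < q by lra.
  have ub3 : \sum_(1 <= m < N.+1 | near m) b m * `|g m| <= 4 * Kc * (q^-1 * S2).
    rewrite -(ler_pM2l (divr_gt0 L0 (ltr0Sn R 1))); apply: (le_trans ub2).
    rewrite -qq (_ : q * q / 2 * _ = Kc * (2 * q) * S2); last by field; rewrite gt_eqF.
    by rewrite ler_wpM2r// ler_wpM2l ?(ltW Kc0)//; lra.
  by apply: (le_trans ub3); rewrite ler_wpM2l ?mulr_ge0 ?(ltW Kc0)// ler_wpM2r.
have split (F : nat -> R) (cf cn : R) : 0 <= cf -> 0 <= cn ->
  (forall m, (0 < m <= N)%N -> `|F m| <= b m * `|g m| * N%:R `^ s * (if near m then cn else cf * eps)) ->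
  `|\sum_(1 <= m < N.+1) F m| <= N%:R `^ s * (cf * (eps * S2) + cn * (4 * Kc * (eps * S2))).
  move=> cf0 cn0 hF; apply: (le_trans (ler_norm_sum _ _ _)).
  apply: (@le_trans _ _ (N%:R `^ s * (cf * eps * S2 + cn * \sum_(1 <= m < N.+1 | near m) b m * `|g m|))); last first.
    by rewrite ler_wpM2l ?powR_ge0//; apply: lerD; [rewrite mulrA|rewrite ler_wpM2l].
  rewrite mulrDr !mulr_sumr [X in _ <= _ + X]big_mkcond -big_split/= [leLHS]big_nat [leRHS]big_nat.
  apply: ler_sum => m /andP[m0 mN].
  have Ns0 : 0 <= N%:R `^ s :> R by exact: powR_ge0.
  have bg : b m * `|g m| <= b m * g2 m by rewrite ler_wpM2l.
  have bg0 : 0 <= b m * `|g m| by rewrite mulr_ge0.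
  have ce : 0 <= cf * eps by rewrite mulr_ge0// ltW.
  apply: (le_trans (hF m _)); first by rewrite m0 -ltnS.
  case: ifP => _.
    rewrite (_ : _ * _ * cn = N%:R `^ s * (cn * (b m * `|g m|))); last by ring.
    by rewrite lerDr; have := mulr_ge0 ce (le_trans bg0 bg) => h; nonneg.
  rewrite addr0 (_ : _ * _ * (cf * eps) = N%:R `^ s * (cf * eps * (b m * `|g m|))); last by ring.
  by rewrite ler_wpM2l// ler_wpM2l.
have Ns0 : 0 <= N%:R `^ s :> R by exact: powR_ge0.
(* Replacing ln m by ln N. *)
have D3 : `|\sum_(1 <= m < N.+1) alpha m * g m * (L - ln m%:R)| <=
   N%:R `^ s * ((s / 2)^-1 ^+ 2 * (eps * S2) + s^-1 * (4 * Kc * (eps * S2))).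
  apply: split; [exact: sqr_ge0|by rewrite invr_ge0 ltW|].
  move=> m /andP[m0 mN]; have mR : 0 < m%:R :> R by rewrite ltr0n.
  set y : R := N%:R / m%:R.
  have lm : L - ln m%:R = ln y by rewrite /y ln_div ?posrE.
  have y1 : 1 <= y by rewrite ler_pdivlMr// mul1r ler_nat.
  have y0 : 0 < y by lra.
  have l0 : 0 <= ln y by rewrite ln_ge0.
  rewrite lm 2!normrM (ger0_norm (a0 m)) (ger0_norm l0).
  have ms : m%:R `^ s = N%:R `^ s / y `^ s.
    by rewrite -(mNs m m0) -/y mulfK// gt_eqF// powR_gt0.
  rewrite /alpha ms [leLHS](_ : _ = b m * `|g m| * N%:R `^ s * (ln y / y `^ s)); last by ring.
  rewrite ler_wpM2l//; first by rewrite !mulr_ge0.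
  rewrite ler_pdivrMr ?powR_gt0//; case: ifP => nm; first exact: ln_le_powR.
  have qy : q <= ln y by rewrite leNgt; apply/negP; rewrite -/(near m) nm.
  have h : ln y * ln y <= (s / 2)^-1 ^+ 2 * y `^ s.
    have -> : y `^ s = (y `^ (s / 2)) ^+ 2.
      by rewrite -powR_mulrn ?powR_ge0// -powRrM; congr (_ `^ _); field.
    rewrite -exprMn -expr2 lerXn2r ?nnegrE ?mulr_ge0 ?powR_ge0 ?(ltW is0)//.
    by apply: ln_le_powR => //; rewrite divr_gt0.
  apply: (@le_trans _ _ ((ln y * ln y) * eps)); last by rewrite [leRHS]mulrAC ler_wpM2r// ltW.
  rewrite -mulrA ler_peMr//; apply: (@le_trans _ _ (q * q^-1)); first by rewrite divff// gt_eqF//; lra.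
  by rewrite ler_pM ?invr_ge0//; lra.
(* Replacing the sum over p^v by its asymptotic value. *)
have D2 : `|\sum_(1 <= m < N.+1) alpha m * g m * (psim s b N m - beta / s * (N%:R / m%:R) `^ s)| <=
   N%:R `^ s * (K * (eps * S2) + (K + beta / s) * (4 * Kc * (eps * S2))).
  apply: split; [exact: ltW|by rewrite addr_ge0// ltW|].
  move=> m mN; have /andP[m0 _] := mN.
  have [h1 h2] := hK b N m rb mN.
  set y : R := N%:R / m%:R in h1 h2 *.
  have ms := mNs m m0; rewrite -/y in ms.
  rewrite 2!normrM (ger0_norm (a0 m)) /alpha -ms.
  rewrite [leLHS](_ : _ = b m * `|g m| * m%:R `^ s * `|psim s b N m - beta / s * y `^ s|); last by ring.
  have -> : b m * `|g m| * (m%:R `^ s * y `^ s) * (if near m then K + beta / s else K * eps) =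
    b m * `|g m| * m%:R `^ s * (y `^ s * (if near m then K + beta / s else K * eps)).
    by rewrite !mulrA.
  have c0 : 0 <= b m * `|g m| * m%:R `^ s by rewrite !mulr_ge0 ?powR_ge0.
  rewrite ler_wpM2l//; case: ifP => nm.
    apply: (le_trans (ler_normB _ _)); rewrite mulrDr lerD//.
      rewrite ger0_norm; first by rewrite mulrC.
      by apply: sumr_pred_ge0 => p _ _; apply: sumr_ge0 => v _; rewrite !mulr_ge0 ?powR_ge0 ?ln_nat_ge0.
    rewrite ger0_norm; first by rewrite mulrC.
    by apply: mulr_ge0; [exact: ltW|exact: powR_ge0].
  have qy : q <= ln y by rewrite leNgt; apply/negP; rewrite -/(near m) nm.
  apply: (le_trans (h2 _ qy)); first by rewrite -/L; lra.
  by rewrite -/L -/eps mulrCA.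
(* Replacing g (p^v m) by g m. *)
have D1 : `|\sum_(1 <= m < N.+1) alpha m * \sum_(1 <= p < N.+1 | prime p)
    \sum_(1 <= v < N.+1 | ~~ (p %| m)%N && (p ^ v * m <= N)%N)
      alpha (p ^ v)%N * ln (p ^ v)%:R * (g (p ^ v * m)%N - g m)| <= N%:R `^ s * (K * S1).
  apply: (le_trans (ler_norm_sum _ _ _)).
  rewrite /S1 !mulr_sumr [leLHS]big_nat [leRHS]big_nat; apply: ler_sum => m /andP[m0 mN].
  rewrite normrM (ger0_norm (a0 m)).
  apply: (@le_trans _ _ (alpha m * (psim s b N m * g1 m))).
    rewrite ler_wpM2l//; apply: (le_trans (ler_norm_sum _ _ _)).
    rewrite /psim mulr_suml; apply: ler_sum_pred => p pp _.
    apply: (le_trans (ler_norm_sum _ _ _)).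
    rewrite mulr_suml; apply: ler_sum_pred => v /andP[pm _] /andP[v0 _].
    have al : 0 <= alpha (p ^ v)%N * ln (p ^ v)%:R by rewrite mulr_ge0 ?ln_nat_ge0.
    by rewrite normrM (ger0_norm al) ler_wpM2l// (hg m p v m0 pp v0 pm).1.
  have mNN : (0 < m <= N)%N by rewrite m0.
  have [h1 _] := hK b N m rb mNN.
  rewrite -(mNs m m0) /alpha.
  rewrite [leLHS](_ : _ = b m * g1 m * m%:R `^ s * psim s b N m); last by ring.
  rewrite [leRHS](_ : _ = b m * g1 m * m%:R `^ s * (K * (N%:R / m%:R) `^ s)); last by ring.
  by rewrite ler_wpM2l// !mulr_ge0 ?powR_ge0.
have decomp : L * \sum_(1 <= n < N.+1) b n * n%:R `^ s * g n
    - beta / s * N%:R `^ s * \sum_(1 <= n < N.+1) b n * g n =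
  \sum_(1 <= m < N.+1) alpha m * \sum_(1 <= p < N.+1 | prime p)
    \sum_(1 <= v < N.+1 | ~~ (p %| m)%N && (p ^ v * m <= N)%N)
      alpha (p ^ v)%N * ln (p ^ v)%:R * (g (p ^ v * m)%N - g m) +
  \sum_(1 <= m < N.+1) alpha m * g m * (psim s b N m - beta / s * (N%:R / m%:R) `^ s) +
  \sum_(1 <= m < N.+1) alpha m * g m * (L - ln m%:R).
  have e0 := log_weight_sum g N alphaM.
  transitivity (\sum_(1 <= m < N.+1) alpha m * ln m%:R * g m +
    \sum_(1 <= m < N.+1) alpha m * g m * (L - ln m%:R) -
    \sum_(1 <= m < N.+1) beta / s * N%:R `^ s * (b m * g m)).
    rewrite mulr_sumr [X in _ - X = _]mulr_sumr; congr (_ - _).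
    by rewrite -big_split/=; apply: eq_bigr => m _; rewrite /alpha; ring.
  rewrite e0 addrAC; congr (_ + _).
  rewrite -sumrB -big_split/= big_nat [RHS]big_nat; apply: eq_bigr => m /andP[m0 _].
  rewrite mulrBr addrA -(mNs m m0).
  have -> : alpha m * (\sum_(1 <= p < N.+1 | prime p)
    \sum_(1 <= v < N.+1 | ~~ (p %| m)%N && (p ^ v * m <= N)%N)
      alpha (p ^ v)%N * ln (p ^ v)%:R * (g (p ^ v * m)%N - g m)) =
     alpha m * (\sum_(1 <= p < N.+1 | prime p)
    \sum_(1 <= v < N.+1 | ~~ (p %| m)%N && (p ^ v * m <= N)%N)
      alpha (p ^ v)%N * ln (p ^ v)%:R * g (p ^ v * m)%N) - alpha m * (psim s b N m * g m).
    rewrite -mulrBr; congr (_ * _); rewrite /psim mulr_suml -sumrB; apply: eq_bigr => p _.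
    rewrite mulr_suml -sumrB; apply: eq_bigr => v _; rewrite /alpha; ring.
  rewrite /alpha; ring.
rewrite decomp; apply: (le_trans (ler_normD _ _)).
apply: (le_trans (lerD (le_trans (ler_normD _ _) (lerD D1 D2)) D3)).
rewrite -/eps -subr_ge0.
rewrite [X in 0 <= X](_ : _ = N%:R `^ s * ((Kf + Kn * (4 * Kc)) * S1 + K * (eps * S2))); last first.
  by rewrite /Kf /Kn; move: ((s / 2)^-1) (s^-1) (beta / s) => *; ring.
by move: Kf Kf0 Kn Kn0 => kf kf0 kn kn0; nonneg.
Qed.

End LogReduction.

(** * The product model of the weighted integers *)

Definition primes_in k N := [seq p <- index_iota k.+1 N.+1 | prime p].

Lemma sum_primes_in (R : realType) k N (F : nat -> R) :
  \sum_(p <- primes_in k N) F p = \sum_(k.+1 <= p < N.+1 | prime p) F p.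
Proof. by rewrite /primes_in big_filter. Qed.

Lemma primes_in_cat k l N : (k <= l <= N)%N ->
  primes_in k N = primes_in k l ++ primes_in l N.
Proof.
move=> /andP[kl lN]; rewrite /primes_in -filter_cat; congr [seq p <- _ | _].
rewrite /index_iota (_ : N.+1 - k.+1 = (l.+1 - k.+1) + (N.+1 - l.+1))%N; last by lia.
by rewrite iotaD subnKC.
Qed.

Lemma mem_primes_in k N p : (p \in primes_in k N) = [&& prime p, (k < p)%N & (p <= N)%N].
Proof. by rewrite mem_filter mem_index_iota ltnS. Qed.

Lemma sorted_primes_in k N : sorted ltn (primes_in k N).
Proof. by apply: sorted_filter; [exact: ltn_trans|exact: iota_ltn_sorted]. Qed.

Lemma uniq_primes_in k N : uniq (primes_in k N).
Proof. by rewrite filter_uniq// iota_uniq. Qed.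

Lemma primes_in_split N ps1 p ps2 : primes_in 0 N = ps1 ++ p :: ps2 ->
  [/\ prime p, (p <= N)%N & ps2 = primes_in p N].
Proof.
move=> e; have pin : p \in primes_in 0 N by rewrite e mem_cat mem_head orbT.
have [pp p0 pN] : [/\ prime p, (0 < p)%N & (p <= N)%N].
  by move: pin; rewrite mem_primes_in => /and3P.
split=> //.
have e2 : primes_in 0 N = primes_in 0 p ++ primes_in p N by apply: primes_in_cat.
have so := sorted_primes_in 0 N; rewrite e in so.
rewrite (sorted_pairwise ltn_trans) pairwise_cat in so.
move: so => /and3P[/allrelP a12 _ /=/andP[/allP ap2 _]].
have f1 : [seq q <- ps1 ++ p :: ps2 | (p < q)%N] = ps2.
  rewrite filter_cat /= ltnn.
  rewrite (_ : [seq q <- ps1 | _] = [::]); last first.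
    apply/eqP; rewrite -[_ == _]negbK -has_filter; apply/hasPn => q qin.
    by rewrite -leqNgt ltnW//; apply: a12 => //; exact: mem_head.
  by rewrite cat0s; apply/all_filterP/allP => q /ap2.
have f2 : [seq q <- primes_in 0 p ++ primes_in p N | (p < q)%N] = primes_in p N.
  rewrite filter_cat (_ : [seq q <- primes_in 0 p | _] = [::]); last first.
    apply/eqP; rewrite -[_ == _]negbK -has_filter; apply/hasPn => q.
    by rewrite mem_primes_in => /and3P[_ _]; rewrite -leqNgt.
  by rewrite cat0s; apply/all_filterP/allP => q; rewrite mem_primes_in => /and3P[].
by rewrite -f1 -e e2 f2.
Qed.

Section IntegerModel.
Variable R : realType.
Variables (A beta eta C : R).
Hypotheses (A0 : 0 < A) (beta0 : 0 < beta) (eta0 : 0 < eta) (C0 : 0 < C).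
Notation regular := (regular_weight A beta eta C).

(** Euler factor, truncated at the exponent N, which exceeds all exponents occurring below N. *)
Definition factor_mass (b : nat -> R) N p := \sum_(v < N.+1) b (p ^ v)%N.
Definition model_wt (b : nat -> R) N p v := b (p ^ v)%N / factor_mass b N p.
(** The probability that p divides the random integer. *)
Definition model_q (b : nat -> R) N p := 1 - (factor_mass b N p)^-1.
Definition model_dev (b f : nat -> R) N p (v : nat) :=
  (if prime p then f p else 0) * ((0 < v)%N%:R - model_q b N p).
(** Expectation over the exponents; the second coordinate is the logarithm of the random integer. *)
Definition model (b f : nat -> R) N :=
  EE N (model_wt b N) (model_dev b f N) (fun p => ln p%:R : R).

Section Fixed.
Variables (b f : nat -> R) (N : nat).
Hypothesis rb : regular b.
Let b0 := rw_ge0 rb.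
Notation F := (factor_mass b N).
Notation wt := (model_wt b N).
Notation q := (model_q b N).
Notation dev := (model_dev b f N).
Notation Em := (model b f N).

Lemma factor_massE p : F p = 1 + \sum_(1 <= v < N.+1) b (p ^ v)%N.
Proof. by rewrite /factor_mass -(big_mkord xpredT (fun v => b (p ^ v)%N)) big_ltn//= expn0 (rw_one rb). Qed.

Lemma factor_mass_ge1 p : 1 <= F p.
Proof. by rewrite factor_massE lerDl sumr_ge0. Qed.

Lemma factor_mass_gt0 p : 0 < F p.
Proof. exact: lt_le_trans (factor_mass_ge1 p). Qed.

Lemma model_wt_ge0 p v : 0 <= wt p v.
Proof. by rewrite divr_ge0// ltW// factor_mass_gt0. Qed.

Lemma model_wt_sum p : \sum_(v < N.+1) wt p v = 1.
Proof. by rewrite /model_wt -mulr_suml divff// gt_eqF// factor_mass_gt0. Qed.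

Lemma model_wt0 p : wt p 0 = (F p)^-1.
Proof. by rewrite /model_wt expn0 (rw_one rb) mul1r. Qed.

Lemma model_wt_le p v : wt p v <= b (p ^ v)%N.
Proof.
rewrite ler_pdivrMr ?factor_mass_gt0// ler_peMr// factor_mass_ge1//.
Qed.

Lemma model_q_itv p : 0 <= q p <= 1.
Proof.
have F1 := factor_mass_ge1 p; have F0 := factor_mass_gt0 p.
by rewrite /model_q subr_ge0 invf_le1// F1/= gerBl invr_ge0 ltW.
Qed.

Lemma model_q_sum p : \sum_(v < N.+1) wt p v * (0 < v)%N%:R = q p.
Proof.
rewrite /model_q -model_wt0 -[1 in RHS](model_wt_sum p) !big_ord_recl /= mulr0 add0r.
rewrite addrAC subrr add0r; apply: eq_bigr => i _; exact: mulr1.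
Qed.

Hypothesis f1 : forall p, prime p -> `|f p| <= 1.

Lemma model_dev_le1 p v : `|dev p v| <= 1.
Proof.
have /andP[q0 q1] := model_q_itv p.
rewrite normrM -[leRHS]mulr1 ler_pM//.
  by case: ifP => [/f1//|_]; rewrite normr0.
by rewrite ler_norml; case: (0 < v)%N => /=; apply/andP; split; lra.
Qed.

Lemma model_dev_diff p v : `|dev p v - dev p 0| <= 1.
Proof.
rewrite /model_dev -mulrBr normrM -[leRHS]mulr1 ler_pM//.
  by case: ifP => [/f1//|_]; rewrite normr0.
move: (q p) => t; case: (0 < v)%N => /=.
  by rewrite (_ : _ - _ = 1) ?normr1//; ring.
by rewrite subrr normr0.
Qed.

Lemma model_dev_mean p : \sum_(v < N.+1) wt p v * dev p v = 0.
Proof.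
rewrite /model_dev; under eq_bigr do rewrite mulrCA mulrBr.
by rewrite -mulr_sumr sumrB model_q_sum -mulr_suml model_wt_sum mul1r subrr mulr0.
Qed.

Lemma model_lg_ge0 p : 0 <= ln p%:R :> R.
Proof. exact: ln_nat_ge0. Qed.

Lemma model_var1 p : prime p -> var1 N wt dev p = f p ^+ 2 * (q p * (1 - q p)).
Proof.
move=> pp; rewrite /var1 /model_dev pp.
have e (v : 'I_N.+1) : wt p v * (f p * ((0 < v)%N%:R - q p)) ^+ 2 =
   f p ^+ 2 * (wt p v * (0 < v)%N%:R * (1 - 2 * q p) + wt p v * q p ^+ 2).
  by case: (0 < v)%N => /=; ring.
under eq_bigr do rewrite e; rewrite -mulr_sumr big_split/= -[X in X + _]mulr_suml -[X in _ + X]mulr_suml.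
by rewrite model_q_sum (model_wt_sum p); ring.
Qed.

Hypothesis fa : strongly_additive f.

Definition supported_on (ps : seq nat) n := all (fun p => p \in ps) (primes n).
Definition mass (ps : seq nat) := \prod_(p <- ps) F p.
(** The mean of f at the random integer. *)
Definition centre (ps : seq nat) := \sum_(p <- ps) (if prime p then f p else 0) * q p.

Lemma mass_gt0 ps : 0 < mass ps.
Proof. by apply: prodr_gt0 => p _; exact: factor_mass_gt0. Qed.

Lemma f_one : f 1%N = 0.
Proof.
have [fM _] := fa; have := fM 1%N 1%N isT isT (coprimen1 1).
by rewrite mul1n; lra.
Qed.

Lemma f_pfactor p v m : prime p -> (0 < m)%N -> ~~ (p %| m)%N ->
  f (p ^ v * m)%N = (0 < v)%N%:R * f p + f m.
Proof.
move=> pp m0 pm; have [fM fp] := fa.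
have pv0 : (0 < p ^ v)%N by rewrite expn_gt0 prime_gt0.
rewrite fM//; last by rewrite coprimeXl// prime_coprime.
case: v pv0 => [|v] _; first by rewrite expn0 f_one ltnn mul0r.
by rewrite fp// ltn0Sn mul1r.
Qed.

Lemma supported_on_pfactor p ps v m : prime p -> p \notin ps -> (0 < m)%N ->
  ~~ (p %| m)%N -> supported_on (p :: ps) (p ^ v * m)%N = supported_on ps m.
Proof.
move=> pp pps m0 pm; have pv0 : (0 < p ^ v)%N by rewrite expn_gt0 prime_gt0.
apply/allP/allP => h r; rewrite mem_primes => /and3P[rp _ rm].
  have := h r; rewrite mem_primes rp muln_gt0 pv0 m0 dvdn_mull// => /(_ isT).
  rewrite in_cons => /orP[/eqP e|//].
  by rewrite -e rm in pm.
rewrite in_cons; case: eqVneq => //= rnp; apply: h.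
rewrite mem_primes rp m0/=; move: rm; rewrite Euclid_dvdM// => /orP[|//].
case: v pv0 => [|v] _; first by rewrite expn0 dvdn1 => /eqP r1; rewrite r1 in rp.
by rewrite Euclid_dvdX// dvdn_prime2// (negbTE rnp).
Qed.

Lemma supported_on_notin p ps m : prime p -> p \notin ps -> (0 < m)%N ->
  supported_on ps m -> ~~ (p %| m)%N.
Proof.
move=> pp pps m0 /allP h; apply/negP => pm.
by have := h p; rewrite mem_primes pp m0 pm (negbTE pps) => /(_ isT).
Qed.

(** The product over primes in ps of (sum over v of b (p^v)) expands into the sum of b n over the integers
    composed of these primes; the hypothesis on h removes the integers above N. *)
Lemma model_link ps (h : R -> R -> R) a c :
  (0 < N)%N -> all prime ps -> uniq ps -> 
  (forall x u, c + ln N%:R < u -> h x u = 0) ->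
  \sum_(1 <= n < N.+1 | supported_on ps n) b n * h (a + f n - centre ps) (c + ln n%:R) =
  mass ps * Em ps h a c.
Proof.
move=> N0; elim: ps a c => [|p ps IH] a c.
  move=> _ _ _; rewrite /mass /centre !big_nil mul1r /=.
  rewrite big_mkcond big_ltn//= big_nat big1 ?addr0.
    by rewrite (rw_one rb) mul1r f_one ln1 subr0 !addr0.
  move=> n /andP[n2 _]; case: ifP => // /allP sup.
  have := sup (pdiv n); rewrite mem_primes pdiv_prime// pdiv_dvd (ltnW n2) => /(_ isT).
  by [].
move=> /=/andP[pp pps] /andP[pnps ups] hsupp.
have F0 := factor_mass_gt0 p.
rewrite /mass big_cons -/(mass ps).
have -> : F p * mass ps * \sum_(v < N.+1) wt p v * Em ps h (a + dev p v) (c + v%:R * ln p%:R) =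
  \sum_(v < N.+1) b (p ^ v)%N * (mass ps * Em ps h (a + dev p v) (c + v%:R * ln p%:R)).
  rewrite mulr_sumr; apply: eq_bigr => v _; rewrite /model_wt; field.
  by rewrite gt_eqF.
have -> : \sum_(v < N.+1) b (p ^ v)%N * (mass ps * Em ps h (a + dev p v) (c + v%:R * ln p%:R)) =
  \sum_(0 <= v < N.+1) b (p ^ v)%N *
   \sum_(1 <= m < N.+1 | supported_on ps m) b m * h (a + dev p v + f m - centre ps) (c + v%:R * ln p%:R + ln m%:R).
  rewrite big_mkord; apply: eq_bigr => v _; rewrite IH// => x u hu.
  apply: hsupp; apply: le_lt_trans hu; rewrite lerD2r lerDl mulr_ge0// ln_nat_ge0//.
transitivity (\sum_(0 <= v < N.+1) \sum_(1 <= n < N.+1 | logn p n == v)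
   if supported_on (p :: ps) n then b n * h (a + f n - centre (p :: ps)) (c + ln n%:R) else 0).
  rewrite (exchange_big_dep xpredT)//= big_mkcond big_nat [RHS]big_nat.
  apply: eq_bigr => n /andP[n0 nN].
  rewrite (eq_bigl (pred1 (logn p n))); last by move=> v; rewrite /= eq_sym.
  rewrite -[RHS]big_filter filter_pred1_uniq ?iota_uniq ?big_seq1//.
  by rewrite mem_index_iota/= (leq_trans (ltn_logl p n0))// ltnW.
apply: eq_bigr => v _; rewrite (sum_by_valuation v N _ pp) mulr_sumr.
rewrite [LHS]big_mkcond [RHS]big_mkcond big_nat [RHS]big_nat; apply: eq_bigr => m /andP[m0 mN].
have mR : 0 < m%:R :> R by rewrite ltr0n.
have pv0 : (0 < p ^ v)%N by rewrite expn_gt0 prime_gt0.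
have pR : 0 < (p ^ v)%:R :> R by rewrite ltr0n.
have lnE : ln (p ^ v * m)%:R = v%:R * ln p%:R + ln m%:R :> R.
  by rewrite natrM lnM ?posrE// ln_pfactor// prime_gt0.
have [pm|pm] := boolP (p %| m)%N.
  by rewrite /=; case: ifP => // /(supported_on_notin pp pnps m0); rewrite pm.
rewrite supported_on_pfactor//=; case: (boolP (supported_on ps m)) => sm; last by case: ifP.
have hE : h (a + f (p ^ v * m)%N - centre (p :: ps)) (c + ln (p ^ v * m)%:R) =
   h (a + dev p v + f m - centre ps) (c + v%:R * ln p%:R + ln m%:R).
  congr h; last by rewrite lnE addrA.
  rewrite f_pfactor// /centre big_cons /model_dev pp; ring.
case: ifP => [pvm|pvm].
  rewrite hE (rw_mul rb)//; first by rewrite mulrA.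
  by rewrite coprimeXl// prime_coprime.
rewrite -hE hsupp ?mulr0// ltrD2l ltr_ln ?posrE ?ltr0n ?muln_gt0 ?pv0//.
by rewrite ltr_nat ltnNge pvm.
Qed.

End Fixed.
End IntegerModel.

(** * The size of the random integer *)

Section SizeOfModel.
Variable R : realType.
Variables (A beta eta C : R).
Hypotheses (A0 : 0 < A) (beta0 : 0 < beta) (eta0 : 0 < eta) (C0 : 0 < C).
Notation regular := (regular_weight A beta eta C).

Lemma ler_powR_div (x y L g : R) : 0 <= g -> 0 < L -> 0 <= x -> x <= y ->
  (x / L) `^ g <= (y / L) `^ g.
Proof.
move=> g0 L0 x0 xy; have y0 := le_trans x0 xy.
apply: ge0_ler_powR => //; rewrite ?nnegrE; try by apply: divr_ge0 => //; exact: ltW.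
by rewrite ler_pM2r ?invr_gt0.
Qed.

Lemma prime_sum_tail_le (k N : nat) (F : nat -> R) : (forall p, prime p -> 0 <= F p) ->
  \sum_(k.+1 <= p < N.+1 | prime p) F p <= \sum_(1 <= p < N.+1 | prime p) F p.
Proof.
move=> F0; have [kN|Nk] := leqP k.+1 N.+1.
  by rewrite [leRHS](big_cat_nat _ (n := k.+1))//= lerDr sumr_ge0.
by rewrite big_geq ?(ltnW Nk)// sumr_ge0.
Qed.

Section Fixed.
Variables (b f : nat -> R) (N : nat).
Hypothesis rb : regular b.
Let b0 := rw_ge0 rb.
Notation F := (factor_mass b N).
Notation Em := (model b f N).

Lemma model_cst ps (k a c : R) : Em ps (fun _ _ => k) a c = k.
Proof. by apply: EE_cst; exact: model_wt_sum rb. Qed.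

Lemma model_le_supp ps (g g' : R -> R -> R) (a c : R) :
  (forall x y, c <= y -> g x y <= g' x y) -> Em ps g a c <= Em ps g' a c.
Proof.
by apply: EE_le_supp; [exact: model_wt_ge0 rb|exact: model_lg_ge0].
Qed.

Lemma model_le ps (g g' : R -> R -> R) (a c : R) :
  (forall x y, g x y <= g' x y) -> Em ps g a c <= Em ps g' a c.
Proof. by move=> h; apply: model_le_supp => x y _; exact: h. Qed.

Lemma model_ge0 ps (g : R -> R -> R) (a c : R) :
  (forall x y, 0 <= g x y) -> 0 <= Em ps g a c.
Proof. by move=> h; rewrite -(model_cst ps 0 a c); exact: model_le. Qed.

Lemma model_norm ps (g : R -> R -> R) (a c : R) :
  `|Em ps g a c| <= Em ps (fun x y => `|g x y|) a c.
Proof. by apply: EE_norm; [exact: model_wt_ge0 rb|exact: model_lg_ge0]. Qed.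

(** From 1 + x >= exp(x - x^2) for x >= 0, via (1 - x + x^2)(1 + x) = 1 + x^3 >= 1. *)
Lemma factor_mass_lower p : (0 < N)%N -> expR (b p - b p ^+ 2) <= F p.
Proof.
move=> N0; set x := b p; have x0 : 0 <= x by exact: b0.
apply: (@le_trans _ _ (1 + x)); last first.
  rewrite (factor_massE N rb) lerD2l (big_ltn (_ : 1 < N.+1)%N)// expn1 lerDl.
  exact: sumr_ge0.
have e0 := expR_gt0 (x - x ^+ 2).
have : 1 - (x - x ^+ 2) <= (expR (x - x ^+ 2))^-1 by rewrite -expRN; exact: expR_ge1Dx.
rewrite -(ler_pM2l e0) mulfV ?gt_eqF// => h.
have x3 : 0 <= x ^+ 3 by apply: exprn_ge0.
have : expR (x - x ^+ 2) * (1 + x ^+ 3) <= 1 + x.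
  rewrite (_ : 1 + x ^+ 3 = (1 - (x - x ^+ 2)) * (1 + x)); last by ring.
  by rewrite mulrA -[leRHS]mul1r ler_wpM2r// addr_ge0.
by apply: le_trans; rewrite ler_peMr ?lerDl// ltW.
Qed.

Lemma factor_mass_upper p :
  F p <= expR (b p + \sum_(2 <= v < N.+1) b (p ^ v)%N).
Proof.
apply: le_trans (expR_ge1Dx _); rewrite (factor_massE N rb) lerD2l.
case: N => [|n]; first by rewrite big_geq// addr_ge0// sumr_ge0.
by rewrite big_ltn// expn1.
Qed.

Lemma mass_lower k : (0 < N)%N ->
  expR (\sum_(k.+1 <= p < N.+1 | prime p) b p - C) <= mass b N (primes_in k N).
Proof.
move=> N0; apply: (@le_trans _ _ (expR (\sum_(k.+1 <= p < N.+1 | prime p) (b p - b p ^+ 2)))).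
  rewrite ler_expR sumrB lerD2l lerN2.
  apply: le_trans (prime_sum_tail_le k N _) (rw_sq rb N) => p _; exact: sqr_ge0.
rewrite /mass -sum_primes_in expR_sum; apply: ler_prod => p _.
by rewrite expR_ge0/= factor_mass_lower.
Qed.

Lemma mass_upper k :
  mass b N (primes_in k N) <= expR (\sum_(k.+1 <= p < N.+1 | prime p) b p + C).
Proof.
apply: (@le_trans _ _ (expR (\sum_(k.+1 <= p < N.+1 | prime p)
    (b p + \sum_(2 <= v < N.+1) b (p ^ v)%N)))).
  rewrite /mass -sum_primes_in expR_sum; apply: ler_prod => p _.
  by rewrite (ltW (factor_mass_gt0 N rb p)) factor_mass_upper.
rewrite ler_expR big_split/= lerD2l.
apply: le_trans (prime_sum_tail_le k N _) (prime_power_tail eta0 N N.+1 rb) => p _.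
exact: sumr_ge0.
Qed.

(** If every prime exceeds exp(y), the random integer is at most exp(y) only when it is 1. *)
Lemma model_below_le ps (y a c : R) : 0 <= c -> all (fun p => y < ln (p%:R : R)) ps ->
  Em ps (fun _ (u : R) => (u <= y)%R%:R) a c <= (mass b N ps)^-1.
Proof.
move=> c0; rewrite /mass; elim: ps a => [|p ps IH] a; first by move=> _; rewrite big_nil invr1/= lern1 leq_b1.
move=> /=/andP[yp yps]; rewrite big_cons invfM big_ord_recl /= mul0r addr0.
rewrite big1 ?addr0; last first.
  move=> v _; rewrite /bump /=; apply/eqP; rewrite mulf_eq0; apply/orP; right.
  rewrite eq_le; apply/andP; split; last by apply: model_ge0 => *; exact: ler0n.
  rewrite -[leRHS](model_cst ps 0 (a + model_dev b f N p (1 + v)) (c + (1 + v)%:R * ln p%:R)).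
  apply: model_le_supp => x u hu; rewrite [u <= y]leNgt (lt_le_trans yp)//.
  apply: le_trans hu; have := model_lg_ge0 R p; set l := ln _ => l0.
  have : 0 <= v%:R * l by rewrite mulr_ge0.
  by rewrite natrD mulrDl mul1r; lra.
by rewrite (model_wt0 N rb) ler_wpM2l ?IH// invr_ge0 ltW// (factor_mass_gt0 N rb).
Qed.

Lemma model_below_le_cat k l (y a c : R) : 0 <= c -> (k <= l <= N)%N -> y < ln (l.+1%:R : R) ->
  Em (primes_in k N) (fun _ (u : R) => (u <= y)%R%:R) a c <= (mass b N (primes_in l N))^-1.
Proof.
move=> c0 klN yl; rewrite (primes_in_cat klN) /model EE_cat.
rewrite -[leRHS](model_cst (primes_in k l) _ a c).
apply: model_le_supp => x u cu; apply: model_below_le; first exact: le_trans cu.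
apply/allP => p; rewrite mem_primes_in => /and3P[pp lp _].
have p0 := prime_gt0 pp; by apply: lt_le_trans yl _; rewrite ler_ln ?posrE ?ltr0n// (ler_nat R).
Qed.

Lemma model_below_ge ps (y a c : R) :
  (mass b N ps)^-1 * (c <= y)%R%:R <= Em ps (fun _ (u : R) => (u <= y)%R%:R) a c.
Proof.
rewrite /mass; elim: ps a => [|p ps IH] a; first by rewrite big_nil invr1 mul1r.
rewrite big_cons invfM /= big_ord_recl /= mul0r addr0 -[leLHS]addr0 lerD//.
  by rewrite (model_wt0 N rb) -mulrA ler_wpM2l ?IH// invr_ge0 ltW// (factor_mass_gt0 N rb).
apply: sumr_ge0 => v _; rewrite mulr_ge0 ?(model_wt_ge0 N rb)//.
by apply: model_ge0 => *; exact: ler0n.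
Qed.

Lemma model_mean_size ps (a c : R) :
  Em ps (fun _ (u : R) => u) a c = c + \sum_(p <- ps) \sum_(v < N.+1) model_wt b N p v * (v%:R * ln p%:R).
Proof.
elim: ps a c => [|p ps IH] a c; first by rewrite big_nil addr0.
rewrite big_cons /=; under eq_bigr do rewrite IH -addrA mulrDr mulrDr.
rewrite big_split/= big_split/= -mulr_suml (model_wt_sum N rb) mul1r -mulr_suml (model_wt_sum N rb) mul1r.
by [].
Qed.

End Fixed.

(** The primes between max(p, exp y) and N must all be absent; their Euler product is at least a power of
    L / (ln p + y), by [mertens_lower]. *)
Lemma model_below_decay : exists g K : R, [/\ 0 < g <= 1, 0 < K &
  forall (b f : nat -> R) (N p : nat) (y a c : R), regular b ->
    (2 <= N)%N -> (p <= N)%N -> 0 <= c -> 0 <= y <= ln N%:R ->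
    model b f N (primes_in p N) (fun _ (u : R) => (u <= y)%R%:R) a c <=
      K * ((1 + ln p%:R + y) / ln N%:R) `^ g].
Proof.
have [g [K [g01 K0 HK]]] := @mertens_lower R A beta eta C A0 beta0 C0.
exists g, (expR (K + C)); split => //; first exact: expR_gt0.
move=> b f N p y a c rb N2 pN c0 /andP[y0 yL]; have N0 : (0 < N)%N by exact: ltnW.
have [g0 _] := andP g01.
set k := Num.truncn (expR y); pose l := maxn 2 (maxn p k).
have NR : 0 < N%:R :> R by rewrite ltr0n.
have kE : k%:R <= expR y by rewrite truncn_le expR_ge0.
have kN : (k <= N)%N.
  rewrite -(ler_nat R) (le_trans kE)//.
  by rewrite -(@lnK _ (N%:R : R)) ?posrE// ler_expR.
have l2 : (2 <= l)%N by exact: leq_maxl.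
have lN : (l <= N)%N by rewrite /l !geq_max N2 pN.
have pl : (p <= l)%N by rewrite /l !leq_max leqnn ?orbT.
have kl : (k <= l)%N by rewrite /l !leq_max leqnn ?orbT.
have yl : y < ln (l.+1%:R : R).
  rewrite -ltr_expR lnK ?posrE ?ltr0n//; apply: (@lt_le_trans _ _ k.+1%:R); last by rewrite ler_nat.
  by rewrite truncnS_gt ?num_real.
apply: le_trans (model_below_le_cat f rb a c0 _ yl) _; first by rewrite pl lN.
have lnl : 0 < ln (l%:R : R) by rewrite ln_gt0// ltr1n.
have L0 : 0 < ln (N%:R : R) by rewrite ln_gt0// ltr1n.
have lle : ln (l%:R : R) <= 1 + ln p%:R + y.
  have p0 : 0 <= ln (p%:R : R) by exact: ln_nat_ge0.
  have ln21 : ln (2%:R : R) <= 1 by rewrite -[leRHS]expRK ler_ln ?posrE ?expR_gt0//; exact: expR_ge1Dx.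
  rewrite /l /maxn; case: ifP => _; last by lra.
  case: ifP => _; last by lra.
  have [->|k0] := posnP k; first by rewrite ln0//; lra.
  have : ln (k%:R : R) <= y; last by lra.
  by rewrite -[leRHS]expRK ler_ln ?posrE ?expR_gt0 ?ltr0n.
have l2N : (1 < l <= N)%N by rewrite l2.
have ml := mass_lower rb l N0; have HKl := HK b l N rb l2N.
have m0 : 0 < mass b N (primes_in l N) := mass_gt0 N rb _.
apply: (@le_trans _ _ (expR (K + C) * (ln l%:R / ln N%:R) `^ g)); last first.
  by rewrite ler_wpM2l ?expR_ge0// ler_powR_div// ltW.
rewrite invf_ple ?posrE//; last by rewrite mulr_gt0 ?expR_gt0 ?powR_gt0 ?divr_gt0.
apply: le_trans ml; rewrite /powR gt_eqF ?divr_gt0// -expRD -expRN ler_expR.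
by rewrite ln_div ?posrE//; lra.
Qed.

Lemma supported_on_factor ps m n : (0 < m * n)%N ->
  supported_on ps (m * n)%N -> supported_on ps n.
Proof.
move=> mn /allP h; apply/allP => p pn; apply: h; move: pn.
by rewrite !mem_primes mn => /and3P[-> _ /(dvdn_mull m) ->].
Qed.

(** In the window (exp(y - h), exp y] the logarithm ln n is about y, unless y = O(h).  Multiplying by it and
    expanding over prime powers ([log_trick_upper]) trades the window for the factor (1 + h)/y and leaves the event
    that the integer is at most exp y, for which [model_below_decay] holds. *)
Lemma model_anticoncentration : exists g K : R, [/\ 0 < g <= 1, 0 < K &
  forall (b f : nat -> R) (N p : nat) (y h a : R), regular b -> strongly_additive f ->
    (2 <= N)%N -> (p <= N)%N -> 0 <= h -> y <= ln N%:R ->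
    model b f N (primes_in p N) (fun _ (u : R) => ((y - h < u) && (u <= y))%R%:R) a 0 <=
      K * ((1 + h + ln p%:R) / ln N%:R) `^ g].
Proof.
have [g [K [g01 K0 HK]]] := model_below_decay.
have [g0 g1] := andP g01.
set ic := power_interval_const A beta eta C.
have ic0 : 0 < ic by exact: power_interval_const_gt0.
exists g, ((3 + 4 * ic) * K); split => //; first by rewrite mulr_gt0// addr_gt0// mulr_gt0.
move=> b f N p y h a rb fa N2 pN h0 yL; have N0 : (0 < N)%N by exact: ltnW.
have L0 : 0 < ln (N%:R : R) by rewrite ln_gt0// ltr1n.
have p0 : 0 <= ln (p%:R : R) by exact: ln_nat_ge0.
set t := 1 + h + ln p%:R; have t1 : 1 <= t by rewrite /t; lra.
have tg0 : 0 <= (t / ln N%:R) `^ g by exact: powR_ge0.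
have [y0|y0] := ltP y 0.
  apply: (@le_trans _ _ 0); last by apply: mulr_ge0 => //; nonneg; lra.
  rewrite -[leRHS](model_cst f N rb (primes_in p N) 0 a 0).
  apply: (model_le_supp f N rb) => x u u0; rewrite [u <= y]leNgt (lt_le_trans y0)// andbF//.
set ps := primes_in p N.
have below : model b f N ps (fun _ (u : R) => (u <= y)%R%:R) a 0 <= K * ((t + y) / ln N%:R) `^ g.
  apply: le_trans (HK b f N p y a 0 rb N2 pN (lexx _) _) _; first by rewrite y0 yL.
  rewrite ler_wpM2l//; first exact: ltW.
  by apply: ler_powR_div => //; rewrite ?/t; lra.
have [yt|ty] := leP y (2 * t).
  apply: (@le_trans _ _ (model b f N ps (fun _ (u : R) => (u <= y)%R%:R) a 0)).
    by apply: (model_le f N rb) => x u; rewrite ler_nat; case: (_ < u); case: (u <= y).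
  apply: le_trans below _.
  rewrite -[leRHS]mulrA [leRHS]mulrCA ler_pM2l//.
  apply: (@le_trans _ _ ((3 * (t / ln N%:R)) `^ g)).
    by rewrite mulrA; apply: ler_powR_div => //; lra.
  rewrite powRM//; last by rewrite divr_ge0//; [lra|exact: ltW].
  rewrite ler_wpM2r//.
  apply: (@le_trans _ _ 3); last by rewrite lerDl mulr_ge0// ltW.
  by rewrite -[leRHS]powRr1// ler_powR//; lra.
set Q := model b f N ps _ a 0.
have mass0 : 0 < mass b N ps := mass_gt0 N rb _.
have apr : all prime ps by apply/allP => q; rewrite mem_primes_in => /and3P[].
have ups : uniq ps := uniq_primes_in p N.
pose G n : R := (supported_on ps n)%:R.
have EY : 0 < expR y := expR_gt0 y.
have lnLE n : (0 < n)%N -> (n%:R <= expR y) = (ln (n%:R : R) <= y).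
  by move=> n0; rewrite -[y in RHS]expRK ler_ln ?posrE ?ltr0n.
have lnGE n : (0 < n)%N -> (expR y / expR h < n%:R) = (y - h < ln (n%:R : R)).
  by move=> n0; rewrite -expRB -[(n%:R : R) in LHS]lnK ?posrE ?ltr0n// ltr_expR.
have link1 : mass b N ps * Q =
  \sum_(1 <= n < N.+1 | (expR y / expR h < n%:R) && (n%:R <= expR y)) b n * G n.
  rewrite /Q -(model_link rb fa)//; last first.
    move=> x u; rewrite add0r => Lu; rewrite [u <= y]leNgt (le_lt_trans yL Lu) andbF//.
  rewrite [LHS]big_mkcond [RHS]big_mkcond big_nat [RHS]big_nat; apply: eq_bigr => n /andP[n0 nN].
  rewrite lnLE// lnGE// add0r /G.
  by case: (supported_on ps n); case: (_ < _); case: (_ <= _); rewrite /= ?mulr0.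
have link2 : mass b N ps * model b f N ps (fun _ (u : R) => (u <= y)%R%:R) a 0 =
  \sum_(1 <= n < N.+1 | n%:R <= expR y) b n * G n.
  rewrite -(model_link rb fa)//; last by move=> x u; rewrite add0r => Lu; rewrite [u <= y]leNgt (le_lt_trans yL Lu).
  rewrite [LHS]big_mkcond [RHS]big_mkcond big_nat [RHS]big_nat; apply: eq_bigr => n /andP[n0 nN].
  rewrite lnLE// add0r /G.
  by case: (supported_on ps n); case: (_ <= _); rewrite /= ?mulr0.
have step : y / 2 * (mass b N ps * Q) <= ic * (1 + h) * (mass b N ps * (K * ((t + y) / ln N%:R) `^ g)).
  apply: (@le_trans _ _ (ic * (1 + h) * (mass b N ps * model b f N ps (fun _ (u : R) => (u <= y)%R%:R) a 0))); last first.
    apply: ler_wpM2l; first by apply: mulr_ge0; [exact: ltW|lra].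
    by apply: ler_wpM2l => //; exact: ltW.
  rewrite link1 link2; have := @log_trick_upper R A beta eta C A0 beta0 eta0 C0 b G G (expR y) (expR h) N rb EY.
  rewrite expRK => lt; apply: le_trans (lt _ _ _ _).
  - rewrite mulr_sumr; apply: ler_sum_pred => n /andP[yn _] /andP[n0 _].
    rewrite -[leRHS]mulrA [leRHS]mulrCA; apply: ler_wpM2r.
      by apply: mulr_ge0 => //; exact: rw_ge0 rb _.
    move: yn; rewrite lnGE//.
    by rewrite /t in ty; lra.
  - by rewrite -(expR0 R) ler_expR.
  - by move=> n; exact: ler0n.
  - by move=> n; exact: ler0n.
  move=> m q v m0 qp v0 qm; rewrite /G ler_nat.
  have pos : (0 < q ^ v * m)%N by rewrite muln_gt0 expn_gt0 prime_gt0.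
  by case: (boolP (supported_on ps (q ^ v * m))) => // /(supported_on_factor pos) ->.
have {}step : y / 2 * Q <= ic * t * (K * ((t + y) / ln N%:R) `^ g).
  rewrite -(ler_pM2l mass0) mulrCA; apply: le_trans step _.
  rewrite [leRHS]mulrCA; apply: ler_wpM2r; first by nonneg.
  by rewrite ler_pM2l// /t; lra.
have tp : 0 < t := lt_le_trans ltr01 t1.
have y1 : 0 < y by clear -ty tp A0 beta0 eta0 C0; lra.
have big : ((t + y) / ln N%:R) `^ g <= 2 * (y / t) * (t / ln N%:R) `^ g.
  apply: (@le_trans _ _ ((2 * (y / t)) `^ g * (t / ln N%:R) `^ g)).
    rewrite -powRM; [|by rewrite mulr_ge0// divr_ge0// ltW|by rewrite divr_ge0// ltW].
    have -> : 2 * (y / t) * (t / ln N%:R) = (2 * y) / ln N%:R by field; rewrite !gt_eqF.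
    by apply: ler_powR_div => //; lra.
  rewrite ler_wpM2r// -[leRHS]powRr1; last by rewrite mulr_ge0// divr_ge0// ltW.
  apply: ler_powR => //.
  have : 1 <= y / t by rewrite ler_pdivlMr// mul1r; clear -ty tp A0 beta0 eta0 C0; lra.
  by clear -A0 beta0 eta0 C0; lra.
have y2 : 0 < y / 2 by rewrite divr_gt0.
rewrite -(ler_pM2l y2); apply: le_trans step _.
apply: (@le_trans _ _ (ic * t * (K * (2 * (y / t) * (t / ln N%:R) `^ g)))).
  rewrite ler_wpM2l//; first by rewrite mulr_ge0// ltW.
  by rewrite ler_pM2l.
move: (_ `^ g) tg0 => Z Z0.
have -> : ic * t * (K * (2 * (y / t) * Z)) = (y / 2) * (4 * ic * K * Z) by field; rewrite gt_eqF.
rewrite ler_pM2l// ler_wpM2r// ler_pM2r//; clear -ic0 A0 beta0 eta0 C0; lra.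
Qed.

End SizeOfModel.

(** * Conditioning on the size of the random integer *)

Section ModelProbabilities.
Variable R : realType.
Variables (A beta eta C : R).
Hypotheses (A0 : 0 < A) (beta0 : 0 < beta) (eta0 : 0 < eta) (C0 : 0 < C).
Notation regular := (regular_weight A beta eta C).

(** Absence of the prime changes nothing, hence the value 0 at v = 0. *)
Definition below_rate (g K : R) N (p v : nat) : R :=
  if v is 0 then 0 else K * ((1 + v.+1%:R * ln p%:R) / ln N%:R) `^ g.

(** Adjoining p^v shifts the threshold for the remaining primes by v ln p, so the change is the mass of a window. *)
Lemma model_smoothing : exists g K : R, [/\ 0 < g <= 1, 0 < K &
  forall (b f : nat -> R) (N : nat), regular b -> strongly_additive f -> (2 <= N)%N ->
    smoothing N (model_wt b N) (model_dev b f N) (fun p => ln p%:R : R)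
      (below_rate g K N) (fun u => (u <= ln (N%:R : R))%R%:R) (primes_in 0 N)].
Proof.
have [g [K [g01 K0 HK]]] := model_anticoncentration A0 beta0 eta0 C0.
exists g, K; split => // b f N rb fa N2 ps1 p ps2 /primes_in_split[pp pN ->] v a c c0.
have [g0 g1] := andP g01.
set l := ln (p%:R : R); have l0 : 0 <= l := model_lg_ge0 R p.
case: v => [[|v] vN] /=; first by rewrite mul0r addr0 subrr normr0.
set h := v.+1%:R * l; have h0 : 0 <= h by apply: mulr_ge0.
rewrite -{1 2}[a]addr0 -[c + h]add0r -{2}[c]add0r !EE_shift -EEB.
apply: le_trans (model_norm f N rb _ _ _ _) _.
apply: le_trans (_ : model b f N (primes_in p N)
  (fun _ (u : R) => ((ln N%:R - c - h < u) && (u <= ln N%:R - c))%R%:R) a 0 <= _).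
  apply: (model_le f N rb) => x u.
  rewrite [_ < u]ltNge; set L := ln (N%:R : R).
  have -> : (u <= L - c - h) = (u + (c + h) <= L) by apply/idP/idP; lra.
  have -> : (u <= L - c) = (u + c <= L) by apply/idP/idP; lra.
  have : u + (c + h) <= L -> u + c <= L by lra.
  case: (u + (c + h) <= L) => [-> //|_]; first by rewrite subrr normr0.
  by rewrite sub0r normrN; case: (u + c <= L); rewrite /= ?normr1 ?normr0.
apply: le_trans (HK b f N p _ h a rb fa N2 pN h0 _) _; first by rewrite gerBl.
rewrite ler_wpM2l//; first exact: ltW.
have L0 : 0 < ln (N%:R : R) by rewrite ln_gt0// ltr1n.
apply: ler_powR_div; [exact: ltW|done|by rewrite -/l; lra|].
by rewrite -[v.+2%:R]natr1 mulrDl mul1r -/h -/l; lra.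
Qed.

(** The first powers contribute the sum of b p (ln p / L)^g = O(1), by [prime_log_power]; for higher powers
    x^g <= x reduces to the convergent sums over proper prime powers. *)
Lemma rho_below_rate (g K : R) : 0 < g <= 1 -> 0 < K -> exists2 D : R, 0 < D &
  forall (b : nat -> R) (N : nat), regular b -> 1 <= ln (N%:R : R) ->
    rho N (model_wt b N) (below_rate g K N) (primes_in 0 N) <= D.
Proof.
move=> g01 K0; have [g0 g1] := andP g01.
have [K1 K10 HK1] := prime_log_power eta A0 beta0 C0 g01.
exists (2 * (K * (4 * K1 + (C + 2 * (eta^-1 * C))))).
  by apply: mulr_gt0 => //; apply: mulr_gt0 => //; apply: addr_gt0;
    [exact: mulr_gt0|apply: addr_gt0 => //; apply: mulr_gt0 => //; apply: mulr_gt0; rewrite ?invr_gt0].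
move=> b N rb L1; have b0 := rw_ge0 rb.
have L0 : 0 < ln (N%:R : R) by lra.
have N0 : (0 < N)%N by case: N L1 L0 => // ; rewrite ln0//; lra.
set L := ln (N%:R : R) in L1 L0 *.
have Lg : 0 < L `^ g by exact: powR_gt0.
rewrite /rho sum_primes_in -mulr_sumr ler_pM2l//.
apply: (@le_trans _ _ (\sum_(1 <= p < N.+1 | prime p)
  (K * (4 * (b p * ln p%:R `^ g / L `^ g)) + K * (\sum_(2 <= v < N.+1) b (p ^ v)%N +
    2 * \sum_(2 <= v < N.+1) b (p ^ v)%N * ln (p ^ v)%:R)))).
  apply: ler_sum_pred => p pp /andP[p0 pN].
  have l2 : 2^-1 <= ln (p%:R : R) := ln_prime_ge _ pp.
  rewrite -(big_mkord xpredT (fun v => model_wt b N p v * below_rate g K N p v)).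
  rewrite big_ltn//= mulr0 add0r big_ltn ?ltnS//; apply: lerD.
    apply: (@le_trans _ _ (b p * (K * ((4 * ln p%:R) / L) `^ g))).
      apply: ler_pM; [exact: model_wt_ge0 rb _ _|by nonneg| | ].
        by have := model_wt_le N rb p 1; rewrite expn1.
      by rewrite ler_pM2l//; apply: ler_powR_div => //; [exact: ltW|lra|lra].
    have pL : 0 <= ln (p%:R : R) / L by apply: divr_ge0; [lra|exact: ltW].
    have divE : (ln (p%:R : R) / L) `^ g = ln p%:R `^ g / L `^ g.
      apply: (mulIf (lt0r_neq0 Lg)); rewrite divfK ?gt_eqF// -powRM ?(ltW L0)//.
      by rewrite divfK// gt_eqF.
    have four : 4 `^ g <= 4 :> R by rewrite -[leRHS]powRr1//; apply: ler_powR => //; lra.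
    rewrite -[4 * _ / L]mulrA powRM// divE; set z := ln _ `^ g / _.
    have z0 : 0 <= b p * z by apply: mulr_ge0 => //; rewrite /z; nonneg.
    rewrite mulrCA ler_pM2l// [b p * (_ * _)]mulrCA -[b p * _ / _]mulrA.
    exact: ler_wpM2r.
  rewrite [2 * _]mulr_sumr -big_split/= mulr_sumr big_nat_cond [leRHS]big_nat_cond.
  apply: ler_sum => v /andP[/andP[v2 vN] _].
  case: v v2 vN => [//|v] v2 vN /=.
  set w := v.+1; rewrite ln_pfactor ?prime_gt0//.
  have vl : 0 <= w%:R * ln (p%:R : R) by rewrite mulr_ge0//; lra.
  have vl2 : ln (p%:R : R) <= w%:R * ln (p%:R : R) by rewrite ler_peMl ?ler1n//; lra.
  apply: (@le_trans _ _ (b (p ^ w)%N * (K * (1 + 2 * (w%:R * ln p%:R))))); last first.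
    by have := b0 (p ^ w)%N; lra.
  apply: ler_pM; [exact: model_wt_ge0 rb _ _|by nonneg|exact: model_wt_le rb _ _|].
  have wS : w.+1%:R * ln (p%:R : R) = w%:R * ln p%:R + ln p%:R by rewrite -natr1 mulrDl mul1r.
  rewrite ler_pM2l// wS -/L; set z := (X in X / L); have z1 : 1 <= z by rewrite /z; lra.
  apply: (@le_trans _ _ (z `^ g)).
    have z0 : 0 <= z by lra.
    apply: ge0_ler_powR; rewrite ?nnegrE ?(ltW g0)//.
      by apply: divr_ge0 => //; exact: ltW L0.
    by rewrite ler_pdivrMr// ler_peMr.
  apply: (@le_trans _ _ z); last by rewrite /z; lra.
  by rewrite -[leRHS]powRr1; [apply: ler_powR|lra].
rewrite big_split/= -!mulr_sumr -mulrDr ler_pM2l//; apply: lerD.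
  rewrite ler_pM2l// -mulr_suml ler_pdivrMr//; exact: HK1.
rewrite big_split/= -mulr_sumr; apply: lerD; first exact: (prime_power_tail eta0 N N.+1 rb).
by rewrite ler_pM2l//; exact: (prime_power_tail_log eta0 N N.+1 rb).
Qed.

(** Split the primes at j = N^(1/k).  The part of the logarithm from primes up to j has mean at most L/2
    for k large, and the primes in (j, N] are all absent with probability bounded below. *)
Lemma model_below_lower : exists c L1 : R, 0 < c /\
  forall (b f : nat -> R) (N : nat) (a : R), regular b -> L1 <= ln (N%:R : R) ->
    c <= model b f N (primes_in 0 N) (fun _ (u : R) => (u <= ln (N%:R : R))%R%:R) a 0.
Proof.
set ic := interval_const A beta C.
have ic0 : 0 < ic by exact: interval_const_gt0.
pose k := 4 * ic + 2; have k2 : 2 <= k by rewrite /k; lra.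
have Ce : 0 < eta^-1 * C by rewrite mulr_gt0 ?invr_gt0.
exists (expR (- (4 * k * ic + C)) / 2), (2 * k + 4 * (ic + eta^-1 * C) + 1); split.
  by rewrite divr_gt0 ?expR_gt0.
move=> b f N a rb; have b0 := rw_ge0 rb; set L := ln (N%:R : R) => LL.
have L1 : 1 <= L by lra.
have N0 : (0 < N)%N by case: N @L LL L1 => // L; rewrite /L ln0//; lra.
have NR : 0 < N%:R :> R by rewrite ltr0n.
have EN : expR L = N%:R by rewrite /L lnK ?posrE.
set j := Num.truncn (expR (L / k)).
have Lk2 : 2 <= L / k by rewrite ler_pdivlMr; lra.
have jE : j%:R <= expR (L / k) by rewrite truncn_le expR_ge0.
have jE2 : expR (L / k) < j.+1%:R by rewrite truncnS_gt ?num_real.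
have e3 : 3 <= expR (L / k).
  by apply: le_trans (expR_ge1Dx _); lra.
have j2R : 2 < j.+1%:R :> R by lra.
have j0 : (0 < j)%N by move: j2R; rewrite (ltr_nat R) ltnS; exact: ltnW.
have jR : 0 < j%:R :> R by rewrite ltr0n.
have jN : (j <= N)%N.
  rewrite -(ler_nat R) -EN (le_trans jE)// ler_expR ler_pdivrMr; last by lra.
  by rewrite ler_peMr; lra.
have lnj : ln (j%:R : R) <= L / k by rewrite -[leRHS]expRK ler_ln ?posrE ?expR_gt0.
have lnj2 : L / (2 * k) <= ln (j%:R : R).
  apply: (@le_trans _ _ (L / k - 1)).
    have -> : L / (2 * k) = (L / k) / 2 by field; rewrite gt_eqF//; lra.
    lra.
  have : expR (L / k) / expR 1 <= j%:R.
    rewrite ler_pdivrMr ?expR_gt0//; apply: (@le_trans _ _ (j%:R * 2)).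
      by apply: (le_trans (ltW jE2)); rewrite -natrM ler_nat muln2 -addnn -addn1 leq_add2l.
    by rewrite ler_pM2l//; apply: le_trans (expR_ge1Dx _); lra.
  by rewrite -expRB => h; rewrite -[leLHS]expRK ler_ln ?posrE ?expR_gt0.
have jjN : (0 <= j <= N)%N by rewrite jN.
rewrite (primes_in_cat jjN) /model EE_cat.
have sum_top : \sum_(j.+1 <= p < N.+1 | prime p) b p <= 4 * k * ic.
  have l0 : 0 < ln (j%:R : R).
    by apply: lt_le_trans lnj2; apply: divr_gt0; lra.
  rewrite -(ler_pM2l l0).
  apply: (@le_trans _ _ (ic * (1 + ln (N%:R / j%:R)))).
    have jN1 : 1 <= N%:R / j%:R :> R by rewrite ler_pdivlMr// mul1r ler_nat.
    apply: le_trans (chebyshev_interval A0 beta0 C0 N rb NR jN1).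
    rewrite mulr_sumr [leRHS]big_mkcond [leRHS](big_cat_nat _ (n := j.+1))//=.
    apply: ler_wpDl.
      by apply: sumr_ge0 => p _; case: ifP => // _; apply: mulr_ge0; rewrite ?ln_nat_ge0.
    rewrite big_mkcond big_nat [leRHS]big_nat; apply: ler_sum => p /andP[jp pN].
    case: (boolP (prime p)) => //= pp.
    have -> : N%:R / (N%:R / j%:R) = j%:R :> R by field; rewrite !gt_eqF.
    rewrite ltr_nat jp ler_nat -ltnS pN /= mulrC ler_wpM2l//.
    by have p0 := prime_gt0 pp; rewrite ler_ln ?posrE ?ltr0n// (ler_nat R) ltnW.
  rewrite ln_div ?posrE// -/L.
  apply: (@le_trans _ _ (ic * (2 * L))).
    by rewrite ler_pM2l//; have := l0; lra.
  apply: (@le_trans _ _ (L / (2 * k) * (4 * k * ic))).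
    by rewrite le_eqVlt; apply/orP; left; apply/eqP; field; rewrite gt_eqF//; lra.
  by rewrite ler_wpM2r// mulr_ge0// ltW//; lra.
have mtop : expR (- (4 * k * ic + C)) <= (mass b N (primes_in j N))^-1.
  rewrite expRN lef_pV2 ?posrE ?expR_gt0 ?(mass_gt0 N rb)//.
  by apply: le_trans (mass_upper eta0 N rb j) _; rewrite ler_expR lerD2r.
set E := expR (- _) in mtop *; have E0 : 0 < E by exact: expR_gt0.
apply: (@le_trans _ _ (model b f N (primes_in 0 j) (fun _ (u : R) => E * (1 + - L^-1 * u)) a 0)).
  rewrite /model EEZ ler_pM2l// EED EEZ.
  rewrite -!/(model b f N _ _ _ _) (model_cst f N rb) (model_mean_size f N rb) add0r sum_primes_in.
  suff : \sum_(1 <= p < j.+1 | prime p) \sum_(v < N.+1) model_wt b N p v * (v%:R * ln p%:R) <= L / 2.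
    move=> h; have : L^-1 * (\sum_(1 <= p < j.+1 | prime p) \sum_(v < N.+1) model_wt b N p v * (v%:R * ln p%:R)) <= L^-1 * (L / 2).
      by rewrite ler_pM2l// invr_gt0; lra.
    by rewrite [L^-1 * (L / 2)]mulrA mulVf ?mul1r ?mulNr ?gt_eqF//; lra.
  apply: (@le_trans _ _ (\sum_(1 <= p < j.+1 | prime p) (b p * ln p%:R + \sum_(2 <= v < N.+1) b (p ^ v)%N * ln (p ^ v)%:R))).
    apply: ler_sum_pred => p pp /andP[p0 pj].
    rewrite -(big_mkord xpredT (fun v => model_wt b N p v * (v%:R * ln p%:R))).
    rewrite big_ltn//= mul0r mulr0 add0r big_ltn ?ltnS// mul1r; apply: lerD.
      rewrite ler_wpM2r ?ln_nat_ge0//; by have := model_wt_le N rb p 1; rewrite expn1.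
    apply: ler_sum => v _; rewrite ln_pfactor ?prime_gt0// ler_wpM2r//; last exact: model_wt_le rb _ _.
    by rewrite mulr_ge0// ln_nat_ge0.
  rewrite big_split/=; apply: (@le_trans _ _ (ic * (1 + ln j%:R) + eta^-1 * C)).
    apply: lerD; last exact: (prime_power_tail_log eta0 j N.+1 rb).
    have j1 : 1 <= j%:R :> R by rewrite ler1n.
    apply: le_trans (chebyshev_interval A0 beta0 C0 j rb jR j1).
    rewrite big_mkcond [leRHS]big_mkcond big_nat [leRHS]big_nat; apply: ler_sum => p /andP[p0 pj].
    case: (boolP (prime p)) => //= pp.
    by rewrite divff ?gt_eqF// ltr1n prime_gt1//= ler_nat -ltnS pj.
  apply: (@le_trans _ _ (ic * (1 + L / k) + eta^-1 * C)).
    by rewrite lerD2r ler_pM2l// lerD2l.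
  have : ic * (L / k) <= L / 4.
    rewrite mulrA ler_pdivrMr; last by lra.
    by rewrite /k; lra.
  by rewrite mulrDr; lra.
apply: (model_le_supp f N rb) => x u u0.
apply: le_trans (model_below_ge f N rb _ _ _ _).
case: (leP u L) => uL /=.
  rewrite mulr1; apply: le_trans mtop; rewrite ger_pMr//.
  by rewrite gerDl mulNr oppr_le0 mulr_ge0// invr_ge0; lra.
rewrite mulr0 mulr_ge0_le0//; first exact: ltW.
have : L^-1 * L <= L^-1 * u by rewrite ler_pM2l ?invr_gt0; lra.
by rewrite mulVf ?gt_eqF//; lra.
Qed.

End ModelProbabilities.

(** * Comparison of the moments over integers with the moments of the model *)

(** Both X and S are proportional to X' and T with the same factor k/L, up to errors, so the quotients agree. *)
Lemma ratio_compare (R : realType) (L S T X X' G1 G2 k K lam : R) :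
  0 < L -> 0 < k -> 0 < T -> 0 <= K -> 0 <= lam -> 0 <= G1 -> K * lam <= 2^-1 ->
  `|L * X - k * X'| <= k * K * (G1 + lam * G2) ->
  `|L * S - k * T| <= k * K * (lam * T) -> `|X'| <= G2 ->
  `|S^-1 * X - X' / T| <= 2 * K * (G1 + 2 * lam * G2) / T.
Proof.
move=> L0 k0 T0 K0 lam0 G10 Kl hX hS hG; have G20 := le_trans (normr_ge0 _) hG.
have kT0 : 0 < k * T by exact: mulr_gt0.
have LS : k * T / 2 <= L * S.
  have : k * K * (lam * T) <= k * T * 2^-1.
    have -> : k * K * (lam * T) = k * T * (K * lam) by ring.
    by rewrite ler_pM2l.
  by have := ler_norm (- (L * S - k * T)); rewrite normrN; lra.
have LS0 : 0 < L * S by apply: lt_le_trans LS; rewrite divr_gt0.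
have S0 : 0 < S by rewrite -(pmulr_rgt0 _ L0).
have -> : S^-1 * X - X' / T = ((L * X - k * X') * T - X' * (L * S - k * T)) / (L * S * T).
  by field; rewrite !gt_eqF.
rewrite normrM [`|(_ * T)^-1|]ger0_norm ?invr_ge0; last by apply: mulr_ge0; exact: ltW.
rewrite ler_pdivrMr ?mulr_gt0//.
apply: (@le_trans _ _ (k * K * (G1 + lam * G2) * T + G2 * (k * K * (lam * T)))).
  apply: le_trans (ler_normB _ _) _; rewrite !normrM (gtr0_norm T0); apply: lerD.
    by rewrite ler_wpM2r// ltW.
  by apply: ler_pM.
have -> : k * K * (G1 + lam * G2) * T + G2 * (k * K * (lam * T)) =
  2 * K * (G1 + 2 * lam * G2) / T * (k * T / 2 * T) by field; rewrite gt_eqF.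
apply: ler_wpM2l; first by nonneg; exact: ltW.
by apply: ler_wpM2r => //; exact: ltW.
Qed.

Lemma ler_pow_base (R : realType) (x y : R) n : 0 <= x -> x <= y -> x ^+ n <= y ^+ n.
Proof.
by move=> x0 xy; apply: lerXn2r => //; rewrite nnegrE// (le_trans x0).
Qed.

Lemma norm_pow_le (R : realType) (x a b : R) i : 0 <= a -> a <= b ->
  (`|x| + a) ^+ i <= (`|x| + b) ^+ i.
Proof. by move=> a0 ab; apply: ler_pow_base; rewrite ?addr_ge0// lerD2l. Qed.

Lemma shifted_pow_le (R : realType) (x d D : R) i : `|d| <= D ->
  (`|x + d| + 2) ^+ i <= (`|x| + (D + 2)) ^+ i.
Proof.
move=> dD; apply: ler_pow_base; first by rewrite addr_ge0.
by have := ler_normD x d; lra.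
Qed.

Section MomentReduction.
Variable R : realType.
Variables (s A beta eta C : R).
Hypotheses (s0 : 0 < s) (A0 : 0 < A) (A1 : A <= 1) (beta0 : 0 < beta) (eta0 : 0 < eta)
  (etas : eta <= s) (C0 : 0 < C).
Notation regular := (regular_weight A beta eta C).

Definition prime_mean (b f : nat -> R) N := \sum_(1 <= p < N.+1 | prime p) b p * f p.
Definition prime_variance (b f : nat -> R) N := \sum_(1 <= p < N.+1 | prime p) b p * f p ^+ 2.
Definition dev_mean (b f : nat -> R) N (g : R -> R) :=
  model b f N (primes_in 0 N) (fun x _ => g x) 0 0.
Definition model_variance (b f : nat -> R) N :=
  vars N (model_wt b N) (model_dev b f N) (primes_in 0 N).

Lemma dev_mean_functional b f N : regular b -> mean_functional (dev_mean b f N).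
Proof.
move=> rb; split.
- by move=> k g g'; rewrite /dev_mean /model EE_lin.
- by move=> g g' h; apply: (model_le f N rb) => x _; exact: h.
- by move=> k; exact: model_cst f N rb _ _ _ _.
Qed.

Lemma dev_mean_shift b f N (g : R -> R) d :
  model b f N (primes_in 0 N) (fun x _ => g x) d 0 = dev_mean b f N (fun x => g (x + d)).
Proof. by rewrite -[d in LHS]add0r /model E1_shift. Qed.

Lemma dev_mean_ge0 b f N (g : R -> R) : regular b -> (forall x, 0 <= g x) -> 0 <= dev_mean b f N g.
Proof. by move=> rb g0; apply: (model_ge0 f N rb). Qed.

Lemma factor_mass_split b N p : regular b -> (0 < N)%N ->
  factor_mass b N p = 1 + (b p + \sum_(2 <= v < N.+1) b (p ^ v)%N).
Proof. by move=> rb N0; rewrite (factor_massE N rb) big_ltn ?ltnS// expn1. Qed.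

(** The two quantities are the mean and the variance of the indicator that p divides the random integer. *)
Lemma model_q_close b N p : regular b -> (0 < N)%N ->
  `|model_q b N p - b p| <= 3 * (b p ^+ 2 + \sum_(2 <= v < N.+1) b (p ^ v)%N) /\
  `|model_q b N p * (1 - model_q b N p) - b p| <=
     3 * (b p ^+ 2 + \sum_(2 <= v < N.+1) b (p ^ v)%N).
Proof.
move=> rb N0; rewrite /model_q (factor_mass_split p rb N0).
have x0 : 0 <= b p := rw_ge0 rb p.
have t0 : 0 <= \sum_(2 <= v < N.+1) b (p ^ v)%N by apply: sumr_ge0 => v _; exact: rw_ge0 rb _.
move: (b p) (\sum_(_ <= _ < _) _) x0 t0 => x t x0 t0.
set q := 1 - (1 + (x + t))^-1.
have F0 : 0 < 1 + (x + t) by lra.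
have qE : q * (1 + (x + t)) = x + t by rewrite /q; field; rewrite gt_eqF.
have q0 : 0 <= q by rewrite /q subr_ge0 invf_le1//; lra.
have q1 : q <= 1 by rewrite /q gerBl invr_ge0 ltW.
clearbody q.
have qxt : 0 <= q * (x + t) by apply: mulr_ge0 => //; lra.
have qt : q * t <= t by rewrite ler_piMl.
have qx : q * x <= x ^+ 2 + t.
  have : q * x <= (x + t) * x by rewrite ler_wpM2r//; lra.
  have : q * x <= x by rewrite ler_piMl.
  have [x1|x1] := leP x 1.
    have : t * x <= t by rewrite ler_piMr.
    by rewrite expr2; lra.
  have : x <= x ^+ 2 by rewrite expr2 ler_peMr// ltW.
  by lra.
have q2 : q * q <= q * x + q * t by rewrite -mulrDr ler_wpM2l//; lra.
have xx0 : 0 <= x ^+ 2 by exact: sqr_ge0.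
have qq0 : 0 <= q * q by exact: mulr_ge0.
by split; rewrite ler_norml; apply/andP; split; lra.
Qed.

Lemma prime_sum_close b (F G : nat -> R) N : regular b -> (0 < N)%N ->
  (forall p, prime p -> `|F p - G p| <= 3 * (b p ^+ 2 + \sum_(2 <= v < N.+1) b (p ^ v)%N)) ->
  `|\sum_(1 <= p < N.+1 | prime p) F p - \sum_(1 <= p < N.+1 | prime p) G p| <= 6 * C.
Proof.
move=> rb N0 h; rewrite -sumrB; apply: le_trans (ler_norm_sum _ _ _) _.
apply: (@le_trans _ _ (\sum_(1 <= p < N.+1 | prime p) 3 * (b p ^+ 2 + \sum_(2 <= v < N.+1) b (p ^ v)%N))).
  by apply: ler_sum => p; exact: h.
rewrite -mulr_sumr big_split/=.
by have := rw_sq rb N; have := prime_power_tail eta0 N N.+1 rb; lra.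
Qed.

Lemma centre_close b f N : regular b -> (0 < N)%N -> (forall p, prime p -> `|f p| <= 1) ->
  `|centre b f N (primes_in 0 N) - prime_mean b f N| <= 6 * C.
Proof.
move=> rb N0 f1; rewrite /centre sum_primes_in; apply: (prime_sum_close rb N0) => p pp.
rewrite pp [b p * _]mulrC -mulrBr normrM; apply: le_trans (model_q_close p rb N0).1.
by rewrite ler_piMl// f1.
Qed.

Lemma model_variance_close b f N : regular b -> (0 < N)%N -> (forall p, prime p -> `|f p| <= 1) ->
  `|model_variance b f N - prime_variance b f N| <= 6 * C.
Proof.
move=> rb N0 f1; rewrite /model_variance /vars sum_primes_in.
apply: (prime_sum_close rb N0) => p pp.
rewrite (model_var1 f N rb pp) [b p * _]mulrC -mulrBr normrM; apply: le_trans (model_q_close p rb N0).2.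
by rewrite ler_piMl// ger0_norm ?sqr_ge0// -real_normK ?num_real// exprn_ile1// f1.
Qed.

Lemma log_growth : forall K : R, exists L1 : R, forall L, L1 <= L ->
   K * (L `^ (A / 2))^-1 <= 2^-1.
Proof.
move=> K; have A2 : 0 < A / 2 by rewrite divr_gt0.
pose Z := Num.max 1 (2 * K); have Z1 : 1 <= Z by rewrite /Z le_max lexx.
have Z0 : 0 < Z by lra.
exists (Z `^ (A / 2)^-1) => L hL.
have hZ : Z <= L `^ (A / 2).
  apply: le_trans (_ : (Z `^ (A / 2)^-1) `^ (A / 2) <= _).
    by rewrite -powRrM mulVf ?gt_eqF// powRr1// ltW.
  by apply: ge0_ler_powR; rewrite ?nnegrE ?powR_ge0// ?(ltW A2)// (le_trans _ hL)// powR_ge0.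
rewrite ler_pdivrMr; last by lra.
have : 2 * K <= Z by rewrite /Z le_max lexx orbT.
lra.
Qed.

(** Three comparisons: [log_reduction] for the power and for the constant 1 passes from alpha to b, [model_link] and
    [covariance] from b to the unconditioned model, and the mean of f is moved from [prime_mean] to the centre. *)
Lemma moment_reduction : exists K D L1 : R, [/\ 0 < K, 0 <= D &
  forall (b f : nat -> R) (N m : nat), regular b -> strongly_additive f ->
    (forall p, prime p -> `|f p| <= 1) -> L1 <= ln (N%:R : R) ->
  `|(\sum_(1 <= n < N.+1) b n * n%:R `^ s)^-1 *
      \sum_(1 <= n < N.+1) b n * n%:R `^ s * (f n - prime_mean b f N) ^+ m.+1 -
    dev_mean b f N (fun x => x ^+ m.+1)| <=
  K * (m.+1%:R * dev_mean b f N (fun x => (`|x| + D) ^+ m) +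
       (ln (N%:R : R) `^ (A / 2))^-1 * dev_mean b f N (fun x => (`|x| + D) ^+ m.+1))].
Proof.
have [g [Kg [g01 Kg0 smooth]]] := model_smoothing A0 beta0 eta0 C0.
have [Dr Dr0 rhoD] := rho_below_rate A0 beta0 eta0 C0 g01 Kg0.
have [c1 [L2 [c10 lower]]] := model_below_lower A0 beta0 eta0 C0.
have [KL KL0 reduction] := log_reduction s0 A0 A1 beta0 eta0 etas C0.
have bs0 : 0 < beta / s by rewrite divr_gt0.
pose K' := KL / (beta / s); have K'0 : 0 < K' by rewrite divr_gt0.
have [L3 small] := log_growth K'.
pose D1 := 6 * C; have D10 : 0 < D1 by rewrite /D1 mulr_gt0.
exists (4 * K' / c1 + Dr / c1 + D1), (D1 + 2), (Num.max 4 (Num.max L2 L3)); split.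
- by rewrite !addr_gt0// divr_gt0// mulr_gt0.
- by lra.
move=> b f N m rb fa f1; rewrite !ge_max => /and3P[L4 LL2 LL3].
have b0 := rw_ge0 rb.
set L := ln (N%:R : R) in L4 LL2 LL3 *; have L0 : 0 < L by apply: lt_le_trans L4.
have L1 : 1 <= L by apply: le_trans L4; rewrite ler1n.
have N2 : (2 <= N)%N.
  by rewrite ltnNge; apply: contraTN L0 => N1; rewrite -leNgt ln_le0// lern1.
have N0 : (0 < N)%N by exact: ltnW.
set lam := (L `^ (A / 2))^-1; have lam0 : 0 <= lam by rewrite invr_ge0 powR_ge0.
set AN := prime_mean b f N; set ps := primes_in 0 N.
set d := centre b f N ps - AN.
have dD : `|d| <= D1 by exact: centre_close.
pose psi (u : R) : R := (u <= L)%R%:R.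
have psi0 u : 0 <= psi u by exact: ler0n.
have psi1 u : psi u <= 1 by rewrite /psi lern1 leq_b1.
have M0 : 0 < mass b N ps := mass_gt0 N rb _.
have apr : all prime ps by apply/allP => q; rewrite mem_primes_in => /and3P[].
have ups : uniq ps := uniq_primes_in 0 N.
have link (h : R -> R) : \sum_(1 <= n < N.+1) b n * h (f n - AN) =
    mass b N ps * model b f N ps (fun x u => h x * psi u) d 0.
  rewrite -(model_link rb fa)//; last first.
    by move=> x u; rewrite add0r => Lu; rewrite /psi leNgt Lu mulr0.
  rewrite [RHS]big_mkcond; apply: eq_big_nat => n /andP[n0 nN].
  have -> : supported_on ps n.
    apply/allP => q; rewrite mem_primes n0 mem_primes_in => /and3P[qp _ qn].
    by rewrite qp prime_gt0//= (leq_trans (dvdn_leq n0 qn)).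
  rewrite add0r /psi ler_ln ?posrE ?ltr0n// ler_nat -ltnS nN mulr1.
  by congr (_ * h _); rewrite /d; ring.
pose P := model b f N ps (fun _ u => psi u) d 0.
have Pc : c1 <= P by exact: lower.
have P0 : 0 < P by lra.
have TE : \sum_(1 <= n < N.+1) b n = mass b N ps * P.
  transitivity (\sum_(1 <= n < N.+1) b n * (fun=> 1) (f n - AN)).
    by apply: eq_bigr => n _; rewrite mulr1.
  by rewrite (link (fun=> 1)); congr (_ * _); apply: EE_ext => x u; rewrite mul1r.
set T := \sum_(1 <= n < N.+1) b n in TE *.
have T0 : 0 < T by rewrite TE mulr_gt0.
pose X' := \sum_(1 <= n < N.+1) b n * (f n - AN) ^+ m.+1.
pose G1 := \sum_(1 <= n < N.+1) b n * (m.+1%:R * (`|f n - AN| + 1) ^+ m).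
pose G2 := \sum_(1 <= n < N.+1) b n * (`|f n - AN| + 1) ^+ m.+1.
have NsR : 0 < N%:R `^ s :> R by apply: powR_gt0; rewrite ltr0n.
pose k := beta / s * N%:R `^ s; have k0 : 0 < k by rewrite mulr_gt0.
have kK : KL * N%:R `^ s = k * K' by rewrite /k /K'; field; rewrite !gt_eqF.
have fpv m' p v : (0 < m')%N -> prime p -> (0 < v)%N -> ~~ (p %| m')%N ->
    f (p ^ v * m')%N - AN = (f m' - AN) + f p.
  by move=> m0 pp v0 pm; rewrite (f_pfactor fa)// v0 mul1r; ring.
have hX : `|L * (\sum_(1 <= n < N.+1) b n * n%:R `^ s * (f n - AN) ^+ m.+1) - k * X'| <=
    k * K' * (G1 + lam * G2).
  have pos n i : 0 <= (`|f n - AN| + 1) ^+ i by apply: exprn_ge0; apply: addr_ge0.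
  rewrite -kK; apply: (reduction b N (fun n => (f n - AN) ^+ m.+1)
    (fun n => m.+1%:R * (`|f n - AN| + 1) ^+ m) (fun n => (`|f n - AN| + 1) ^+ m.+1)) => //.
    by move=> n; rewrite normrX; apply: ler_pow_base; rewrite ?lerDl//.
  move=> m' p v m0 pp v0 pm; rewrite fpv//; have fp1 := f1 p pp; split.
    apply: le_trans (power_increment _ _ _) _; rewrite -[leLHS]mulrA.
    apply: le_trans (ler_piMl _ fp1) _; first by nonneg.
    by rewrite ler_wpM2l//; apply: ler_pow_base; rewrite ?lerD2l// addr_ge0.
  rewrite normrX; apply: ler_pow_base => //.
  by apply: le_trans (ler_normD _ _) _; rewrite lerD2l.
have hS : `|L * (\sum_(1 <= n < N.+1) b n * n%:R `^ s) - k * T| <= k * K' * (lam * T).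
  have eS : \sum_(1 <= n < N.+1) b n * n%:R `^ s * 1 = \sum_(1 <= n < N.+1) b n * n%:R `^ s.
    by apply: eq_bigr => n _; rewrite mulr1.
  have eT : \sum_(1 <= n < N.+1) b n * 1 = T by apply: eq_bigr => n _; rewrite mulr1.
  have e0 : \sum_(1 <= n < N.+1) b n * 0 = 0 by apply: big1 => n _; rewrite mulr0.
  have red := reduction b N (fun=> 1) (fun=> 0) (fun=> 1) rb L4 (fun=> lexx 0) (fun=> ler01).
  cbv beta in red; rewrite -/L -/lam eS eT e0 add0r kK in red.
  apply: red; first by move=> n; rewrite normr1.
  by move=> m' p v _ _ _ _; rewrite subrr normr0 normr1.
have X'G : `|X'| <= G2.
  apply: le_trans (ler_norm_sum _ _ _) _; apply: ler_sum => n _.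
  rewrite normrM ger0_norm ?ler_wpM2l// normrX; apply: ler_pow_base; rewrite ?lerDl//.
have G10 : 0 <= G1 by apply: sumr_ge0 => n _; apply: mulr_ge0 => //; nonneg.
have step1 := ratio_compare L0 k0 T0 (ltW K'0) lam0 G10 (small L LL3) hX hS X'G.
have toE (h : R -> R) i : (forall x, 0 <= h x) -> (forall x, h x <= (`|x| + 2) ^+ i) ->
    (\sum_(1 <= n < N.+1) b n * h (f n - AN)) / T <= c1^-1 * dev_mean b f N (fun x => (`|x| + (D1 + 2)) ^+ i).
  move=> h0 hi; rewrite (link h) TE -mulf_div divff ?gt_eqF// mul1r mulrC.
  apply: ler_pM; [by rewrite invr_ge0 ltW|by apply: (model_ge0 f N rb) => x u; apply: mulr_ge0| |].
    by rewrite lef_pV2.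
  apply: (@le_trans _ _ (model b f N ps (fun x _ => (`|x| + 2) ^+ i) d 0)).
    by apply: (model_le f N rb) => x u; apply: le_trans (hi x); rewrite ler_piMr.
  rewrite dev_mean_shift; apply: (model_le f N rb) => x _.
  exact: shifted_pow_le.
set E1 := dev_mean b f N (fun x => (`|x| + (D1 + 2)) ^+ m).
set E2 := dev_mean b f N (fun x => (`|x| + (D1 + 2)) ^+ m.+1).
have E10 : 0 <= E1 by apply: dev_mean_ge0 => // x; nonneg; lra.
have E20 : 0 <= E2 by apply: dev_mean_ge0 => // x; nonneg; lra.
have g1E : G1 / T <= c1^-1 * (m.+1%:R * E1).
  have -> : G1 = m.+1%:R * \sum_(1 <= n < N.+1) b n * (`|f n - AN| + 1) ^+ m.
    by rewrite mulr_sumr; apply: eq_bigr => n _; rewrite mulrCA.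
  rewrite -[leLHS]mulrA [leRHS]mulrCA ler_wpM2l//.
  apply: (toE (fun x => (`|x| + 1) ^+ m)) => x; first by nonneg.
  by apply: norm_pow_le => //; rewrite ler1n.
have g2E : G2 / T <= c1^-1 * E2.
  apply: (toE (fun x => (`|x| + 1) ^+ m.+1)) => x; first by nonneg.
  by apply: norm_pow_le => //; rewrite ler1n.
have step2 : `|X' / T - model b f N ps (fun x _ => x ^+ m.+1) d 0| <= Dr / c1 * (m.+1%:R * E1).
  rewrite /X' (link (fun x => x ^+ m.+1)) TE -mulf_div divff ?gt_eqF// mul1r.
  have -> : forall Y Z : R, Y / P - Z = (Y - Z * P) / P by move=> Y Z; field; rewrite gt_eqF.
  rewrite normrM [X in _ * X]ger0_norm ?invr_ge0 ?(ltW P0)//.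
  have cov := @covariance R N (model_wt b N) (model_dev b f N) (fun p => ln p%:R)
    (model_wt_ge0 N rb) (@model_lg_ge0 R) (model_wt_sum N rb) (model_dev_le1 N rb f1)
    (model_dev_diff b N f1) (below_rate g Kg N) psi ps m d 0 (smooth b f N rb fa N2) (lexx 0).
  have rD := rhoD b N rb L1.
  apply: (@le_trans _ _ (Dr * (m.+1%:R * E1) / P)); last first.
    by rewrite mulrAC ler_wpM2r ?mulr_ge0// ler_wpM2l ?(ltW Dr0)// lef_pV2.
  rewrite ler_wpM2r ?invr_ge0 ?(ltW P0)//; apply: le_trans cov _.
  have E1' : m.+1%:R * model b f N ps (fun x _ => (`|x| + 2) ^+ m) d 0 <= m.+1%:R * E1.
    rewrite ler_wpM2l// dev_mean_shift; apply: (model_le f N rb) => x _.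
    exact: shifted_pow_le.
  apply: le_trans (ler_wpM2r _ rD) _; first by apply: mulr_ge0 => //; apply: (model_ge0 f N rb) => x u; nonneg.
  by apply: ler_wpM2l E1'; exact: ltW.
have step3 : `|model b f N ps (fun x _ => x ^+ m.+1) d 0 - dev_mean b f N (fun x => x ^+ m.+1)| <=
    D1 * (m.+1%:R * E1).
  rewrite dev_mean_shift /dev_mean /model -EEB -!/(model b f N _ _ _ _).
  apply: le_trans (model_norm f N rb _ _ _ _) _.
  rewrite mulrA /E1 /dev_mean /model -EEZ -!/(model b f N _ _ _ _); apply: (model_le f N rb) => x _.
  apply: le_trans (power_increment _ _ _) _; apply: ler_pM; [by nonneg|by nonneg|by rewrite ler_wpM2r|].
  by apply: norm_pow_le => //; apply: ler_wpDr.
rewrite -/lam.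
have tri (x y z w : R) : `|x - w| <= `|x - y| + (`|y - z| + `|z - w|).
  by rewrite (_ : x - w = (x - y) + ((y - z) + (z - w))); [apply: le_trans (ler_normD _ _) (lerD (lexx _) (ler_normD _ _))|ring].
apply: le_trans (tri _ (X' / T) (model b f N ps (fun x _ => x ^+ m.+1) d 0) _) _.
apply: le_trans (lerD step1 (lerD step2 step3)) _.
have e1 : 2 * K' * (G1 + 2 * lam * G2) / T = 2 * K' * (G1 / T) + 4 * K' * lam * (G2 / T) by ring.
rewrite e1; have mE : 0 <= m.+1%:R * E1 by apply: mulr_ge0.
have lE : 0 <= lam * E2 by apply: mulr_ge0.
have a1 : 2 * K' * (G1 / T) <= 2 * K' * (c1^-1 * (m.+1%:R * E1)) by rewrite ler_pM2l// mulr_gt0.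
have a2 : 4 * K' * lam * (G2 / T) <= 4 * K' * lam * (c1^-1 * E2).
  by apply: ler_wpM2l g2E; apply: mulr_ge0 => //; apply: mulr_ge0 => //; exact: ltW.
apply: le_trans (lerD (lerD a1 a2) (lexx _)) _.
have -> : 4 * K' * lam * (c1^-1 * E2) = 4 * K' / c1 * (lam * E2) by ring.
rewrite -[_ * (c1^-1 * _)]mulrA [2 * (K' * _)]mulrA.
move: (m.+1%:R * E1) (lam * E2) mE lE => Y Z Y0 Z0.
have u0 : 0 <= K' / c1 by rewrite divr_ge0// ltW.
have v0 : 0 <= Dr / c1 by rewrite divr_ge0// ltW.
rewrite [2 * K' * _](_ : _ = 2 * (K' / c1 * Y)); last by ring.
have w1 : 0 <= K' / c1 * Y by exact: mulr_ge0.
have w2 : 0 <= Dr / c1 * Z by exact: mulr_ge0.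
have w3 : 0 <= D1 * Z by apply: mulr_ge0 => //; exact: ltW.
rewrite -[4 * K' / c1]mulrA !mulrDr !mulrDl.
by clear -w1 w2 w3 s0 A0 A1 beta0 eta0 etas C0; lra.
Qed.

End MomentReduction.

(** * Moments for additive functions bounded by one on primes *)

(** Here |s - t| <= D/t, and (1 + D/t^2)^n is bounded because n = O(t). *)
Lemma power_perturbation (R : realType) (D h s t : R) n :
  0 <= D -> 1 <= t -> 0 <= s -> `|s ^+ 2 - t ^+ 2| <= D -> n.+1%:R <= h * t ->
  `|s ^+ n.+1 - t ^+ n.+1| <= D * expR (h * D) * (n.+1%:R / t) * t ^+ n.+1.
Proof.
move=> D0 t1 s0 hD hn; have t0 : 0 < t by lra.
have st : `|s - t| <= D / t.
  rewrite ler_pdivlMr//; apply: le_trans hD; rewrite subr_sqr normrM ler_wpM2l//.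
  by rewrite ger0_norm; lra.
have := power_increment t (s - t) n; rewrite subrKC (gtr0_norm t0) => h1; apply: le_trans h1 _.
have h2 : (t + `|s - t|) ^+ n <= t ^+ n * expR (h * D).
  apply: (@le_trans _ _ ((t * (1 + D / t ^+ 2)) ^+ n)).
    apply: ler_pow_base; first by nonneg.
    by rewrite mulrDr mulr1 (_ : t * (D / t ^+ 2) = D / t) ?lerD2l//; field; rewrite gt_eqF.
  have t20 : 0 < t ^+ 2 by exact: exprn_gt0.
  have x0 : 0 <= D / t ^+ 2 by apply: divr_ge0 => //; exact: ltW.
  rewrite exprMn ler_wpM2l ?exprn_ge0 ?(ltW t0)//.
  apply: (@le_trans _ _ (expR (D / t ^+ 2) ^+ n)).
    by apply: ler_pow_base; [lra|exact: expR_ge1Dx].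
  rewrite -expRM_natl ler_expR mulrA ler_pdivrMr//.
  have : n%:R * D <= h * t * D.
    by rewrite ler_wpM2r//; apply: le_trans hn; rewrite ler_nat.
  have : h * t * D * 1 <= h * t * D * t.
    by rewrite ler_wpM2l//; apply: mulr_ge0 => //; apply: le_trans hn.
  by rewrite expr2; lra.
apply: (@le_trans _ _ (D / t * n.+1%:R * (t ^+ n * expR (h * D)))).
  apply: ler_pM; [by nonneg|by nonneg|by rewrite ler_wpM2r|exact: h2].
have -> : D * expR (h * D) * (n.+1%:R / t) * t ^+ n.+1 =
  (D / t * n.+1%:R * (t ^+ n * expR (h * D))) * t by rewrite exprS; field; rewrite gt_eqF.
by apply: ler_peMr => //; nonneg; exact: ltW.
Qed.

Lemma ler_of_sqr (R : realType) (x y : R) : 0 <= y -> x ^+ 2 <= y ^+ 2 -> x <= y.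
Proof.
move=> y0 h; rewrite leNgt; apply/negP => yx; move: h.
by rewrite leNgt !expr2 ltr_pM.
Qed.

Lemma rescale_error (R : realType) (a k q s t W Z : R) :
  0 <= a -> 0 <= q -> 0 < t -> t / 2 <= s -> 0 <= W -> W <= k * Z ->
  a * (q / s * W) <= 2 * a * k * (q / t) * Z.
Proof.
move=> a0 q0 t0 ts W0 WZ; have s0 : 0 < s by lra.
have -> : 2 * a * k * (q / t) * Z = a * ((q * (t / 2)^-1) * (k * Z)).
  by field; rewrite gt_eqF.
apply: ler_wpM2l => //; apply: ler_pM => //; first by rewrite divr_ge0// ltW.
by apply: ler_wpM2l => //; rewrite lef_pV2 ?posrE//; lra.
Qed.

Section NormalisedMoments.
Variable R : realType.
Variables (s A beta eta C : R).
Hypotheses (s0 : 0 < s) (A0 : 0 < A) (A1 : A <= 1) (beta0 : 0 < beta) (eta0 : 0 < eta)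
  (etas : eta <= s) (C0 : 0 < C).
Notation regular := (regular_weight A beta eta C).
Notation c := (Cconst R).

(** Makes L^(-A/2) an error of order 1/s: the variance is at most of order L^A. *)
Lemma prime_variance_le : exists2 K : R, 0 < K & forall (b f : nat -> R) N,
  regular b -> (forall p, prime p -> `|f p| <= 1) ->
  prime_variance b f N <= K * ln N%:R `^ A.
Proof.
have A01 : 0 < A <= 1 by rewrite A0.
have [K K0 HK] := prime_log_power eta A0 beta0 C0 A01.
exists (2 `^ A * K); first by rewrite mulr_gt0// powR_gt0.
move=> b f N rb f1; rewrite -mulrA.
apply: le_trans (_ : _ <= 2 `^ A * \sum_(1 <= p < N.+1 | prime p) b p * ln p%:R `^ A) _; last first.
  by rewrite ler_wpM2l ?powR_ge0//; exact: HK.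
rewrite mulr_sumr; apply: ler_sum => p pp; rewrite [leRHS]mulrCA ler_wpM2l ?(rw_ge0 rb)//.
have l2 : 2^-1 <= ln (p%:R : R) := ln_prime_ge _ pp.
rewrite -powRM//; last by lra.
apply: (@le_trans _ _ 1).
  by rewrite -real_normK ?num_real// exprn_ile1// f1.
by apply: powR_ge1; [lra|exact: ltW].
Qed.

Lemma normalised_moments (h0 : R) : 0 < h0 -> exists K L1 B1 : R, 0 < K /\
  forall (b f : nat -> R) (N m : nat), regular b -> strongly_additive f ->
    (forall p, prime p -> `|f p| <= 1) -> L1 <= ln (N%:R : R) ->
    B1 <= prime_variance b f N -> (0 < m)%N ->
    m%:R * Num.sqrt m%:R <= h0 * Num.sqrt (prime_variance b f N) ->
  `|(\sum_(1 <= n < N.+1) b n * n%:R `^ s)^-1 *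
      \sum_(1 <= n < N.+1) b n * n%:R `^ s * (f n - prime_mean b f N) ^+ m -
    chi R m * (c m * Num.sqrt (prime_variance b f N) ^+ m)| <=
  K * (m%:R * Num.sqrt m%:R / Num.sqrt (prime_variance b f N)) *
    (c m * Num.sqrt (prime_variance b f N) ^+ m).
Proof.
move=> h00; have [K1 [D [L1 [K10 D0 red]]]] := moment_reduction s0 A0 A1 beta0 eta0 etas C0.
have h20 : 0 <= 2 * h0 by lra.
have [K2 K20 asym] := moment_asymptotics (Cconst0 R) (@Cconst_gt0 R) (@CconstSS R) h20 D0.
have [K3 K30 varle] := prime_variance_le.
set mu := moment_ratio (Cconst R) in asym *.
have mu0 : 0 < mu := moment_ratio_gt0 (@Cconst_gt0 R).
have [D2 D20 D2E] : exists2 D2 : R, 0 <= D2 & D2 = 6 * C by exists (6 * C) => //; rewrite mulr_ge0// ltW.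
pose K4 := 2 * K3 + 1; pose Ec := expR (h0 * D2).
pose K5 := K1 * (K2 / mu + K4 * K2) + K2; pose K6 := 1 + D2 * Ec * h0.
have Ec0 : 0 <= Ec := expR_ge0 _.
have K40 : 0 < K4 by rewrite /K4; lra.
have K50 : 0 < K5.
  rewrite /K5; apply: ltr_wpDl => //; apply: mulr_ge0; first exact: ltW.
  by apply: addr_ge0; [apply: divr_ge0; exact: ltW|apply: mulr_ge0; exact: ltW].
have K60 : 0 < K6 by rewrite /K6; apply: ltr_pwDl => //; nonneg.
exists (2 * K5 * K6 + D2 * Ec), (Num.max L1 1), (4 * D2 + 4); split.
  by apply: ltr_wpDr; [exact: mulr_ge0|rewrite !mulr_gt0].
move=> b f N m rb fa f1; rewrite ge_max => /andP[LL1 LL2].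
set B := prime_variance b f N => B1 m0; set t := Num.sqrt B => hm.
have L0 : 0 < ln (N%:R : R) by exact: lt_le_trans LL2.
have N2 : (2 <= N)%N.
  by rewrite ltnNge; apply: contraTN L0 => N1; rewrite -leNgt ln_le0// lern1.
have N0 : (0 < N)%N by exact: ltnW.
set v := model_variance b f N.
have vB : `|v - B| <= D2 by rewrite D2E; exact: (model_variance_close eta0 rb N0 f1).
have vB4 : B / 4 <= v by have := ler_norm (- (v - B)); rewrite normrN; lra.
have vB2 : v <= 2 * B by have := ler_norm (v - B); lra.
set sg := Num.sqrt v.
have t2 : t ^+ 2 = B by rewrite sqr_sqrtr//; lra.
have sg2 : sg ^+ 2 = v by rewrite sqr_sqrtr//; lra.
have tn0 : 0 <= t by exact: sqrtr_ge0.
have sgn0 : 0 <= sg by exact: sqrtr_ge0.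
have t20 : 2 <= t by apply: ler_of_sqr => //; rewrite t2; lra.
have t0 : 0 < t by clear -t20 s0 A0 A1 beta0 eta0 etas C0; lra.
have sgt : t / 2 <= sg by apply: ler_of_sqr => //; rewrite sg2 expr_div_n t2; clear -vB4 s0 A0 A1 beta0 eta0 etas C0; lra.
have sg1 : 1 <= sg by clear -sgt t20 s0 A0 A1 beta0 eta0 etas C0; lra.
have sg0 : 0 < sg by clear -sg1 s0 A0 A1 beta0 eta0 etas C0; lra.
set l := ln (N%:R : R) `^ (A / 2).
have l0 : 0 < l by exact: powR_gt0.
have l2 : l ^+ 2 = ln N%:R `^ A.
  by rewrite /l expr2 -powRD ?(implybT, gt_eqF L0)//; congr (_ `^ _); field.
have lsg : l^-1 <= K4 / sg.
  rewrite ler_pdivlMr// mulrC ler_pdivrMr//; apply: ler_of_sqr; first by apply: mulr_ge0; exact: ltW.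
  rewrite sg2 exprMn l2; apply: (le_trans vB2).
  have := varle b f N rb f1; rewrite -/B => hB.
  apply: (@le_trans _ _ (2 * K3 * ln N%:R `^ A)); first by rewrite -mulrA ler_pM2l.
  rewrite ler_wpM2r ?powR_ge0//; have : 0 <= K3 * K3 by rewrite mulr_ge0// ltW.
  by rewrite /K4 expr2; clear -K30 s0 A0 A1 beta0 eta0 etas C0; lra.
have E0 : 0 <= c m by exact: ltW (Cconst_gt0 R m).
pose Ef := dev_mean b f N.
have hm2 : m%:R * Num.sqrt m%:R <= 2 * h0 * sg.
  apply: le_trans hm _; rewrite -mulrA [leRHS]mulrCA; apply: ler_wpM2l; first exact: ltW.
  by clear -sgt s0 A0 A1 beta0 eta0 etas C0; lra.
have wt1 := model_wt_sum N rb; have dv0 := model_dev_mean f N rb.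
have Ef1 : Ef id = 0 by exact: (@E1_mean R N _ _ (fun p => ln p%:R) wt1 dv0 _ 0).
have Ef2 : Ef (fun x => x ^+ 2) = sg ^+ 2.
  have := @E1_var R N _ _ (fun p => ln p%:R) wt1 dv0 (primes_in 0 N) 0.
  by rewrite sg2 expr0n add0r.
have st (j : nat) : `|Ef (fun x => x ^+ j.+3) - j.+2%:R * sg ^+ 2 * Ef (fun x => x ^+ j.+1)| <=
    2 * sg ^+ 2 * j.+2%:R ^+ 2 * Ef (fun x => (`|x| + 2) ^+ j).
  have := @stein R N (model_wt b N) (model_dev b f N) (fun p => ln p%:R) (model_wt_ge0 N rb)
    (@model_lg_ge0 R) wt1 (model_dev_le1 N rb f1) dv0 (primes_in 0 N) j 0.
  rewrite sg2; congr (`|_ - _| <= _).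
  by apply: EE_ext => x u; rewrite subr0 -exprS.
have [as1 as2] := asym Ef sg m (dev_mean_functional f N rb) sg1 m0 hm2 Ef1 Ef2 st.
case: m m0 hm hm2 E0 as1 as2 => [//|n] _ hm hm2 E0 as1 as2.
set M := (X in `|X - _|).
have m1 : 1 <= n.+1%:R :> R by rewrite ler1n.
set q := n.+1%:R * Num.sqrt n.+1%:R in hm hm2 as1 *.
have sq1 : 1 <= Num.sqrt n.+1%:R :> R by apply: ler_of_sqr; rewrite ?sqrtr_ge0// sqr_sqrtr ?ler0n// expr1n.
have sq2 : Num.sqrt n.+1%:R ^+ 2 = n.+1%:R :> R by rewrite sqr_sqrtr ?ler0n.
have qn : n.+1%:R <= q by rewrite /q ler_peMr.
have q1 : 1 <= q := le_trans m1 qn.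
set W := c n.+1 * sg ^+ n.+1 in as1 as2.
have W0 : 0 <= W by apply: mulr_ge0 => //; exact: exprn_ge0.
have h1 : `|M - Ef (fun x => x ^+ n.+1)| <= K1 * (K2 / mu + K4 * K2) * (q / sg * W).
  apply: le_trans (red b f N n rb fa f1 LL1) _; rewrite -/l -mulrA ler_pM2l// mulrDl; apply: lerD.
    apply: (@le_trans _ _ (n.+1%:R * (K2 * (c n * sg ^+ n)))).
      by rewrite ler_pM2l ?ltr0n//; exact: (as2 n (leqnSn n)).
    have mr : mu * Num.sqrt n.+1%:R * c n <= c n.+1.
      exact: moment_ratioP (Cconst0 R) (@Cconst_gt0 R) (@CconstSS R) n.
    have cn0 : 0 < c n := Cconst_gt0 R n.
    apply: (@le_trans _ _ (K2 / mu * (n.+1%:R / sg * sg ^+ n.+1 * c n.+1))).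
      have -> : n.+1%:R * (K2 * (c n * sg ^+ n)) = K2 / mu * (n.+1%:R / sg * sg ^+ n.+1 * (mu * c n)).
        by rewrite exprS; field; rewrite !gt_eqF.
      apply: ler_wpM2l; first by apply: divr_ge0; exact: ltW.
      apply: ler_wpM2l; first by apply: mulr_ge0; [apply: divr_ge0|apply: exprn_ge0].
      apply: le_trans mr; rewrite ler_pM2r// ler_peMr//; exact: ltW.
    apply: ler_wpM2l; first by apply: divr_ge0; exact: ltW.
    rewrite -mulrA [sg ^+ _ * _]mulrC -/W; apply: ler_wpM2r => //.
    by rewrite ler_pM2r ?invr_gt0.
  apply: (@le_trans _ _ (K4 / sg * (K2 * W))).
    apply: ler_pM; [by rewrite invr_ge0 ltW| |exact: lsg|exact: (as2 n.+1 (leqnn _))].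
    by apply: (dev_mean_ge0 f N rb) => x; nonneg.
  have -> : K4 / sg * (K2 * W) = K4 * K2 * (1 / sg * W) by field; rewrite gt_eqF.
  apply: ler_wpM2l; first by apply: mulr_ge0; exact: ltW.
  by apply: ler_wpM2r => //; rewrite ler_pM2r ?invr_gt0.
have h2 : `|M - chi R n.+1 * W| <= K5 * (q / sg * W).
  rewrite (_ : M - chi R n.+1 * W = (M - Ef (fun x => x ^+ n.+1)) + (Ef (fun x => x ^+ n.+1) - chi R n.+1 * W)); last by ring.
  apply: le_trans (ler_normD _ _) _; rewrite /K5 mulrDl; apply: lerD => //.
  by rewrite [leRHS]mulrA.
have t1 : 1 <= t by clear -t20 s0 A0 A1 beta0 eta0 etas C0; lra.
have vt : `|sg ^+ 2 - t ^+ 2| <= D2 by rewrite sg2 t2.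
have pert : `|sg ^+ n.+1 - t ^+ n.+1| <= D2 * Ec * (q / t) * t ^+ n.+1.
  apply: le_trans (power_perturbation D20 t1 sgn0 vt (le_trans qn hm)) _.
  apply: ler_wpM2r; first exact: exprn_ge0.
  apply: ler_wpM2l; first exact: mulr_ge0.
  by rewrite ler_pM2r ?invr_gt0.
set Z := c n.+1 * t ^+ n.+1.
have tn : 0 <= t ^+ n.+1 by exact: exprn_ge0.
have Z0 : 0 <= Z by exact: mulr_ge0.
have WZ : W <= K6 * Z.
  rewrite /W /Z mulrCA; apply: ler_wpM2l => //.
  have qt : q / t <= h0 by rewrite ler_pdivrMr.
  have : D2 * Ec * (q / t) * t ^+ n.+1 <= D2 * Ec * h0 * t ^+ n.+1.
    by apply: ler_wpM2r => //; apply: ler_wpM2l => //; exact: mulr_ge0.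
  by have := ler_norm (sg ^+ n.+1 - t ^+ n.+1); rewrite /K6 mulrDl mul1r; clear -pert s0 A0 A1 beta0 eta0 etas C0; lra.
have h3 : K5 * (q / sg * W) <= 2 * K5 * K6 * (q / t) * Z.
  exact: rescale_error (ltW K50) (le_trans ler01 q1) t0 sgt W0 WZ.
have /andP[c0 c1] := chi_norm R n.+1.
have h4 : `|chi R n.+1 * W - chi R n.+1 * Z| <= D2 * Ec * (q / t) * Z.
  rewrite /W /Z -mulrBr -mulrBr normrM (ger0_norm c0) normrM (ger0_norm E0).
  apply: le_trans (ler_piMl _ c1) _; first by apply: mulr_ge0.
  by rewrite [leRHS]mulrCA; apply: ler_wpM2l.
rewrite (_ : M - chi R n.+1 * Z = (M - chi R n.+1 * W) + (chi R n.+1 * W - chi R n.+1 * Z)); last by ring.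
apply: le_trans (ler_normD _ _) _; rewrite mulrDl mulrDl; apply: lerD h4.
exact: le_trans h2 h3.
Qed.

End NormalisedMoments.

(** * Weights from the class of multiplicative functions *)

Lemma geometric_sum_le (R : realType) (z : R) k V : 0 <= z < 1 ->
  \sum_(k <= v < V) z ^+ v <= (1 - z)^-1.
Proof.
move=> /andP[z0 z1]; have d0 : 0 < 1 - z by lra.
have [kV|Vk] := leqP k V; last by rewrite big_geq ?(ltnW Vk)// invr_ge0 ltW.
apply: (@le_trans _ _ (\sum_(0 <= v < V) z ^+ v)).
  by rewrite [leRHS](big_cat_nat _ (n := k))//= lerDr sumr_ge0// => v _; exact: exprn_ge0.
rewrite -(ler_pM2l d0) mulfV ?gt_eqF// big_mkord.
have := subrX1 z V; have : 0 <= z ^+ V by exact: exprn_ge0.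
by move: (\sum_(_ < _) _) => W; lra.
Qed.

(** The exceptional primes are finitely many and contribute boundedly each. *)
Lemma sum_except_le (R : realType) (E : seq nat) (n : nat) (F : nat -> R) (K3 c : R) :
  (forall p, prime p -> 0 <= F p) -> 0 <= c ->
  \sum_(0 <= p < n.+1 | prime p && (p \notin E)) F p <= K3 ->
  (forall p, prime p -> F p <= c) ->
  \sum_(1 <= p < n.+1 | prime p) F p <= K3 + (size E)%:R * c.
Proof.
move=> F0 c0 hK hc; rewrite (bigID (fun p => p \in E))/= addrC; apply: lerD.
  by apply: le_trans hK; rewrite [leRHS]big_mkcond big_ltn//= add0r -big_mkcond.
apply: (@le_trans _ _ (\sum_(1 <= p < n.+1 | p \in E) c)).
  rewrite big_mkcond [leRHS]big_mkcond; apply: ler_sum => p _.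
  by case: (boolP (prime p)) => [/hc|] /=; case: (p \in E).
rewrite -big_filter big_const_seq count_predT iter_addr_0 -[leLHS]mulr_natl.
rewrite ler_wpM2r// ler_nat; apply: uniq_leq_size; first by rewrite filter_uniq// iota_uniq.
by move=> p; rewrite mem_filter => /andP[].
Qed.

(** Finite truncations of a nonnegative double series. *)
Lemma partial_double_sum_le (R : realType) (P : pred nat) (x : nat -> R) (y : nat -> nat -> R)
    (K : R) n V :
  (forall p, 0 <= x p) -> (forall p v, 0 <= y p v) ->
  (\sum_(0 <= p <oo | P p) ((x p)%:E + \sum_(2 <= v <oo) (y p v)%:E) <= K%:E)%E ->
  \sum_(0 <= p < n | P p) (x p + \sum_(2 <= v < V) y p v) <= K.
Proof.
move=> x0 y0 h; rewrite -lee_fin -sumEFin; apply: le_trans h.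
have s0 p : (0 <= \sum_(2 <= v <oo) (y p v)%:E)%E.
  by apply: nneseries_ge0 => v _ _; rewrite lee_fin.
apply: le_trans (nneseries_lim_ge n _); last first.
  by move=> p _ _; apply: adde_ge0 => //; rewrite lee_fin.
apply: lee_sum => p _; rewrite EFinD; apply: leeD => //.
rewrite -sumEFin; apply: (nneseries_lim_ge V) => v _ _; by rewrite lee_fin.
Qed.

Definition normalised_weight (R : realType) (alpha : nat -> R) (sigma0 : R) n :=
  alpha n / n%:R `^ sigma0.

(** eta is chosen at most 1 - r, so that the double sum in the third condition of [Mstar_with] dominates those with b,
    and at most (1 - rho0)/2, so that its first condition gives convergent geometric series at the exceptional primes. *)
Lemma Mstar_regular_weight (R : realType) (A0 beta sigma0 theta0 rho0 r K1 K2 : R)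
    (E : seq nat) (K3 K4 : R) :
  0 < A0 -> 0 < sigma0 -> 0 <= rho0 < 1 -> 0 < r < 1 ->
  exists A eta C : R, [/\ 0 < A <= 1, 0 < eta <= sigma0, 0 < C &
  forall alpha : nat -> R,
    Mstar_with A0 beta sigma0 theta0 rho0 r K1 K2 E K3 K4 alpha ->
    regular_weight A beta eta C (normalised_weight alpha sigma0)].
Proof.
move=> A00 sg0 /andP[rho00 rho01] /andP[r0 r1].
pose A : R := Num.min A0 1; pose k : R := (1 - rho0) / 2.
pose eta : R := Num.min (Num.min (1 - r) k) sigma0.
have k0 : 0 < k by rewrite /k; lra.
have eta_r : eta <= 1 - r by rewrite /eta !ge_min lexx.
have eta_k : eta <= k by rewrite /eta !ge_min lexx orbT.
have eta_s : eta <= sigma0 by rewrite /eta !ge_min lexx !orbT.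
have eta0 : 0 < eta by rewrite /eta !lt_min k0 sg0 andbT; lra.
have AA0 : A <= A0 by rewrite /A ge_min lexx.
have A1 : A <= 1 by rewrite /A ge_min lexx orbT.
have A0' : 0 < A by rewrite /A lt_min A00 ltr01.
pose z : R := 2 `^ (- k).
have z0 : 0 < z by exact: powR_gt0.
have z1 : z < 1.
  have : 1 `^ k < 2 `^ k :> R by apply: gt0_ltr_powR; rewrite ?nnegrE// ltr1n.
  by rewrite powR1 /z powRN invf_lt1 ?powR_gt0.
clearbody A eta.
have zg : 0 < (1 - z)^-1 by rewrite invr_gt0 subr_gt0.
set k1 := `|K1|; have k10 : 0 <= k1 by exact: normr_ge0.
pose c := k1 ^+ 2 + k1 * (1 - z)^-1.
have c0 : 0 <= c by rewrite /c; nonneg.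
pose C := 1 + `|K2| * 2 `^ (A0 - A) + (`|K3| + (size E)%:R * c) + k1.
have p1 : 0 <= `|K2| * 2 `^ (A0 - A) by nonneg.
have p2 : 0 <= `|K3| + (size E)%:R * c by nonneg.
exists A, eta, C; split; [by rewrite A0'|by rewrite eta0|by rewrite /C; move: p1 p2 k10; clear; lra|].
move=> alpha [_ _ [al1 alM] al0 [h1 h2 h3 _]].
set b := normalised_weight alpha sigma0.
have b0 n : 0 <= b n.
  rewrite /b /normalised_weight; case: n => [|n]; last by rewrite divr_ge0 ?powR_ge0// al0.
  by rewrite powR0 ?gt_eqF// invr0 mulr0.
have pge2 p : prime p -> 2 <= p%:R :> R by move=> pp; rewrite ler_nat prime_gt1.
have bpow p v : prime p -> (0 < v)%N -> b (p ^ v)%N <= k1 * p%:R `^ ((rho0 - 1) * v%:R).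
  move=> pp v0; have p2' := pge2 p pp; have pR : 0 < p%:R :> R by rewrite ltr0n prime_gt0.
  rewrite /b /normalised_weight natrX -powR_mulrn ?ler0n// -powRrM ler_pdivrMr ?powR_gt0//.
  rewrite -mulrA -powRD; last by rewrite (gt_eqF pR) implybT.
  rewrite (_ : _ + _ = (rho0 + sigma0 - 1) * v%:R); last by ring.
  by apply: le_trans (h1 p v pp v0) _; rewrite ler_wpM2r ?powR_ge0// ler_norm.
have powle p (x y : R) : prime p -> x <= y -> p%:R `^ x <= p%:R `^ y :> R.
  by move=> pp xy; apply: ler_powR => //; have := pge2 p pp; lra.
have pow_le1 p (x : R) : prime p -> x <= 0 -> p%:R `^ x <= 1 :> R.
  by move=> pp x0; have := powle p x 0 pp x0; rewrite powRr0.
have blek1 p : prime p -> b p <= k1.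
  move=> pp; have := bpow p 1%N pp isT; rewrite expn1 mulr1 => h; apply: le_trans h _.
  by rewrite ler_piMr// pow_le1//; lra.
pose x p := alpha p ^+ 2 / p%:R `^ (2 * (r + sigma0 - 1)).
pose y p v := alpha (p ^ v)%N / p%:R `^ ((r + sigma0 - 1) * v%:R).
have yge p v : prime p -> b (p ^ v)%N * (p ^ v)%:R `^ eta <= y p v.
  move=> pp; have p2' := pge2 p pp; have pR : 0 < p%:R :> R by rewrite ltr0n prime_gt0.
  have pv : (0 < p ^ v)%N by rewrite expn_gt0 prime_gt0.
  rewrite /b /normalised_weight /y natrX -powR_mulrn ?ler0n// -!powRrM -mulrA; apply: ler_wpM2l; first exact: al0.
  rewrite -powRN -powRD; last by rewrite (gt_eqF pR) implybT.
  rewrite -powRN; apply: powle => //.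
  have : 0 <= (1 - r - eta) * v%:R by apply: mulr_ge0 => //; lra.
  lra.
have xge p : prime p -> b p ^+ 2 <= x p.
  move=> pp; have p2' := pge2 p pp; have pR : 0 < p%:R :> R by rewrite ltr0n prime_gt0.
  rewrite /b /normalised_weight /x expr_div_n; apply: ler_wpM2l; first exact: sqr_ge0.
  rewrite -powR_mulrn ?powR_ge0// -powRrM -!powRN; apply: powle => //; lra.
have x0 p : 0 <= x p by rewrite /x divr_ge0 ?sqr_ge0 ?powR_ge0.
have tail_b p V : prime p -> \sum_(2 <= v < V) b (p ^ v)%N * (p ^ v)%:R `^ eta <= k1 * (1 - z)^-1.
  move=> pp; have p2' := pge2 p pp; have pR : 0 < p%:R :> R by rewrite ltr0n prime_gt0.
  apply: (@le_trans _ _ (k1 * \sum_(2 <= v < V) z ^+ v)); last first.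
    by rewrite ler_wpM2l// geometric_sum_le// (ltW z0).
  rewrite mulr_sumr big_nat_cond [leRHS]big_nat_cond; apply: ler_sum => v /andP[/andP[v2 _] _].
  apply: le_trans (ler_wpM2r _ (bpow p v pp (ltnW v2))) _; first exact: powR_ge0.
  rewrite -mulrA ler_wpM2l// natrX -[X in X `^ eta]powR_mulrn ?ler0n// -powRrM.
  rewrite -powRD; last by rewrite (gt_eqF pR) implybT.
  apply: (@le_trans _ _ (p%:R `^ (- k * v%:R))).
    apply: powle => //; have : 0 <= (k - eta) * v%:R by apply: mulr_ge0 => //; lra.
    by rewrite /k; lra.
  rewrite /z -[leRHS]powR_mulrn ?powR_ge0// -powRrM !mulNr !powRN lef_pV2 ?posrE ?powR_gt0//.
  by apply: ge0_ler_powR; rewrite ?nnegrE ?ler0n//; apply: mulr_ge0 => //; exact: ltW.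
have dbl n V : \sum_(1 <= p < n.+1 | prime p)
    (b p ^+ 2 + \sum_(2 <= v < V) b (p ^ v)%N * (p ^ v)%:R `^ eta) <= `|K3| + (size E)%:R * c.
  apply: sum_except_le => //.
  - move=> p pp; apply: addr_ge0; first exact: sqr_ge0.
    by apply: sumr_ge0 => v _; rewrite mulr_ge0 ?powR_ge0.
  - apply: (@le_trans _ _ (\sum_(0 <= p < n.+1 | prime p && (p \notin E))
       (x p + \sum_(2 <= v < V) if prime p then y p v else 0))).
      apply: ler_sum => p /andP[pp _]; rewrite pp; apply: lerD; first exact: xge.
      by apply: ler_sum => v _; exact: yge.
    apply: le_trans (ler_norm K3).
    apply: (partial_double_sum_le (P := fun p => prime p && (p \notin E))) => //.
      move=> p v; case: ifP => // pp; rewrite /y divr_ge0 ?powR_ge0// al0//.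
      by rewrite expn_gt0 prime_gt0.
    apply: le_trans h3; rewrite le_eqVlt; apply/orP; left; apply/eqP.
    by apply: eq_eseriesr => p /andP[pp _]; rewrite pp.
  move=> p pp; rewrite /c; apply: lerD; last exact: tail_b.
  by rewrite ler_sqr ?nnegrE ?b0//; exact: blek1.
split.
- exact: b0.
- by rewrite /b /normalised_weight al1 powR1 divr1.
- move=> m n m0 n0 mn; rewrite /b /normalised_weight alM// natrM powRM// invfM; ring.
- move=> n n1.
  have n2 : 2 <= n%:R :> R by rewrite ler_nat.
  have ln2 : 2^-1 <= ln (n%:R : R).
    by apply: le_trans (ln2_ge_half R) _; rewrite ler_ln ?posrE//; move: n2; clear; lra.
  have := h2 n%:R n2; rewrite (truncn_def (n := n)) ?lexx ?ltr_nat ?ltnSn// => hn.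
  have -> : \sum_(1 <= p < n.+1 | prime p) b p * p%:R * ln p%:R =
      \sum_(1 <= p < n.+1 | prime p) alpha p * ln p%:R / p%:R `^ (sigma0 - 1).
    apply: eq_bigr => p pp; have p2' := pge2 p pp; have pR : 0 < p%:R :> R by rewrite ltr0n prime_gt0.
    rewrite /b /normalised_weight powRB ?(gt_eqF pR) ?implybT// powRr1 ?ltW//.
    by field; rewrite !gt_eqF ?powR_gt0.
  apply: le_trans hn _; apply: (@le_trans _ _ (`|K2| * 2 `^ (A0 - A) * (n%:R / ln n%:R `^ A))).
    have l0 : 0 < ln (n%:R : R) by move: ln2; clear; lra.
    apply: (@le_trans _ _ (`|K2| * (n%:R / ln n%:R `^ A0))).
      by rewrite ler_wpM2r ?ler_norm// divr_ge0 ?powR_ge0// ler0n.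
    rewrite -mulrA ler_wpM2l// [leRHS]mulrCA; apply: ler_wpM2l; first exact: ler0n.
    rewrite ler_pdivlMr ?powR_gt0// -powRN -powRD; last by rewrite (gt_eqF l0) implybT.
    rewrite (_ : - A0 + A = - (A0 - A)); last by ring.
    have e0 : 0 <= A0 - A by rewrite subr_ge0.
    have h : (2^-1) `^ (A0 - A) <= ln (n%:R : R) `^ (A0 - A).
      by apply: ge0_ler_powR; rewrite ?nnegrE//; move: ln2; clear; lra.
    have i2 : 2 `^ (A0 - A) * (2^-1) `^ (A0 - A) = 1 :> R.
      by rewrite -powRM ?invr_ge0// mulfV ?powR1// pnatr_eq0.
    rewrite powRN -[leLHS]mul1r ler_pdivrMr ?powR_gt0//.
    by rewrite -[leLHS]i2; apply: ler_wpM2l => //; exact: powR_ge0.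
  apply: ler_wpM2r; first by apply: divr_ge0; [exact: ler0n|exact: powR_ge0].
  by rewrite /C; move: p1 p2 k10; clear; lra.
- move=> n; have := dbl n 0%N; under eq_bigr do rewrite big_geq// addr0.
  by move=> h; apply: le_trans h _; rewrite /C; move: p1 p2 k10; clear; lra.
- move=> n V; have h := dbl n V.
  apply: (@le_trans _ _ (`|K3| + (size E)%:R * c)); last by rewrite /C; move: p1 p2 k10; clear; lra.
  by apply: le_trans h; apply: ler_sum => p _; rewrite lerDr sqr_ge0.
- move=> p pp; have := bpow p 1%N pp isT; rewrite expn1 mulr1 => h; apply: le_trans h _.
  apply: ler_pM; [exact: k10|exact: powR_ge0|by rewrite /C; move: p1 p2 k10; clear; lra|].
  by apply: powle => //; rewrite /k in eta_k; lra.
Qed.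

(** * The moment theorem *)

Lemma powR_three_halves (R : realType) (x : R) : 0 <= x -> x `^ (3 / 2) = x * Num.sqrt x.
Proof.
move=> x0; have [->|xn0] := eqVneq x 0.
  by rewrite powR0 ?mul0r//; apply/negP => /eqP; lra.
rewrite (_ : 3 / 2 = 1 + 2^-1); last by lra.
by rewrite powRD ?xn0 ?implybT// powRr1// powR12_sqrt.
Qed.

Lemma powR_half_natmul (R : realType) (x : R) m : 0 <= x -> x `^ (m%:R / 2) = Num.sqrt x ^+ m.
Proof.
move=> x0; rewrite -powR_mulrn ?sqrtr_ge0// -powR12_sqrt// -powRrM.
by congr (_ `^ _); rewrite mulrC.
Qed.

Lemma relative_error (R : realType) (M B Z : R) m : 0 < B ->
  `|M - chi R m * (Cconst R m * Num.sqrt B ^+ m)| <= Z * (Cconst R m * Num.sqrt B ^+ m) ->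
  exists2 e : R, `|e| <= Z & M = Cconst R m * B `^ (m%:R / 2) * (chi R m + e).
Proof.
move=> B0; rewrite powR_half_natmul ?(ltW B0)//.
have W0 : 0 < Cconst R m * Num.sqrt B ^+ m by rewrite mulr_gt0 ?Cconst_gt0// exprn_gt0// sqrtr_gt0.
move: (Cconst R m * _) W0 => W W0 h; exists ((M - chi R m * W) / W).
  by rewrite normrM normfV (gtr0_norm W0) ler_pdivrMr.
by field; rewrite gt_eqF.
Qed.

(** Both f and the moments are homogeneous, which reduces to M = 1.  When the parameters violate the constraints
    of the class there is nothing to prove, but a constant K must still be produced. *)
Lemma uniform_moments (R : realType) (A0 beta sigma0 theta0 rho0 r K1 K2 : R)
    (E : seq nat) (K3 K4 h0 : R) : 0 < h0 -> exists2 K : R, 0 < K &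
  forall (alpha f : nat -> R) (M : R),
    Mstar_with A0 beta sigma0 theta0 rho0 r K1 K2 E K3 K4 alpha ->
    strongly_additive f -> 0 < M -> (forall p : nat, prime p -> `|f p| <= M) ->
    Bsum alpha f sigma0 x @[x --> +oo] --> +oo ->
    \forall x \near +oo, 0 < Bsum alpha f sigma0 x /\
      forall m : nat, (1 <= m)%N ->
      m%:R `^ (3 / 2) <= h0 * (Num.sqrt (Bsum alpha f sigma0 x) / M) ->
      `|Mmoment alpha f sigma0 x m -
          chi R m * (Cconst R m * Num.sqrt (Bsum alpha f sigma0 x) ^+ m)| <=
      K * (M * m%:R `^ (3 / 2) / Num.sqrt (Bsum alpha f sigma0 x)) *
        (Cconst R m * Num.sqrt (Bsum alpha f sigma0 x) ^+ m).
Proof.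
move=> h00.
have [/and5P[A00 b0 s0 rho01 r01]|bad] :=
  boolP [&& 0 < A0, 0 < beta, 0 < sigma0, 0 <= rho0 < 1 & 0 < r < 1]; last first.
  exists 1 => // alpha f M [[a1 a2 a3] [_ a4 a5]] _ _ _.
  by move: bad; rewrite a1 a2 a3 a4 a5.
have [A [eta [C [/andP[A0' A1] /andP[eta0 etas] C0 reg]]]] :=
  @Mstar_regular_weight R A0 beta sigma0 theta0 rho0 r K1 K2 E K3 K4 A00 s0 rho01 r01.
have [K [L1 [B1 [K0 main]]]] := normalised_moments s0 A0' A1 b0 eta0 etas C0 h00.
exists K => // alpha f M hal fa M0 fM hB.
have rb := reg alpha hal; set b := normalised_weight alpha sigma0 in rb.
pose g n := f n / M.
have Mn0 : M != 0 by rewrite gt_eqF.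
have ga : strongly_additive g.
  have [fa1 fa2] := fa; split=> [m n m0 n0 mn|p v pp v0]; rewrite /g; first by rewrite fa1// mulrDl.
  by rewrite fa2.
have g1 p : prime p -> `|g p| <= 1.
  by move=> pp; rewrite /g normrM normfV (gtr0_norm M0) ler_pdivrMr// mul1r fM.
have fg n : f n = M * g n by rewrite /g; field.
have BE x : Bsum alpha f sigma0 x = M ^+ 2 * prime_variance b g (Num.truncn x).
  by rewrite /Bsum /prime_variance mulr_sumr; apply: eq_bigr => p _;
    rewrite fg /b /normalised_weight; ring.
have AE x : Asum alpha f sigma0 x = M * prime_mean b g (Num.truncn x).
  by rewrite /Asum /prime_mean mulr_sumr; apply: eq_bigr => p _;
    rewrite fg /b /normalised_weight; ring.
have alE n : (0 < n)%N -> b n * n%:R `^ sigma0 = alpha n.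
  by move=> n0; rewrite /b /normalised_weight divfK// gt_eqF// powR_gt0// ltr0n.
have ME x m : Mmoment alpha f sigma0 x m = M ^+ m *
    ((\sum_(1 <= n < (Num.truncn x).+1) b n * n%:R `^ sigma0)^-1 *
     \sum_(1 <= n < (Num.truncn x).+1) b n * n%:R `^ sigma0 * (g n - prime_mean b g (Num.truncn x)) ^+ m).
  rewrite mulrCA /Mmoment /Ssum; congr (_^-1 * _).
    by apply: eq_big_nat => n /andP[n0 _]; rewrite alE.
  rewrite mulr_sumr; apply: eq_big_nat => n /andP[n0 _]; rewrite alE// AE fg -mulrBr exprMn.
  by rewrite mulrCA.
have near1 : \forall x \near +oo, M ^+ 2 * (Num.max 1 B1) <= Bsum alpha f sigma0 x by move/cvgryPge : hB; apply.
have near2 : \forall x \near +oo, expR L1 + 1 <= x by apply: nbhs_pinfty_ge; rewrite num_real.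
near=> x.
have hBx : M ^+ 2 * (Num.max 1 B1) <= Bsum alpha f sigma0 x by near: x.
have hx : expR L1 + 1 <= x by near: x.
have M20 : 0 < M ^+ 2 by exact: exprn_gt0.
set N := Num.truncn x.
have : Num.max 1 B1 <= prime_variance b g N by rewrite -(ler_pM2l M20) -BE.
rewrite ge_max => /andP[pv1 pvB].
have pv0 : 0 < prime_variance b g N by apply: lt_le_trans pv1.
have sqB : Num.sqrt (Bsum alpha f sigma0 x) = M * Num.sqrt (prime_variance b g N).
  by rewrite BE sqrtrM ?(ltW M20)// sqrtr_sqr gtr0_norm.
have lnN : L1 <= ln (N%:R : R).
  have e : expR L1 <= N%:R.
    by have := truncnS_gt x; rewrite -/N -natr1; lra.
  by rewrite -[leLHS]expRK ler_ln ?posrE ?expR_gt0// (lt_le_trans (expR_gt0 L1)).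
split; first by rewrite BE mulr_gt0.
move=> m m1; rewrite sqB powR_three_halves// ME -/N => hm.
set t := Num.sqrt (prime_variance b g N) in hm *.
have t0 : 0 < t by rewrite sqrtr_gt0.
have hm' : m%:R * Num.sqrt m%:R <= h0 * t by move: hm; rewrite [M * t]mulrC mulfK.
have := main b g N m rb ga g1 lnN pvB m1 hm'; rewrite -/t.
set X := (X in `|X - _|) => hX.
have -> : M ^+ m * X - chi R m * (Cconst R m * (M * t) ^+ m) =
  M ^+ m * (X - chi R m * (Cconst R m * t ^+ m)) by rewrite exprMn; ring.
have Mm : 0 < M ^+ m by exact: exprn_gt0.
rewrite normrM (gtr0_norm Mm).
have -> : K * (M * (m%:R * Num.sqrt m%:R) / (M * t)) * (Cconst R m * (M * t) ^+ m) =
   M ^+ m * (K * (m%:R * Num.sqrt m%:R / t) * (Cconst R m * t ^+ m)).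
  by rewrite exprMn; field; rewrite Mn0 gt_eqF.
by rewrite ler_pM2l.
Unshelve. all: by end_near.
Qed.

Theorem theorem2p1 (R : realType) (A0 beta sigma0 theta0 rho0 r : R)
    (K1 K2 : R) (E : seq nat) (K3 K4 : R) :
  (beta = 1 ->
   forall h0 : R, 0 < h0 < (3 / 2) `^ (2 / 3) ->
   exists2 K : R, 0 < K &
   forall (alpha f : nat -> R) (M : R),
     Mstar_with A0 beta sigma0 theta0 rho0 r K1 K2 E K3 K4 alpha ->
     strongly_additive f -> 0 < M ->
     (forall p : nat, prime p -> `|f p| <= M) ->
     Bsum alpha f sigma0 x @[x --> +oo] --> +oo ->
     \forall x \near +oo, forall m : nat, (1 <= m)%N ->
       m%:R <= h0 * (Bsum alpha f sigma0 x / M ^+ 2) `^ (1 / 3) ->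
       exists2 e : R,
         `|e| <= K * (M * m%:R `^ (3 / 2) / Num.sqrt (Bsum alpha f sigma0 x)) &
         Mmoment alpha f sigma0 x m =
           Cconst R m * Bsum alpha f sigma0 x `^ (m%:R / 2) * (chi R m + e))
  /\
  (beta <> 1 ->
   forall c : R, 0 < c ->
   exists2 K : R, 0 < K &
   forall (alpha f : nat -> R) (M : R),
     Mstar_with A0 beta sigma0 theta0 rho0 r K1 K2 E K3 K4 alpha ->
     strongly_additive f -> 0 < M ->
     (forall p : nat, prime p -> `|f p| <= M) ->
     Bsum alpha f sigma0 x / logloglog x ^+ 2 @[x --> +oo] --> +oo ->
     \forall x \near +oo, forall m : nat, (1 <= m)%N ->
       m%:R <= c * (Bsum alpha f sigma0 x `^ (1 / 3)
                    / logloglog x `^ (2 / 3)) ->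
       exists2 e : R,
         `|e| <= K * (M * m%:R `^ (3 / 2) * logloglog x
                      / Num.sqrt (Bsum alpha f sigma0 x)) &
         Mmoment alpha f sigma0 x m =
           Cconst R m * Bsum alpha f sigma0 x `^ (m%:R / 2) * (chi R m + e)).
Proof.
split=> [_ h0 /andP[h00 _]|_ c c0].
  have h320 : 0 < h0 `^ (3 / 2) by exact: powR_gt0.
  have [K K0 HK] := @uniform_moments R A0 beta sigma0 theta0 rho0 r K1 K2 E K3 K4 _ h320.
  exists K => // alpha f M hal fa M0 fM hB.
  have := HK alpha f M hal fa M0 fM hB; apply: filterS => x [B0 hm] m m1 mle.
  apply: relative_error => //; apply: hm => //.
  move: mle; set y := Bsum alpha f sigma0 x / M ^+ 2 => mle.
  have M20 : 0 < M ^+ 2 by exact: exprn_gt0.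
  have y0 : 0 < y by rewrite divr_gt0.
  have -> : Num.sqrt (Bsum alpha f sigma0 x) / M = Num.sqrt y.
    by rewrite /y sqrtrM ?(ltW B0)// sqrtrV ?(ltW M20)// sqrtr_sqr gtr0_norm.
  have -> : h0 `^ (3 / 2) * Num.sqrt y = (h0 * y `^ (1 / 3)) `^ (3 / 2).
    rewrite powRM ?powR_ge0 ?(ltW h00)// -powRrM -powR12_sqrt ?(ltW y0)//.
    by congr (_ * _ `^ _); field.
  apply: ge0_ler_powR => //; rewrite ?nnegrE ?ler0n//.
  by rewrite mulr_ge0 ?powR_ge0// ltW.
have [K K0 HK] := @uniform_moments R A0 beta sigma0 theta0 rho0 r K1 K2 E K3 K4 1 ltr01.
exists K => // alpha f M hal fa M0 fM hB.
have lll (Y : R) : \forall x \near +oo, Y <= logloglog x.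
  have : \forall x \near +oo, expR (expR (expR Y)) <= x :> R by apply: nbhs_pinfty_ge; rewrite num_real.
  apply: filterS => x hx; rewrite /logloglog.
  have up (a z : R) : expR a <= z -> a <= ln z.
    by move=> az; rewrite -[leLHS]expRK ler_ln ?posrE ?expR_gt0// (lt_le_trans (expR_gt0 a)).
  by apply: (up); apply: (up); apply: (up).
have hB' : Bsum alpha f sigma0 x @[x --> +oo] --> +oo.
  apply/cvgryPge => Y; move/cvgryPge : hB => /(_ `|Y|) hB.
  near=> x.
  have h1 : `|Y| <= Bsum alpha f sigma0 x / logloglog x ^+ 2 by near: x.
  have l1 : 1 <= logloglog x by near: x; exact: lll.
  have l2 : 1 <= logloglog x ^+ 2 by exact: exprn_ege1.
  apply: le_trans (ler_norm Y) _; move: h1; rewrite ler_pdivlMr; last by lra.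
  by apply: le_trans; rewrite ler_peMr.
have := HK alpha f M hal fa M0 fM hB' => near1.
near=> x => m m1 mle.
have [B0 hm] : 0 < Bsum alpha f sigma0 x /\ forall m : nat, (1 <= m)%N ->
      m%:R `^ (3 / 2) <= 1 * (Num.sqrt (Bsum alpha f sigma0 x) / M) ->
      `|Mmoment alpha f sigma0 x m -
          chi R m * (Cconst R m * Num.sqrt (Bsum alpha f sigma0 x) ^+ m)| <=
      K * (M * m%:R `^ (3 / 2) / Num.sqrt (Bsum alpha f sigma0 x)) *
        (Cconst R m * Num.sqrt (Bsum alpha f sigma0 x) ^+ m) by near: x.
have l1 : 1 <= logloglog x by near: x; exact: lll.
have lc : c `^ (3 / 2) * M <= logloglog x by near: x; exact: lll.
set B := Bsum alpha f sigma0 x in B0 hm mle *; set l := logloglog x in l1 lc mle *.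
have l0 : 0 < l by lra.
have sB : 0 < Num.sqrt B by rewrite sqrtr_gt0.
have small : m%:R `^ (3 / 2) <= 1 * (Num.sqrt B / M).
  apply: (@le_trans _ _ ((c * (B `^ (1 / 3) / l `^ (2 / 3))) `^ (3 / 2))).
    apply: ge0_ler_powR => //; rewrite ?nnegrE ?ler0n//.
    by rewrite mulr_ge0 ?divr_ge0 ?powR_ge0// ltW.
  have c32 : 0 <= c `^ (3 / 2) by exact: powR_ge0.
  have -> : (c * (B `^ (1 / 3) / l `^ (2 / 3))) `^ (3 / 2) = c `^ (3 / 2) * (Num.sqrt B / l).
    rewrite powRM ?(ltW c0) ?divr_ge0 ?powR_ge0//; congr (_ * _).
    rewrite powRM ?invr_ge0 ?powR_ge0// -powRN -!powRrM -powR12_sqrt ?(ltW B0)//.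
    rewrite (_ : 1 / 3 * (3 / 2) = 2^-1); last by field.
    by rewrite (_ : - (2 / 3) * (3 / 2) = - 1) ?powRN ?powRr1 ?(ltW l0)//; field.
  rewrite mul1r ler_pdivlMr// mulrC mulrCA mulrA mulrA ler_pdivrMr//.
  rewrite [leRHS]mulrC ler_wpM2r ?(ltW sB)//; lra.
have := relative_error B0 (hm m m1 small) => -[e he Me]; exists e => //.
apply: le_trans he _; rewrite ler_pM2l// ler_pM2r ?invr_gt0// ler_peMr//.
by apply: mulr_ge0; [exact: ltW|exact: powR_ge0].
Unshelve. all: by end_near.
Qed.
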